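(* Let $0 < s < d$, let $m$ be a finite nonnegative Borel measure in $\mathbb{R}^d$, and let $V_s(x) = \int_{\mathbb{R}^d} \frac{x-y}{|x-y|^{s+1}}\,\mathrm{d}m(y)$ (defined for almost every $x \in \mathbb{R}^d$). A point $a \in \mathbb{R}^d$ is a Lebesgue point of $V_s$ if and only if the principal value of $V_s$ exists at $a$ and $$\lim_{r \to 0} \frac{m(B_r(a))}{r^s} = 0.$$ One then has $$\widehat{V_s}(a) = \mathrm{p.v.}\,V_s(a).$$
   Context: $d \ge 1$ is an integer and $B_r(a)$ is the ball in $\mathbb{R}^d$ of radius $r$ centered at $a$. The function $V_s$ is $\mathbb{R}^d$-valued and well-defined at every point of $\mathrm{dom}\,V_s = \{x \in \mathbb{R}^d : \int_{\mathbb{R}^d} |x-y|^{-s}\,\mathrm{d}m(y) < \infty\}$, whose complement is Lebesgue-negligible. A point $a \in \mathbb{R}^d$ is a Lebesgue point of $V_s$ if there exists $\alpha \in \mathbb{R}^d$ such that $\lim_{r \to 0} \frac{1}{|B_r(a)|}\int_{B_r(a)} |V_s(x) - \alpha| \,\mathrm{d}x = 0$, where $|B_r(a)|$ and $\mathrm{d}x$ refer to $d$-dimensional Lebesgue measure. Such an $\alpha$ is unique, is called the precise representative of $V_s$ at $a$, and is denoted $\widehat{V_s}(a)$. The principal value of $V_s$ at $a$ is $$\mathrm{p.v.}\,V_s(a) = \lim_{\epsilon \to 0} \int_{\mathbb{R}^d \setminus B_\epsilon(a)} \frac{a-y}{|a-y|^{s+1}}\,\mathrm{d}m(y),$$ whenever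 this limit exists (in $\mathbb{R}^d$). *)

(* Defs.v *)
From HB Require Import structures.
From mathcomp Require Import all_boot all_order all_algebra.
From mathcomp Require Import all_classical all_reals all_analysis.
From mathcomp Require Import lra.

Set Implicit Arguments.
Unset Strict Implicit.
Unset Printing Implicit Defensive.
Import Order.TTheory GRing.Theory Num.Theory.
Import numFieldNormedType.Exports.

Local Open Scope classical_set_scope.
Local Open Scope ring_scope.

(* Borel sigma-algebra on R^d = 'rV[R]_d (more generally on matrices). *)
HB.instance Definition _ (R : realType) (p q : nat) :=
  @isMeasurable.Build (sigma_display (@open 'M[R]_(p, q))) 'M[R]_(p, q)
    <<s @open 'M[R]_(p, q) >> (@sigma_algebra0 _ setT _) (@sigma_algebraC _ _)
    (@sigma_algebra_bigcup _ setT _).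

Section borel_vectors.
Context {R : realType}.

Lemma measurable_open_rV n (U : set 'rV[R]_n) : open U -> measurable U.
Proof. exact: sub_sigma_algebra. Qed.

Lemma measurable_coord n (i : 'I_n) :
  measurable_fun [set: 'rV[R]_n] (fun x => x ord0 i).
Proof.
apply: (measurability _ (measurable_realfun.RGenOpens.measurableE R)).
move=> _ [_ [a [b ->]] <-]; rewrite setTI; apply: measurable_open_rV.
apply: open_comp; last exact: interval_open.
by move=> x _; exact: coord_continuous.
Qed.

Lemma measurable_fun_rV d (T : measurableType d) n (f : T -> 'rV[R]_n) :
  (forall i, measurable_fun setT (fun t => f t ord0 i)) ->
  measurable_fun setT f.
Proof.
move=> mf; apply: (measurability (@open 'rV[R]_n)) => //.
move=> _ [U oU <-]; rewrite setTI.
pose box (q : {ffun 'I_n -> rat * rat}) : set 'rV[R]_n :=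
  [set x | forall i, ratr (q i).1 < x ord0 i < ratr (q i).2].
pose F q := if pselect (box q `<=` U) then f @^-1` box q else set0.
have -> : f @^-1` U = \bigcup_q F q.
  apply/seteqP; split => [t /= Uft|t [q _]]; last first.
    by rewrite /F; case: pselect => // qU /qU.
  have [P nP PU] : nbhs (f t) U by exact: open_nbhs_nbhs.
  have /choice[q qP] (i : 'I_n) : exists q : rat * rat,
      (ratr q.1 < f t ord0 i < ratr q.2) /\
      (forall y : R, ratr q.1 < y < ratr q.2 -> P ord0 i y).
    have /nbhs_ballP[e /= e0 eP] := nP ord0 i.
    have [|q1] := @rat_in_itvoo R (f t ord0 i - e) (f t ord0 i); first lra.
    have [|q2] := @rat_in_itvoo R (f t ord0 i) (f t ord0 i + e); first lra.
    rewrite !in_itv/= => /andP[q2l q2r] /andP[q1l q1r].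
    exists (q1, q2); rewrite /= q1r q2l; split => // y.
    move=> /andP[y1 y2]; apply: eP => /=.
    by rewrite /ball/= ltr_norml; apply/andP; split; lra.
  exists (finfun q) => //; rewrite /F; case: pselect => [qU|[]] /=.
    by move=> i; rewrite ffunE; have [] := qP i.
  move=> x bx; apply: PU => i j; rewrite (ord1 i).
  by have [_] := qP j; apply; have := bx j; rewrite ffunE.
apply: countable_bigcupT_measurable => [|q].
  exact: countableP.
rewrite /F; case: (pselect (box q `<=` U)) => [qU|nqU]; last exact: measurable0.
have -> : f @^-1` box q = \bigcap_(i in [set: 'I_n])
    ((fun t => f t ord0 i) @^-1` `](ratr (q i).1), (ratr (q i).2)[).
  apply/seteqP; split => [t tq i _|t tq i] /=.
    by rewrite in_itv/=; exact: tq.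
  by have := tq i I; rewrite /= in_itv.
apply: fin_bigcap_measurable => // i _.
by rewrite -[X in measurable X]setTI; exact: mf.
Qed.

End borel_vectors.

Section lebesgue_vectors.
Context {R : realType}.

Definition vcons n (p : R * 'rV[R]_n) : 'rV[R]_n.+1 :=
  row_mx (p.1%:M : 'rV[R]_1) p.2.

Lemma vcons0 n (p : R * 'rV[R]_n) : vcons p ord0 ord0 = p.1.
Proof.
have -> : (ord0 : 'I_n.+1) = lshift n (ord0 : 'I_1) by exact: val_inj.
by rewrite /vcons (row_mxEl (p.1%:M : 'rV_1)) mxE eqxx.
Qed.

Lemma vconsS n (p : R * 'rV[R]_n) (i : 'I_n) :
  vcons p ord0 (lift ord0 i) = p.2 ord0 i.
Proof.
have -> : lift ord0 i = rshift 1 i by exact: val_inj.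
by rewrite /vcons (row_mxEr (p.1%:M : 'rV_1)).
Qed.

Lemma vcons_surj n (x : 'rV[R]_n.+1) :
  vcons (x ord0 ord0, \row_i x ord0 (lift ord0 i)) = x.
Proof.
apply/rowP => i; case: (unliftP ord0 i) => [j|] ->; last by rewrite vcons0.
by rewrite vconsS mxE.
Qed.

Lemma measurable_vcons n : measurable_fun [set: R * 'rV[R]_n] (@vcons n).
Proof.
apply: measurable_fun_rV => i; case: (unliftP ord0 i) => [j|] ->.
  under eq_fun do rewrite vconsS.
  exact: measurableT_comp (measurable_coord j) measurable_snd.
by under eq_fun do rewrite vcons0; exact: measurable_fst.
Qed.

Section step.
Variables (n : nat) (mu : {sigma_finite_measure set 'rV[R]_n -> \bar R}).

Definition lebesgueS : set 'rV[R]_n.+1 -> \bar R :=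
  pushforward (@lebesgue_measure R \x mu)%E (@vcons n).

Let lebesgueS0 : lebesgueS set0 = 0%E.
Proof. by rewrite /lebesgueS /pushforward preimage_set0 measure0. Qed.

Let lebesgueS_ge0 A : (0 <= lebesgueS A)%E.
Proof. by rewrite /lebesgueS /pushforward; exact: measure_ge0. Qed.

Let lebesgueS_additive : semi_sigma_additive lebesgueS.
Proof.
have mv A : measurable A -> measurable (@vcons n @^-1` A).
  by move=> mA; rewrite -[X in measurable X]setTI; exact: measurable_vcons.
move=> F mF tF mUF; rewrite /lebesgueS /pushforward preimage_bigcup.
apply: measure_semi_sigma_additive.
- by move=> k; exact: mv.
- by apply/trivIsetP => i j _ _ ij; rewrite -preimage_setI;
    move/trivIsetP : tF => /(_ _ _ _ _ ij) ->//; rewrite preimage_set0.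
- by rewrite -preimage_bigcup; exact: mv.
Qed.

HB.instance Definition _ :=
  isMeasure.Build _ _ _ lebesgueS lebesgueS0 lebesgueS_ge0 lebesgueS_additive.

Let lebesgueS_sigma_finite : sigma_finite setT lebesgueS.
Proof.
have /sigma_finiteP[F [TF ndF Foo]] := sigma_finiteT (@lebesgue_measure R).
have /sigma_finiteP[G [TG ndG Goo]] := sigma_finiteT mu.
pose g (x : 'rV[R]_n.+1) := (x ord0 ord0, \row_i x ord0 (lift ord0 i)).
have mg : measurable_fun setT g.
  apply/measurable_fun_pairP; split; first exact: measurable_coord.
  apply: measurable_fun_rV => i /=.
  by under eq_fun do rewrite mxE; exact: measurable_coord.
exists (fun k => g @^-1` (F k `*` G k)).
  apply/seteqP; split => // x _.
  have [i _ Fi] : (\bigcup_i F i) (g x).1 by rewrite -TF.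
  have [j _ Gj] : (\bigcup_i G i) (g x).2 by rewrite -TG.
  exists (maxn i j) => //; split.
    by move: Fi; exact/subsetPset/ndF/leq_maxl.
  by move: Gj; exact/subsetPset/ndG/leq_maxr.
move=> k; have [mF Fkoo] := Foo k; have [mG Gkoo] := Goo k; split.
  by rewrite -[X in measurable X]setTI; apply: mg => //; exact: measurableX.
rewrite /lebesgueS /pushforward -comp_preimage (_ : g \o @vcons n = id).
  by rewrite preimage_id product_measure1E// lte_mul_pinfty// ge0_fin_numE.
apply/funext => -[x v] /=; rewrite /g vcons0; congr pair.
by apply/rowP => i; rewrite mxE vconsS.
Qed.

HB.instance Definition _ :=
  Measure_isSigmaFinite.Build _ _ _ lebesgueS lebesgueS_sigma_finite.

End step.

(* d-dimensional Lebesgue measure, as the d-fold product of the Lebesgue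
   measure on R; see [lebesgue_rV_prod] for its value on boxes. *)
Fixpoint lebesgue_rV d : {sigma_finite_measure set 'rV[R]_d -> \bar R} :=
  match d with
  | 0 => dirac (0 : 'rV[R]_0)
  | n.+1 => lebesgueS (lebesgue_rV n)
  end.

Lemma lebesgue_rV_prod d (A : 'I_d -> set R) :
  (forall i, measurable (A i)) ->
  lebesgue_rV d [set x | forall i, A i (x ord0 i)] =
  (\prod_(i < d) lebesgue_measure (A i))%E.
Proof.
elim: d A => [|n IHn] A mA.
  rewrite big_ord0 /= diracE mem_set//= => -[]//.
rewrite big_ord_recl -IHn//= /lebesgueS /pushforward -product_measure1E//.
- congr (_ _); apply/seteqP; split => [p /= pA|p /= [p1 p2] i].
    split => [|i]; first by rewrite -vcons0; exact: pA.
    by have := pA (lift ord0 i); rewrite vconsS.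
  by case: (unliftP ord0 i) => [j|] ->; rewrite ?vconsS ?vcons0.
- exact: mA.
- rewrite [X in measurable X](_ : _ = \bigcap_(i in [set: 'I_n])
      ((fun x : 'rV[R]_n => x ord0 i) @^-1` A (lift ord0 i))).
    apply: fin_bigcap_measurable => // i _.
    by rewrite -[X in measurable X]setTI; exact: measurable_coord.
  by apply/seteqP; split => [x xA i _|x xA i]; [exact: xA|exact: (xA i I)].
Qed.

End lebesgue_vectors.

Section riesz_field.
Context {R : realType} {d : nat}.
Implicit Types (x y a v : 'rV[R]_d) (f : 'rV[R]_d -> 'rV[R]_d).

(* The library's `|x| and [ball] on 'rV[R]_d are those of the sup norm, hence
   the Euclidean versions below (the topology is the same). *)
Definition enorm x : R := Num.sqrt (\sum_(i < d) x ord0 i ^+ 2).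

Definition eball a (r : R) : set 'rV[R]_d := [set x | enorm (x - a) < r].

Definition average_dev f a v (r : R) : \bar R :=
  ((lebesgue_rV d (eball a r))^-1 *
   \int[lebesgue_rV d]_(x in eball a r) (enorm (f x - v))%:E)%E.

Definition is_precise_value f a v :=
  average_dev f a v r @[r --> (0 : R)^'+] --> 0%E.

Definition lebesgue_point f a := exists v, is_precise_value f a v.

Definition precise_representative f a : 'rV[R]_d :=
  get [set v | is_precise_value f a v].

Variables (s : R) (m : {finite_measure set 'rV[R]_d -> \bar R}).

(* \bar R has (0%:E)^-1 = +oo, so that |x - y|^-s is +oo at y = x. *)
Definition riesz_dom : set 'rV[R]_d :=
  [set x | (\int[m]_y ((enorm (x - y) `^ s)%:E)^-1 < +oo)%E].

(* The kernel vanishes at y = x, because 0^-1 = 0 in R. *)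
Definition riesz_kernel x y : 'rV[R]_d :=
  (enorm (x - y) `^ (s + 1))^-1 *: (x - y).

(* Coordinatewise integral of a vector-valued function. *)
Definition vintegral (D : set 'rV[R]_d) f : 'rV[R]_d :=
  \row_(i < d) \int[m]_(y in D) f y ord0 i.

(* V_s, given the junk value 0 off its domain (a Lebesgue-negligible set). *)
Definition riesz_field x : 'rV[R]_d :=
  if x \in riesz_dom then vintegral setT (riesz_kernel x) else 0.

Definition truncated_field a (e : R) : 'rV[R]_d :=
  vintegral (~` eball a e) (riesz_kernel a).

Definition has_pv a : Prop :=
  exists v, truncated_field a e @[e --> (0 : R)^'+] --> v.

Definition pv a : 'rV[R]_d := lim (truncated_field a e @[e --> (0 : R)^'+]).

End riesz_field.

(* Main.v *)
Require Import Defs.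
From mathcomp Require Import all_boot all_order all_algebra.
From mathcomp Require Import all_classical all_reals all_analysis.
From mathcomp Require Import measurable_realfun ring lra.

Set Implicit Arguments.
Unset Strict Implicit.
Unset Printing Implicit Defensive.
Import Order.TTheory GRing.Theory Num.Theory.
Import numFieldNormedType.Exports.

Local Open Scope classical_set_scope.
Local Open Scope ring_scope.

(** The proof compares the field [V = riesz_field s m] near [a] with its
   truncations, and detects the mass of small balls by a test field.

   Suppose first that [m (eball a r) = o(r `^ s)]. For [x] in [eball a r], the
   difference between [V x] and the truncation [truncated_field s m a (2 * r)] has
   two parts. The masses within [2 * r] of [a] contribute at most their potential,
   the integral of [|x - y|^-s], whose integral over the ball is
   [O(r^(d - s) * m (eball a (2 * r)))]. The other masses contribute at most
   [O(r)] times the integral of [|y - a|^-(s + 1)] over [2 * r <= |y - a|], by the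
   Lipschitz estimate [kern_lipschitz]; dyadic summation ([tail_littleo]) shows
   that this tends to [0]. Hence the mean over [eball a r] of the distance from
   [V] to the truncation tends to [0] ([truncation_littleo]), and a vector is the
   precise value of [V] at [a] if and only if it is the limit of the truncations
   ([precise_value_truncation]).

   It remains to see that [m (eball a r) = o(r `^ s)] whenever [V] has a precise
   value [v] at [a] ([precise_value_density]). This rests on an odd vector field
   [test p], bounded by a multiple of [max(1, |u|)^-p] for some [p] slightly above
   [d], whose pairing with the kernel satisfies, for some [c > 0] and all [y],

     [int_u kern s (u - y) . test p u >= c * (|y| < 1)]

   ([test_detects]). Rescale it to the ball [eball a r] and integrate over [m]:
   the integral of [V] against the rescaled field bounds
   [c * r^(d - s) * m (eball a r)] from above ([mass_le_test]). By oddness, [V] may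
   be replaced by [V - v] ([int_field_test]), and then the decay of the test field
   and dyadic summation give the bound [o(r^d)] ([density_littleo]).

   The test field is the convolution of a bump function, the tent, with the odd
   homogeneous field [x / |x|^(p + 1)]. Its pairing with the kernel is the
   convolution of the tent with

     [int_x kern p x . (kern s (x - w) + kern s (x + w))].

   By homogeneity and invariance under reflections, this function of [w] is
   [k * |w|^-(s + p - d)] for a constant [k] ([int_sprod]). That [k > 0]
   ([sprod_const_gt0]) follows by integration over the unit ball of [w]: the field
   that a uniform ball generates never points inwards
   ([ball_field_outward]), as a reflection argument shows. *)

(** * Euclidean geometry of row vectors *)

Section euclidean.
Context {R : realType} {d : nat}.
Implicit Types (u v w x y z : 'rV[R]_d) (c : R).

Definition dot u v : R := \sum_(i < d) u ord0 i * v ord0 i.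

Lemma dotC u v : dot u v = dot v u.
Proof. by apply: eq_bigr => i _; rewrite mulrC. Qed.

Lemma dotDl u v w : dot (u + v) w = dot u w + dot v w.
Proof. by rewrite -big_split; apply: eq_bigr => i _; rewrite mxE mulrDl. Qed.

Lemma dotZl c u v : dot (c *: u) v = c * dot u v.
Proof. by rewrite /dot mulr_sumr; apply: eq_bigr => i _; rewrite mxE mulrA. Qed.

Lemma dotNl u v : dot (- u) v = - dot u v.
Proof. by rewrite -scaleN1r dotZl mulN1r. Qed.

Lemma dotBl u v w : dot (u - v) w = dot u w - dot v w.
Proof. by rewrite dotDl dotNl. Qed.

Lemma dotDr u v w : dot w (u + v) = dot w u + dot w v.
Proof. by rewrite !(dotC w) dotDl. Qed.

Lemma dotZr c u v : dot u (c *: v) = c * dot u v.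
Proof. by rewrite !(dotC u) dotZl. Qed.

Lemma dotNr u v : dot u (- v) = - dot u v.
Proof. by rewrite !(dotC u) dotNl. Qed.

Lemma dotBr u v w : dot w (u - v) = dot w u - dot w v.
Proof. by rewrite !(dotC w) dotBl. Qed.

Definition dotE := (dotDl, dotDr, dotNl, dotNr, dotZl, dotZr).

Lemma dot_ge0 u : 0 <= dot u u.
Proof. by apply: sumr_ge0 => i _; rewrite -expr2 sqr_ge0. Qed.

Lemma enorm_ge0 u : 0 <= enorm u.
Proof. exact: sqrtr_ge0. Qed.

Lemma enorm_sqr u : enorm u ^+ 2 = dot u u.
Proof. by rewrite sqr_sqrtr ?sumr_ge0// => i _; rewrite sqr_ge0. Qed.

Lemma enorm_dot u : enorm u = Num.sqrt (dot u u).
Proof. by rewrite -enorm_sqr sqrtr_sqr ger0_norm// enorm_ge0. Qed.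

Lemma coord_le_enorm u i : `|u ord0 i| <= enorm u.
Proof.
rewrite -[leLHS]sqrtr_sqr; apply: ler_wsqrtr; rewrite (bigD1 i)//= lerDl.
by apply: sumr_ge0 => j _; rewrite sqr_ge0.
Qed.

Lemma enorm_eq0 u : enorm u = 0 -> u = 0.
Proof.
move=> u0; apply/rowP => i; rewrite mxE; apply/eqP.
by rewrite -normr_le0 -u0 coord_le_enorm.
Qed.

Lemma enorm0 : enorm (0 : 'rV[R]_d) = 0.
Proof. by rewrite enorm_dot -(scale0r 0) dotZl mul0r sqrtr0. Qed.

Lemma enorm_gt0 u : u != 0 -> 0 < enorm u.
Proof.
move=> u0; rewrite lt_neqAle enorm_ge0 andbT eq_sym.
by apply: contra u0 => /eqP/enorm_eq0/eqP.
Qed.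

Lemma enormZ c u : enorm (c *: u) = `|c| * enorm u.
Proof.
by rewrite !enorm_dot dotZl dotZr mulrA -expr2 sqrtrM ?sqr_ge0// sqrtr_sqr.
Qed.

Lemma enormN u : enorm (- u) = enorm u.
Proof. by rewrite -scaleN1r enormZ normrN1 mul1r. Qed.

Lemma enormB u v : enorm (u - v) = enorm (v - u).
Proof. by rewrite -enormN opprB. Qed.

Lemma cauchy_schwarz u v : `|dot u v| <= enorm u * enorm v.
Proof.
have [->|v0] := eqVneq v 0.
  by rewrite enorm0 mulr0 -(scale0r 0) dotZr mul0r normr0.
have vg := enorm_gt0 v0.
rewrite -[leRHS]ger0_norm ?mulr_ge0 ?enorm_ge0// -ler_sqr ?nnegrE//.
rewrite !real_normK ?num_real// exprMn !enorm_sqr.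
have vv : 0 < dot v v by rewrite -enorm_sqr exprn_gt0.
have := dot_ge0 (dot v v *: u - dot u v *: v).
rewrite !dotE (dotC v u).
set a := dot u u; set b := dot u v; set e := dot v v => h.
have : 0 <= e * (a * e - b ^+ 2) by move: h; congr (_ <= _); ring.
by rewrite pmulr_rge0 // subr_ge0.
Qed.

Lemma dot_le u v : dot u v <= enorm u * enorm v.
Proof. exact: le_trans (ler_norm _) (cauchy_schwarz _ _). Qed.

Lemma enormD u v : enorm (u + v) <= enorm u + enorm v.
Proof.
rewrite -ler_sqr ?nnegrE ?addr_ge0 ?enorm_ge0// sqrrD !enorm_sqr !dotE (dotC v).
have := dot_le u v; set a := enorm u * enorm v; lra.
Qed.

Lemma enorm_triangle x y z : enorm (x - z) <= enorm (x - y) + enorm (y - z).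
Proof. by apply: le_trans (enormD _ _); rewrite addrA subrK. Qed.

Lemma enorm_subl x y : enorm x - enorm y <= enorm (x - y).
Proof. by rewrite lerBlDr; apply: le_trans (enormD _ _); rewrite subrK. Qed.

Lemma enorm_dist x y : `|enorm x - enorm y| <= enorm (x - y).
Proof. by rewrite ler_norml enorm_subl andbT lerNl opprB enormB enorm_subl. Qed.

Lemma enorm_le_sum u : enorm u <= \sum_(i < d) `|u ord0 i|.
Proof.
have s0 : 0 <= \sum_(i < d) `|u ord0 i| by apply: sumr_ge0.
rewrite -ler_sqr ?nnegrE ?enorm_ge0// enorm_sqr expr2 mulr_suml.
apply: ler_sum => i _; rewrite (le_trans (ler_norm _))// normrM.
by rewrite ler_wpM2l// (bigD1 i)//= lerDl sumr_ge0.
Qed.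

Lemma exists_enorm1 : (1 <= d)%N -> exists e : 'rV[R]_d, enorm e = 1.
Proof.
move=> d1; exists (delta_mx ord0 (Ordinal d1)).
rewrite enorm_dot /dot (bigD1 (Ordinal d1))//= big1 => [|i /negbTE ni].
  by rewrite mxE !eqxx mulr1 addr0 sqrtr1.
by rewrite mxE ni mulr0.
Qed.

(** ** Householder reflections *)

(** Reflections do the work of rotations: they are isometries, and by
   [householder_swap] they act transitively on spheres. The formula gives the
   identity for [v = 0]. *)
Definition householder v x : 'rV[R]_d := x - (2 * dot x v / dot v v) *: v.

Lemma householder_dot v x y :
  dot (householder v x) (householder v y) = dot x y.
Proof.
rewrite /householder !dotE (dotC v y).
have [->|v0] := eqVneq v 0.
  by rewrite -(scale0r 0) !dotE !(mul0r,mulr0,oppr0,addr0,subr0).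
have vv : dot v v != 0 by rewrite -enorm_sqr sqrf_eq0 gt_eqF// enorm_gt0.
by field.
Qed.

Lemma householder_enorm v x : enorm (householder v x) = enorm x.
Proof. by rewrite !enorm_dot householder_dot. Qed.

Lemma householderD v x y :
  householder v (x + y) = householder v x + householder v y.
Proof.
rewrite /householder dotDl mulrDr mulrDl scalerDl opprD; exact: addrACA.
Qed.

Lemma householderZ v c x : householder v (c *: x) = c *: householder v x.
Proof.
rewrite /householder dotZl scalerBr scalerA; congr (_ - _ *: _); ring.
Qed.

Lemma householderN v x : householder v (- x) = - householder v x.
Proof. by rewrite -scaleN1r householderZ scaleN1r. Qed.

Lemma householderB v x y :
  householder v (x - y) = householder v x - householder v y.
Proof. by rewrite householderD householderN. Qed.

Lemma householderK v : involutive (householder v).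
Proof.
move=> x; have [->|v0] := eqVneq v 0.
  by rewrite /householder !scaler0 !subr0.
have vv : dot v v != 0 by rewrite -enorm_sqr sqrf_eq0 gt_eqF// enorm_gt0.
rewrite {1}/householder {2}/householder -addrA -opprD -scalerDl.
rewrite -[RHS]subr0; congr (_ - _); rewrite -[RHS](scale0r v).
by congr (_ *: _); rewrite /householder !dotE; field.
Qed.

Lemma householder_swap x y : enorm x = enorm y -> householder (x - y) x = y.
Proof.
move=> xy; have xx : dot y y = dot x x by rewrite -!enorm_sqr xy.
have [/eqP|v0] := eqVneq (x - y) 0.
  by rewrite subr_eq0 /householder => /eqP ->; rewrite subrr scaler0 subr0.
have vv : dot (x - y) (x - y) != 0.
  by rewrite -enorm_sqr sqrf_eq0 gt_eqF// enorm_gt0.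
rewrite /householder (_ : _ / _ = 1) ?scale1r ?subKr//.
move: vv; rewrite !dotE (dotC y x) xx => vv.
rewrite -[RHS](divff vv); congr (_ / _); ring.
Qed.

End euclidean.

(** * The Riesz kernel *)

Section kernel.
Context {R : realType} {d : nat}.
Implicit Types (u v w x y z : 'rV[R]_d) (t c s : R).

(** For [t != 0] the value at the origin is [0], not infinity. *)
Definition epow t x : R := enorm x `^ (- t).

Definition kern s z : 'rV[R]_d := (enorm z `^ (s + 1))^-1 *: z.

Lemma epow_ge0 t x : 0 <= epow t x.
Proof. exact: powR_ge0. Qed.

Lemma epow_gt0 t x : x != 0 -> 0 < epow t x.
Proof. by move=> x0; rewrite powR_gt0// enorm_gt0. Qed.

Lemma epow0 t : t != 0 -> epow t 0 = 0.
Proof. by move=> t0; rewrite /epow enorm0 powR0// oppr_eq0. Qed.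

Lemma epowN t x : epow t (- x) = epow t x.
Proof. by rewrite /epow enormN. Qed.

Lemma epowZ t c x : 0 < c -> epow t (c *: x) = c `^ (- t) * epow t x.
Proof.
by move=> c0; rewrite /epow enormZ (gtr0_norm c0) powRM ?enorm_ge0// ltW.
Qed.

Lemma epow_le t x r : 0 < t -> 0 < r -> r <= enorm x -> epow t x <= r `^ (- t).
Proof.
move=> t0 r0 rx; rewrite /epow !powRN lef_pV2 ?posrE ?powR_gt0//.
  by rewrite ge0_ler_powR ?nnegrE ?(ltW t0) ?(ltW r0) ?enorm_ge0.
exact: lt_le_trans rx.
Qed.

Lemma epow_ge t x r : 0 < t -> x != 0 -> enorm x <= r -> r `^ (- t) <= epow t x.
Proof.
move=> t0 x0 xr; have xg := enorm_gt0 x0.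
rewrite /epow !powRN lef_pV2 ?posrE ?powR_gt0 ?(lt_le_trans xg)//.
by rewrite ge0_ler_powR ?nnegrE ?(ltW t0) ?enorm_ge0 ?(le_trans (enorm_ge0 x)).
Qed.

Lemma epow_mul1 t x : t != 0 -> enorm x * epow (t + 1) x = epow t x.
Proof.
move=> t0; have [->|x0] := eqVneq x 0; first by rewrite enorm0 mul0r epow0.
have xg := enorm_gt0 x0.
by rewrite /epow opprD powRD ?(gt_eqF xg) ?implybT// powR_inv1 ?ltW// mulrCA
  divff ?mulr1// gt_eqF.
Qed.

Lemma kernE s z : kern s z = epow (s + 1) z *: z.
Proof. by rewrite /kern /epow powRN. Qed.

Lemma kernN s z : kern s (- z) = - kern s z.
Proof. by rewrite /kern enormN scalerN. Qed.

Lemma enorm_kern s z : s != 0 -> enorm (kern s z) = epow s z.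
Proof.
move=> s0; rewrite kernE enormZ ger0_norm ?epow_ge0// mulrC.
by rewrite epow_mul1.
Qed.

Lemma kernZ s c z : 0 < c -> kern s (c *: z) = c `^ (- s) *: kern s z.
Proof.
move=> c0; rewrite !kernE epowZ// !scalerA; congr (_ *: _).
rewrite opprD powRD ?(gt_eqF c0) ?implybT// powR_inv1 ?(ltW c0)//.
by field; rewrite gt_eqF.
Qed.

Lemma kern_householder s v z :
  kern s (householder v z) = householder v (kern s z).
Proof. by rewrite !kernE /epow householder_enorm householderZ. Qed.

(** Stands in for the mean value theorem of power functions: round the exponent
   up to an integer and use Bernoulli's inequality. *)
Lemma bernoulli_powR (p x : R) : 0 <= p -> 0 <= x <= 1 ->
  1 - x `^ p <= (Num.truncn p).+1%:R * (1 - x).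
Proof.
move=> p0 /andP[x0 x1]; set n := _.+1.
have pn : p <= n%:R.
  by rewrite /n; have /andP[_ /ltW] := truncn_itv p0.
have [->|xn0] := eqVneq x 0.
  rewrite subr0 mulr1 (le_trans (_ : _ <= 1)) ?gerBl ?powR_ge0//.
  by rewrite ler1n.
have : x ^+ n <= x `^ p.
  by rewrite -powR_mulrn// ger_powR// x1 andbT lt_neqAle eq_sym xn0.
suff : 1 - x ^+ n <= n%:R * (1 - x) by lra.
have bern k : 1 - x ^+ k <= k%:R * (1 - x).
  elim: k => [|k IH]; first by rewrite expr0 mul0r subrr.
  have xk : x ^+ k <= 1 by rewrite exprn_ile1.
  rewrite exprSr -natr1 mulrDl mul1r.
  have : x ^+ k * (1 - x) <= 1 * (1 - x) by rewrite ler_wpM2r// subr_ge0.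
  move: IH; set X := x ^+ k; lra.
exact: bern.
Qed.

(** The derivative of the kernel has the size of [epow (s + 1)], and this changes
   only by a bounded factor when [z] moves by at most half its distance to the
   singularity. *)
Lemma kern_lipschitz s : 0 < s -> exists2 C, 0 <= C & forall z h,
  2 * enorm h <= enorm z ->
  enorm (kern s (z + h) - kern s z) <= C * (enorm h * epow (s + 1) z).
Proof.
move=> s0; set n := (Num.truncn (s + 1)).+1.
pose D : R := 2 `^ (s + 1).
have D0 : 0 < D by rewrite powR_gt0.
exists (D + 2 * n%:R * D) => [|z h hz].
  by rewrite addr_ge0 ?mulr_ge0// ltW.
have s1 : 0 < s + 1 by lra.
have [z0|z0] := eqVneq z 0.
  have h0 : h = 0.
    apply: enorm_eq0; apply/eqP; rewrite eq_le enorm_ge0 andbT.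
    by move: hz; rewrite z0 enorm0; lra.
  by rewrite h0 z0 addr0 subrr enorm0 mul0r mulr0.
have zg := enorm_gt0 z0.
have zh : enorm z <= 2 * enorm (z + h).
  have := enorm_subl z (- h); rewrite opprK enormN; lra.
have zhg : 0 < enorm (z + h) by lra.
have zh0 : z + h != 0.
  by apply: contraTneq zhg => ->; rewrite enorm0 ltxx.
have hh := enorm_ge0 h.
have ED : forall w, w != 0 -> enorm z <= 2 * enorm w ->
    epow (s + 1) w <= D * epow (s + 1) z.
  move=> w w0 zw; apply: (le_trans (@epow_le (s + 1) w (2^-1 * enorm z) _ _ _)).
  - by [].
  - by rewrite mulr_gt0.
  - by rewrite mulrC ler_pdivrMr// mulrC.
  rewrite powRM ?enorm_ge0 ?invr_ge0//.
  by rewrite -(@powR_inv1 _ 2)// -powRrM mulN1r opprK.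
rewrite !kernE.
have -> : epow (s + 1) (z + h) *: (z + h) - epow (s + 1) z *: z =
    epow (s + 1) (z + h) *: h + (epow (s + 1) (z + h) - epow (s + 1) z) *: z.
  by rewrite scalerDr scalerBl addrAC addrC addrA.
apply: le_trans (enormD _ _) _; rewrite mulrDl lerD//.
  rewrite enormZ ger0_norm ?epow_ge0// [D * _]mulrCA mulrC ler_wpM2l//.
  exact: ED.
rewrite enormZ.
(* The difference of powers is compared through the ratio of the smaller norm
   to the larger one, which lies in [0, 1] as [bernoulli_powR] requires. *)
have key : forall x y, x != 0 -> y != 0 -> enorm x <= enorm y ->
    `|epow (s + 1) x - epow (s + 1) y| * enorm y <=
    n%:R * (enorm y - enorm x) * epow (s + 1) x.
  move=> x y x0 y0 xy.
  have xg := enorm_gt0 x0; have yg := enorm_gt0 y0.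
  have -> : epow (s + 1) y = epow (s + 1) x * (enorm x / enorm y) `^ (s + 1).
    rewrite /epow powRM ?ltW ?invr_gt0// mulrA -powRD ?(gt_eqF xg) ?implybT//.
    by rewrite addNr powRr0 mul1r -powR_inv1 ?ltW// -powRrM mulN1r.
  rewrite -[X in X - _]mulr1 -mulrBr normrM ger0_norm ?epow_ge0//.
  have xy1 : 0 <= enorm x / enorm y <= 1.
    by rewrite divr_ge0 ?(ltW xg) ?(ltW yg)//= ler_pdivrMr// mul1r.
  have /andP[xy10 xy11] := xy1.
  rewrite ger0_norm; last first.
    have p1 : 1 `^ (s + 1) = 1 :> R by rewrite powR1.
    by rewrite subr_ge0 -[leRHS]p1 ge0_ler_powR ?nnegrE// ltW.
  rewrite -[leLHS]mulrA [leRHS]mulrC; apply: ler_wpM2l; rewrite ?epow_ge0//.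
  apply: le_trans (_ : _ <= n%:R * (1 - enorm x / enorm y) * enorm y) _.
    by rewrite ler_wpM2r ?(ltW yg)// bernoulli_powR// ltW.
  by rewrite -mulrA mulrBl mul1r divfK// gt_eqF.
have dist := enorm_dist (z + h) z.
rewrite addrAC subrr add0r in dist.
have n0 : 0 <= n%:R :> R by [].
have E0 := epow_ge0 (s + 1) z.
have [le|/ltW le] := leP (enorm (z + h)) (enorm z).
  apply: le_trans (key _ _ zh0 z0 le) _.
  have h1 := ED _ zh0 zh.
  apply: le_trans (_ : _ <= n%:R * enorm h * (D * epow (s + 1) z)) _.
    rewrite ler_pM ?mulr_ge0 ?subr_ge0 ?epow_ge0// ler_wpM2l//.
    by rewrite (le_trans _ dist)// distrC ler_norm.
  have : 0 <= n%:R * enorm h * (D * epow (s + 1) z).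
    by rewrite !mulr_ge0// ltW.
  set A := _ * _ * _ => A0.
  have -> : 2 * n%:R * D * (enorm h * epow (s + 1) z) = 2 * A.
    by rewrite /A; ring.
  lra.
rewrite distrC.
have : `|epow (s + 1) z - epow (s + 1) (z + h)| * enorm z <=
    `|epow (s + 1) z - epow (s + 1) (z + h)| * enorm (z + h).
  by rewrite ler_wpM2l.
move=> /le_trans; apply.
apply: le_trans (key _ _ z0 zh0 le) _.
have D1 : 1 <= D by rewrite -[leLHS](powRr0 (2 : R)); apply: ler_powR; lra.
apply: le_trans (_ : _ <= n%:R * enorm h * (D * epow (s + 1) z)) _.
  rewrite ler_pM ?mulr_ge0 ?subr_ge0 ?epow_ge0//.
    by rewrite ler_wpM2l// (le_trans _ dist)// ler_norm.
  by rewrite ler_peMl.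
have : 0 <= n%:R * enorm h * (D * epow (s + 1) z).
  by rewrite !mulr_ge0// ltW.
set A := _ * _ * _ => A0.
have -> : 2 * n%:R * D * (enorm h * epow (s + 1) z) = 2 * A.
  by rewrite /A; ring.
lra.
Qed.

(** A weight that decays like [enorm u `^ (- p)] without singularity at [0]. *)
Definition wt t x : R := Num.max 1 (enorm x) `^ (- t).

Lemma wt_gt0 (p : R) u : 0 < wt p u.
Proof. by rewrite powR_gt0// lt_max ltr01. Qed.

Lemma wtE (p : R) u : wt p u =
  (enorm u < 1)%R%:R + epow p u * (1 <= enorm u)%R%:R.
Proof.
rewrite /wt /epow; case: leP => [u1|u1].
  by rewrite mulr1 add0r.
by rewrite powR1 mulr0 addr0.
Qed.

Lemma wt_le1 (p : R) u : 0 < p -> wt p u <= 1.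
Proof.
move=> p0; rewrite wtE; case: leP => u1; rewrite ?mulr0 ?addr0// add0r mulr1.
by have := epow_le p0 ltr01 u1; rewrite powR1.
Qed.

End kernel.

Lemma ind_le (R : realType) (b c : bool) :
  (b -> c) -> ((0 : R) <= b%:R) && ((b%:R : R) <= c%:R).
Proof. by case: b; case: c => // h; rewrite ?ler01 ?lexx//; have := h isT. Qed.

(** * Measurability *)

Section measurability.
Context {R : realType} {d0 : measure_display} {T : measurableType d0} {n : nat}.
Implicit Types (f g : T -> 'rV[R]_n) (h : T -> R).

Lemma measurable_coord_fun f i : measurable_fun setT f ->
  measurable_fun setT (fun t => f t ord0 i).
Proof. move=> mf; exact: measurableT_comp (measurable_coord i) mf. Qed.

Lemma measurable_addv f g : measurable_fun setT f -> measurable_fun setT g ->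
  measurable_fun setT (fun t => f t + g t).
Proof.
move=> mf mg; apply: measurable_fun_rV => i.
under eq_fun do rewrite mxE.
by apply: measurable_funD; exact: measurable_coord_fun.
Qed.

Lemma measurable_oppv f : measurable_fun setT f ->
  measurable_fun setT (fun t => - f t).
Proof.
move=> mf; apply: measurable_fun_rV => i.
under eq_fun do rewrite mxE.
by apply: measurable_funN; exact: measurable_coord_fun.
Qed.

Lemma measurable_subv f g : measurable_fun setT f -> measurable_fun setT g ->
  measurable_fun setT (fun t => f t - g t).
Proof. by move=> mf mg; apply: measurable_addv => //; exact: measurable_oppv. Qed.

Lemma measurable_scalev h g : measurable_fun setT h -> measurable_fun setT g ->
  measurable_fun setT (fun t => h t *: g t).
Proof.
move=> mf mg; apply: measurable_fun_rV => i.
under eq_fun do rewrite mxE.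
by apply: measurable_funM => //; exact: measurable_coord_fun.
Qed.

Lemma measurable_dot f g : measurable_fun setT f -> measurable_fun setT g ->
  measurable_fun setT (fun t => dot (f t) (g t)).
Proof.
move=> mf mg; rewrite /dot.
by apply: measurable_sum => i; apply: measurable_funM; exact: measurable_coord_fun.
Qed.

Lemma measurable_enorm f : measurable_fun setT f ->
  measurable_fun setT (fun t => enorm (f t)).
Proof.
move=> mf; under eq_fun do rewrite enorm_dot -powR12_sqrt ?dot_ge0//.
apply: (measurableT_comp (measurable_powR _)); exact: measurable_dot.
Qed.

Lemma measurable_epow p f : measurable_fun setT f ->
  measurable_fun setT (fun t => epow p (f t)).
Proof.
move=> mf; apply: (measurableT_comp (measurable_powR _)).
exact: measurable_enorm.
Qed.

Lemma measurable_kern s f : measurable_fun setT f ->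
  measurable_fun setT (fun t => kern s (f t)).
Proof.
move=> mf; under eq_fun do rewrite kernE.
by apply: measurable_scalev => //; exact: measurable_epow.
Qed.

Lemma measurable_eball f (r : R) (a : 'rV[R]_n) : measurable_fun setT f ->
  measurable [set t | eball a r (f t)].
Proof.
move=> mf; rewrite /eball.
have := measurable_fun_ltr (measurable_enorm (measurable_subv mf
  (measurable_cst a))) (measurable_cst r).
by move=> /(_ measurableT [set true] I); rewrite setTI.
Qed.

Lemma measurable_wt p f : measurable_fun setT f ->
  measurable_fun setT (fun t => wt p (f t)).
Proof.
move=> mf; apply: (measurableT_comp (measurable_powR _)).
by apply: measurable_maxr => //; exact: measurable_enorm.
Qed.

Lemma measurable_bool (b : T -> bool) : measurable_fun setT b ->
  measurable_fun setT (fun x => (b x)%:R : R).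
Proof.
move=> mb; have mB : measurable [set x | b x].
  by have := mb measurableT [set true] I; rewrite setTI.
rewrite (_ : (fun _ => _) = \1_[set x | b x]); first exact: measurable_indic.
apply/funext => x; rewrite indicE; congr (nat_of_bool _)%:R.
by apply/idP/idP => [h|/set_mem//]; exact/mem_set.
Qed.

End measurability.

(** Solves the measurability of the integrands that occur below, which are
   compositions of vector operations, inner products, norms and powers. *)
Ltac meas :=
  lazymatch goal with
  | |- measurable_fun _ (fun t => t) => exact: measurable_id
  | |- measurable_fun _ (fun _ => ?c) => refine (measurable_cst c)
  | |- measurable_fun _ (fun t => t.1) => refine measurable_fst
  | |- measurable_fun _ (fun t => t.2) => refine measurable_snd
  | |- measurable_fun _ (fun t => (@?f t)%:E) => apply/measurable_EFinP; meas
  | |- measurable_fun _ (fun t => kern ?s (@?f t)) =>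
      refine (@measurable_kern _ _ _ _ s f _); meas
  | |- measurable_fun _ (fun t => epow ?s (@?f t)) =>
      refine (@measurable_epow _ _ _ _ s f _); meas
  | |- measurable_fun _ (fun t => enorm (@?f t)) =>
      refine (@measurable_enorm _ _ _ _ f _); meas
  | |- measurable_fun _ (fun t => dot (@?f t) (@?g t)) =>
      refine (@measurable_dot _ _ _ _ f g _ _); meas
  | |- measurable_fun _ (fun t => (@?f t) *: (@?g t)) =>
      refine (@measurable_scalev _ _ _ _ f g _ _); meas
  | |- measurable_fun _ (@enorm _ _) =>
      refine (@measurable_enorm _ _ _ _ (fun x => x) _); meas
  | |- measurable_fun _ (epow ?s) =>
      refine (@measurable_epow _ _ _ _ s (fun x => x) _); meas
  | |- measurable_fun _ (wt ?s) =>
      refine (@measurable_wt _ _ _ _ s (fun x => x) _); meas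
  | |- measurable_fun _ (fun t => wt ?s (@?f t)) =>
      refine (@measurable_wt _ _ _ _ s f _); meas
  | |- measurable_fun _ (fun t => GRing.natmul _ (nat_of_bool (@?b t))) =>
      refine (@measurable_bool _ _ _ b _); meas
  | |- measurable_fun _ (fun t => @?f t < @?g t) =>
      refine (@measurable_fun_ltr _ _ _ _ f g _ _); meas
  | |- measurable_fun _ (fun t => @?f t <= @?g t) =>
      refine (@measurable_fun_ler _ _ _ _ f g _ _); meas
  | |- measurable_fun _ (kern ?s) =>
      refine (@measurable_kern _ _ _ _ s (fun x => x) _); meas
  | |- measurable_fun _ fst => refine measurable_fst
  | |- measurable_fun _ snd => refine measurable_snd
  | |- measurable_fun _ (GRing.scale ?c) =>
      refine (@measurable_scalev _ _ _ _ (fun=> c) (fun x => x) _ _); meas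
  | |- measurable_fun _ (fun t => `|@?f t|) =>
      refine (measurableT_comp (@normr_measurable _ _) _); meas
  | |- measurable_fun _ (fun t => Num.max (@?f t) (@?g t)) =>
      refine (@measurable_maxr _ _ _ _ f g _ _); meas
  | |- measurable_fun _ (fun t => @?f t * @?g t) =>
      refine (@measurable_funM _ _ _ _ f g _ _); meas
  | |- measurable_fun _ (fun t => @?f t - @?g t) =>
      first [ refine (@measurable_funB _ _ _ _ f g _ _)
            | refine (@measurable_subv _ _ _ _ f g _ _) ]; meas
  | |- measurable_fun _ (fun t => @?f t + @?g t) =>
      first [ refine (@measurable_funD _ _ _ _ f g _ _)
            | refine (@measurable_addv _ _ _ _ f g _ _) ]; meas
  | |- measurable_fun _ (fun t => - @?f t) =>
      first [ refine (@measurable_funN _ _ _ _ f _)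
            | refine (@measurable_oppv _ _ _ _ f _) ]; meas
  | |- _ => try assumption
  end.

Definition pushforward_measure {d1 d2} {T1 : measurableType d1}
    {T2 : measurableType d2} {R : realFieldType}
    (m : {measure set T1 -> \bar R}) {f : T1 -> T2}
    (mf : measurable_fun setT f) : {measure set T2 -> \bar R} :=
  @measure_function_pushforward__canonical__measure_function_Measure
    _ _ _ _ _ m f mf.

(** * Affine changes of variable for Lebesgue measure *)

Section lebesgue_affine.
Context {R : realType}.
Local Notation mu1 := (@lebesgue_measure R).

Lemma measurable_affine (c b : R) :
  measurable_fun [set: measurableTypeR R]
    (fun x : measurableTypeR R => c * x + b : measurableTypeR R).
Proof. by apply: measurable_funD => //; exact: measurable_funM. Qed.

Lemma lebesgue_measure_affine (c b : R) (A : set R) : c != 0 -> measurable A ->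
  (lebesgue_measure A = `|c|%:E * lebesgue_measure ((fun x : R => (c * x + b)%R) @^-1` A))%E.
Proof.
move=> c0; move: A.
have cg : 0 < `|c| by rewrite normr_gt0.
pose k : {nonneg R} := NngNum (ltW cg).
pose ff (x : R) := c * x + b.
apply: (@lebesgue_measure_unique R
  (mscale k (pushforward_measure mu1 (measurable_affine c b)))).
move=> _ [[x y]/= _ <-].
change (mu1 `]x, y]%classic = (`|c|%:E * mu1 (ff @^-1` `]x, y]%classic))%E).
have [cp|cn] := ltP 0 c.
  have -> : ff @^-1` `]x, y] = `]((x - b) / c), ((y - b) / c)]%classic.
    apply/seteqP; split => z; rewrite /= !in_itv/= /ff ltr_pdivrMr// ler_pdivlMr//;
    rewrite (mulrC z); lra.
  rewrite !lebesgue_measure_itv/= !lte_fin ltr_pM2r ?invr_gt0// ltrBlDr subrK.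
  case: ifPn => xy; last by rewrite mule0.
  by rewrite -!EFinB -EFinM (gtr0_norm cp); congr EFin; field.
have {}cn : c < 0 by rewrite lt_neqAle c0.
have -> : ff @^-1` `]x, y] = `[((y - b) / c), ((x - b) / c)[%classic.
  apply/seteqP; split => z; rewrite /= !in_itv/= /ff ltr_ndivlMr// ler_ndivrMr//;
  rewrite (mulrC z); lra.
rewrite !lebesgue_measure_itv/= !lte_fin ltr_nM2r ?invr_lt0// ltrBlDr subrK.
case: ifPn => xy; last by rewrite mule0.
by rewrite -!EFinB -EFinM (ltr0_norm cn); congr EFin; field.
Qed.

Lemma ge0_integral_affine1 (c b : R) (f : R -> \bar R) : c != 0 ->
  measurable_fun setT f -> (forall x, 0 <= f x)%E ->
  (\int[mu1]_x f x = `|c|%:E * \int[mu1]_x f (c * x + b)%R)%E.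
Proof.
move=> c0 mf f0.
have cg : 0 < `|c| by rewrite normr_gt0.
pose k : {nonneg R} := NngNum (ltW cg).
pose nu := pushforward_measure mu1 (measurable_affine c b).
rewrite (@eq_measure_integral _ _ _ setT (mscale k nu) mu1); last first.
  by move=> A mA _; exact: (lebesgue_measure_affine b c0 mA).
rewrite ge0_integral_mscale//= ge0_integral_pushforward//.
exact: measurable_affine.
Qed.

End lebesgue_affine.

Section lebesgue_rV_affine.
Context {R : realType}.
Local Notation mu1 := (@lebesgue_measure R).
Local Notation L d := (@lebesgue_rV R d).

Lemma measurable_affv d (c : R) (b : 'rV[R]_d) :
  measurable_fun setT (fun x : 'rV[R]_d => c *: x + b).
Proof.
by apply: measurable_addv => //; apply: measurable_scalev.
Qed.

Lemma vcons_affine d (c t b0 : R) (v b : 'rV[R]_d) :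
  c *: vcons (t, v) + vcons (b0, b) = vcons (c * t + b0, c *: v + b).
Proof.
apply/rowP => i; rewrite [LHS]mxE [X in X + _]mxE.
case: (unliftP ord0 i) => [j|] ->.
  by rewrite !vconsS/= !mxE.
by rewrite !vcons0.
Qed.

Lemma ge0_integral_rVS d (f : 'rV[R]_d.+1 -> \bar R) :
  measurable_fun setT f -> (forall x, 0 <= f x)%E ->
  (\int[L d.+1]_x f x = \int[mu1]_t \int[L d]_v f (vcons (t, v)))%E.
Proof.
move=> mf f0.
transitivity (\int[mu1 \x L d]_p (f \o @vcons R d) p)%E.
  transitivity (\int[pushforward (mu1 \x L d)%E (@vcons R d)]_x f x)%E => //.
  rewrite ge0_integral_pushforward//; exact: measurable_vcons.
rewrite fubini_tonelli1//.
- exact: measurableT_comp mf (@measurable_vcons R d).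
- by move=> x; exact: f0.
Qed.

Lemma ge0_integral_affine d (c : R) (b : 'rV[R]_d) (f : 'rV[R]_d -> \bar R) :
  c != 0 -> measurable_fun setT f -> (forall x, 0 <= f x)%E ->
  (\int[L d]_x f x = (`|c| ^+ d)%:E * \int[L d]_x f (c *: x + b)%R)%E.
Proof.
move=> c0; elim: d b f => [|d IH] b f mf f0.
  rewrite expr0 mul1e; apply: eq_integral => x _.
  by congr f; apply/rowP => -[].
have mff : measurable_fun setT (fun x : 'rV[R]_d.+1 => f (c *: x + b)).
  exact: measurableT_comp mf (measurable_affv c b).
rewrite !ge0_integral_rVS//; move: mff; rewrite -(vcons_surj b).
set b0 := b _ _; set b' := \row_i _ => mff'.
have mg t : measurable_fun setT (fun v : 'rV[R]_d => f (vcons (t, v))).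
  apply: (measurableT_comp mf).
  apply: (measurableT_comp (@measurable_vcons R d)).
  by first [exact: pair1_measurable | exact: pair2_measurable].
rewrite (ge0_integral_affine1 b0 c0); last 2 first.
- apply: (@measurable_fun_fubini_tonelli_F _ _ _ _ _ (L d) (f \o @vcons R d)).
    exact: measurableT_comp mf (@measurable_vcons R d).
  by move=> x; exact: f0.
- by move=> x; exact: integral_ge0.
rewrite exprS EFinM -muleA; congr (_ * _)%E.
rewrite -ge0_integralZl_EFin//; last 2 first.
- by move=> t _; exact: integral_ge0.
- apply: (@measurable_fun_fubini_tonelli_F _ _ _ _ _ (L d)
    (fun p => f (c *: vcons p + vcons (b0, b')))) => //.
  exact: measurableT_comp mff' (@measurable_vcons R d).
apply: eq_integral => t _; rewrite (IH b')//; congr (_ * _)%E.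
by apply: eq_integral => v _; rewrite vcons_affine.
Qed.

(** Both sides are differences of the integrals of the positive and negative
   parts, and a positive factor distributes over such a difference even where
   its terms are infinite. *)
Lemma integral_affine d (c : R) (b : 'rV[R]_d) (f : 'rV[R]_d -> \bar R) :
  c != 0 -> measurable_fun setT f ->
  (\int[L d]_x f x = (`|c| ^+ d)%:E * \int[L d]_x f (c *: x + b)%R)%E.
Proof.
move=> c0 mf; rewrite integralE [in RHS]integralE.
rewrite (ge0_integral_affine b c0 (measurable_funepos mf))//.
rewrite (ge0_integral_affine b c0 (measurable_funeneg mf))//.
have cg : 0 < `|c| ^+ d by rewrite exprn_gt0// normr_gt0.
set A := (\int[_]_x f^\+ _)%E; set B := (\int[_]_x f^\- _)%E.
transitivity ((`|c| ^+ d)%:E * (A - B))%E; last first.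
  by congr (_ * (_ - _))%E; apply: eq_integral => x _; rewrite ?funeposE ?funenegE.
have : (0 <= A)%E by exact: integral_ge0.
have : (0 <= B)%E by exact: integral_ge0.
case: A => [x| |]; case: B => [y| |] => // _ _.
- by rewrite muleBr.
- by rewrite gt0_muley// !addeNy gt0_muleNy.
- by rewrite gt0_muley// !addye// gt0_muley.
- by rewrite gt0_muley// addeNy gt0_muleNy.
Qed.

End lebesgue_rV_affine.

Section lebesgue_rV_ball.
Context {R : realType} {d : nat}.
Local Notation V := 'rV[R]_d.
Local Notation L := (@lebesgue_rV R d).

Lemma measurable_ball_set (a : V) (r : R) : measurable (eball a r).
Proof. exact: (measurable_eball (f := id)). Qed.

Lemma ge0_integral_affine_set (c : R) (b : V) (D : set V) (f : V -> \bar R) :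
  c != 0 -> measurable D -> measurable_fun setT f -> (forall x, 0 <= f x)%E ->
  (\int[L]_(x in D) f x =
   (`|c| ^+ d)%:E * \int[L]_(x in [set x | D (c *: x + b)%R]) f (c *: x + b)%R)%E.
Proof.
move=> c0 mD mf f0; rewrite integral_mkcond (ge0_integral_affine b c0); first last.
- by move=> x; rewrite patchE; case: ifP.
- by apply/(measurable_restrictT f mD); exact: measurable_funTS.
by rewrite [in RHS]integral_mkcond; congr (_ * _)%E.
Qed.

Lemma integral_ball_shift (a : V) (r : R) (f : V -> \bar R) :
  measurable_fun setT f -> (forall x, 0 <= f x)%E ->
  (\int[L]_(x in eball a r) f x = \int[L]_(x in eball 0 r) f (x + a)%R)%E.
Proof.
move=> mf f0.
rewrite (@ge0_integral_affine_set 1 a)//; last exact: measurable_ball_set.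
rewrite normr1 expr1n mul1e.
have -> : [set x | eball a r (1 *: x + a)] = eball 0 r.
  by apply/funext => x; rewrite /eball /= scale1r addrK subr0.
by apply: eq_integral => x _; rewrite scale1r.
Qed.

Let box (r : R) : set V := [set x | forall i : 'I_d, `[- r, r]%classic (x ord0 i)].

Let lebesgue_box (r : R) : 0 < r -> L (box r) = ((2 * r) ^+ d)%:E.
Proof.
move=> r0; pose A (_ : 'I_d) : set R := `[- r, r]%classic.
rewrite -[box r]/([set x : V | forall i, A i (x ord0 i)]).
rewrite lebesgue_rV_prod; last by move=> i; exact: measurable_itv.
under eq_bigr do rewrite /A lebesgue_measure_itv/= lte_fin gtrN// -EFinB.
rewrite prodEFin; congr EFin; rewrite prodr_const card_ord; congr (_ ^+ _).
by rewrite opprK; ring.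
Qed.

Let measurable_box r : measurable (box r).
Proof.
rewrite [X in measurable X](_ : _ = \bigcap_(i in [set: 'I_d])
    ((fun x : V => x ord0 i) @^-1` `[- r, r]%classic)).
  apply: fin_bigcap_measurable => // i _.
  by rewrite -[X in measurable X]setTI; exact: measurable_coord.
by apply/seteqP; split => [x xA i _|x xA i]; [exact: xA|exact: (xA i I)].
Qed.

Lemma lebesgue_ball_lty (a : V) (r : R) : (L (eball a r) < +oo)%E.
Proof.
rewrite -[L _]mul1e -(integral_cst L (measurable_ball_set a r)).
rewrite (@integral_ball_shift a r (cst 1%E))//.
rewrite (integral_cst L (measurable_ball_set 0 r)) mul1e.
have [r0|r0] := leP r 0.
  rewrite (_ : eball 0 r = set0) ?measure0//; apply/seteqP; split => x //=.
  by rewrite /eball/= => /lt_le_trans/(_ r0); rewrite ltNge enorm_ge0.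
apply: (@le_lt_trans _ _ (L (box r))); last by rewrite lebesgue_box// ltry.
apply: le_measure; rewrite ?inE; [exact: measurable_ball_set|exact: measurable_box|].
move=> x; rewrite /eball/= subr0 => xr i.
rewrite /= in_itv/= -ler_norml.
exact: le_trans (coord_le_enorm _ _) (ltW xr).
Qed.

Definition vball : R := fine (L (eball 0 1)).

Lemma lebesgue_ball1 : L (eball 0 1) = vball%:E.
Proof. by rewrite fineK// ge0_fin_numE// lebesgue_ball_lty. Qed.

Lemma vball_gt0 : 0 < vball.
Proof.
rewrite -lte_fin -lebesgue_ball1.
have c0 : 0 < (d.+1%:R : R)^-1 by rewrite invr_gt0.
apply: (@lt_le_trans _ _ (L (box d.+1%:R^-1))).
  by rewrite lebesgue_box// lte_fin exprn_gt0// mulr_gt0.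
apply: le_measure; rewrite ?inE; [exact: measurable_box|exact: measurable_ball_set|].
move=> x bx; rewrite /eball/= subr0; apply: le_lt_trans (enorm_le_sum x) _.
apply: (@le_lt_trans _ _ (\sum_(i < d) d.+1%:R^-1)).
  apply: ler_sum => i _; have := bx i.
  by rewrite /= in_itv/= ler_norml.
by rewrite sumr_const card_ord -[ltLHS]mulr_natl ltr_pdivrMr// mul1r ltr_nat.
Qed.

Lemma lebesgue_ball (a : V) (r : R) : 0 < r ->
  L (eball a r) = (r ^+ d * vball)%:E.
Proof.
move=> r0; rewrite -[L _]mul1e -(integral_cst L (measurable_ball_set a r)).
rewrite (@ge0_integral_affine_set r a) ?gt_eqF//; last exact: measurable_ball_set.
rewrite (gtr0_norm r0) EFinM; congr (_ * _)%E.
have -> : [set x | eball a r (r *: x + a)] = eball 0 1.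
  apply/funext => x; rewrite /eball /= addrK subr0 enormZ (gtr0_norm r0).
  by rewrite -ltr_pdivlMl// mulVf ?gt_eqF.
by rewrite integral_cst ?mul1e -?lebesgue_ball1//; exact: measurable_ball_set.
Qed.

(** A Haar measure argument in place of a determinant: for an involutive linear
   isometry [H], Tonelli and translations give
   [int (f \o H) * int g = int f * int (g \o H)] (both are the double integral
   of [f (H x) * g (y + H x)]), and the indicator [g] of a centred ball is
   invariant under [H]. *)
Lemma ge0_integral_householder (v : V) (f : V -> \bar R) :
  measurable_fun setT f -> (forall x, 0 <= f x)%E ->
  (\int[L]_x f (householder v x) = \int[L]_x f x)%E.
Proof.
move=> mf f0; pose H := householder v.
suff : ((\int[L]_x f (H x)) * vball%:E = (\int[L]_x f x) * vball%:E)%E.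
  move=> /(congr1 (fun t => t * vball^-1%:E)%E).
  by rewrite -!muleA -EFinM divff ?mule1// gt_eqF// vball_gt0.
pose g (x : V) : \bar R := (\1_(eball (0 : V) 1) x)%:E.
have g0 x : (0 <= g x)%E by rewrite lee_fin.
have mg : measurable_fun setT g.
  by apply/measurable_EFinP; apply: measurable_indic; exact: measurable_ball_set.
have gH x : g (H x) = g x.
  rewrite /g !indicE; congr ((nat_of_bool _)%:R%:E).
  apply/idP/idP => /set_mem h; apply/mem_set; move: h;
  by rewrite /eball /= !subr0 householder_enorm.
have ig : (\int[L]_x g x = vball%:E)%E.
  rewrite integral_indic//; last exact: measurable_ball_set.
  by rewrite setIT; exact: lebesgue_ball1.
have mH d1 (T : measurableType d1) (h : T -> V) : measurable_fun setT h ->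
    measurable_fun setT (fun t => H (h t)).
  by move=> mh; rewrite /H /householder; meas.
have HD x y : H (x + H y) = H x + y by rewrite /H householderD householderK.
clearbody g H; clear box lebesgue_box measurable_box.
have shift (b : V) (h : V -> \bar R) : measurable_fun setT h ->
    (forall x, 0 <= h x)%E -> (\int[L]_x h (x + b)%R = \int[L]_x h x)%E.
  move=> mh h0; rewrite [RHS](@ge0_integral_affine _ _ 1 b)//.
  rewrite normr1 expr1n mul1e.
  by apply: eq_integral => x _; rewrite scale1r.
have flip (b : V) (h : V -> \bar R) : measurable_fun setT h ->
    (forall x, 0 <= h x)%E -> (\int[L]_x h (b - x)%R = \int[L]_x h x)%E.
  move=> mh h0; rewrite [RHS](@ge0_integral_affine _ _ (-1) b)//.
  rewrite normrN1 expr1n mul1e.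
  by apply: eq_integral => x _; rewrite scaleN1r addrC.
have mfH : measurable_fun setT (fun x => f (H x)).
  by apply: measurableT_comp mf _; exact: mH.
rewrite -{1}ig -ge0_integralZr//; last first.
  by apply: integral_ge0 => x _; exact: g0.
transitivity (\int[L]_x \int[L]_y (f (H x) * g (y + H x)%R))%E.
  apply: eq_integral => x _; rewrite ge0_integralZl//; last first.
    by apply: (measurableT_comp mg); meas.
  by rewrite shift.
transitivity (\int[L]_x \int[L]_y (f (H x - y)%R * g (H x)))%E; last first.
  under eq_integral => x _.
    rewrite ge0_integralZr//; last first.
      by apply: (measurableT_comp mf); meas.
    rewrite flip// gH; over.
  by rewrite ge0_integralZl// ?ig//; exact: integral_ge0.
rewrite (@fubini_tonelli _ _ _ _ _ L L (fun p => (f (H p.1) * g (p.2 + H p.1)%R)%E));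
  last 2 first.
- apply: emeasurable_funM; first by apply: (measurableT_comp mf); apply: mH.
  by apply: (measurableT_comp mg); apply: measurable_addv => //; apply: mH.
- by move=> p; exact: mule_ge0.
rewrite [RHS](@fubini_tonelli _ _ _ _ _ L L (fun p => (f (H p.1 - p.2)%R * g (H p.1))%E));
  last 2 first.
- apply: emeasurable_funM; last by apply: (measurableT_comp mg); apply: mH.
  by apply: (measurableT_comp mf); apply: measurable_subv => //; apply: mH.
- by move=> p; exact: mule_ge0.
apply: eq_integral => y _ /=.
rewrite -[RHS](shift (H y)) => [|//|x]; last exact: mule_ge0.
  by apply: eq_integral => x _; rewrite HD addrK (addrC y).
apply: emeasurable_funM.
  by apply: (measurableT_comp mf); apply: measurable_subv => //; apply: mH.
by apply: (measurableT_comp mg); apply: mH.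
Qed.

Lemma integral_householder (v : V) (f : V -> \bar R) :
  measurable_fun setT f ->
  (\int[L]_x f (householder v x) = \int[L]_x f x)%E.
Proof.
move=> mf; rewrite integralE [RHS]integralE.
rewrite -(ge0_integral_householder v (measurable_funepos mf))//.
rewrite -(ge0_integral_householder v (measurable_funeneg mf))//.
by congr (_ - _)%E; apply: eq_integral => x _; rewrite ?funeposE ?funenegE.
Qed.

End lebesgue_rV_ball.

(** * Nonnegative integrands *)

Section nonneg_integrals.
Context {R : realType} {d0 : measure_display} {T : measurableType d0}.
Variable mu : {measure set T -> \bar R}.
Implicit Types f g : T -> R.
Local Open Scope ereal_scope.

Lemma le_intT f g : measurable_fun setT f -> measurable_fun setT g ->
  (forall x, (0 <= f x <= g x)%R) ->
  \int[mu]_x (f x)%:E <= \int[mu]_x (g x)%:E.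
Proof.
move=> mf mg fg; apply: ge0_le_integral => //.
- by move=> x _; rewrite lee_fin; have /andP[] := fg x.
- exact/measurable_EFinP.
- exact/measurable_EFinP.
- by move=> x _; rewrite lee_fin; have /andP[] := fg x.
Qed.

Lemma intTD f g : measurable_fun setT f -> measurable_fun setT g ->
  (forall x, (0 <= f x)%R) -> (forall x, (0 <= g x)%R) ->
  \int[mu]_x (f x + g x)%:E = \int[mu]_x (f x)%:E + \int[mu]_x (g x)%:E.
Proof.
move=> mf mg f0 g0; rewrite -ge0_integralD//.
- by move=> x _; rewrite lee_fin.
- exact/measurable_EFinP.
- by move=> x _; rewrite lee_fin.
- exact/measurable_EFinP.
Qed.

Lemma intTZ f (k : R) : measurable_fun setT f -> (forall x, (0 <= f x)%R) ->
  (0 <= k)%R -> \int[mu]_x (k * f x)%:E = k%:E * \int[mu]_x (f x)%:E.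
Proof.
move=> mf f0 k0; rewrite -ge0_integralZl_EFin//.
- by move=> x _; rewrite lee_fin.
- exact/measurable_EFinP.
Qed.

Lemma intT_ge0 f : (forall x, (0 <= f x)%R) -> 0 <= \int[mu]_x (f x)%:E.
Proof. by move=> f0; apply: integral_ge0 => x _; rewrite lee_fin. Qed.

(** A boolean factor in the integrand replaces the domain of integration, so that
   measurability and Fubini are only needed on whole spaces. *)
Lemma integral_ind (D : set T) f (b : T -> bool) :
  (forall x, D x <-> b x) ->
  \int[mu]_(x in D) (f x)%:E = \int[mu]_x (f x * (b x)%:R)%:E.
Proof.
move=> Db; rewrite integral_mkcond; apply: eq_integral => x _.
rewrite patchE; case: ifPn => [|].
  by rewrite inE => /Db ->; rewrite mulr1.
case E : (b x); last by rewrite mulr0.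
by move=> /negP[]; rewrite inE; apply/Db.
Qed.

Lemma intT_le_sup (f : nat -> T -> R) g (M : R) :
  (forall n, measurable_fun setT (f n)) -> (forall n x, (0 <= f n x)%R) ->
  (forall x, {homo f ^~ x : m n / (m <= n)%N >-> (m <= n)%R}) ->
  (forall x, exists N, forall n, (N <= n)%N -> f n x = g x) ->
  (forall n, \int[mu]_x (f n x)%:E <= M%:E) ->
  \int[mu]_x (g x)%:E <= M%:E.
Proof.
move=> mf f0 fh fg fM.
have lg x : limn (fun n => (f n x)%:E) = (g x)%:E.
  have [N HN] := fg x; apply: cvg_lim => //.
  by apply: cvg_near_cst; exists N => // n /= /HN ->.
under eq_integral do rewrite -lg.
rewrite monotone_convergence//.
- apply: lime_le; last by apply: nearW.
  apply: ereal_nondecreasing_is_cvgn => m n mn; apply: le_intT => // x.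
  by rewrite f0/= fh.
- by move=> n; exact/measurable_EFinP.
- by move=> n x _; rewrite lee_fin.
- by move=> x _ m n mn; rewrite lee_fin fh.
Qed.

End nonneg_integrals.

(** * Integrals of powers of the norm *)

Section powers.
Context {R : realType} {d : nat}.
Local Notation V := 'rV[R]_d.
Local Notation L := (@lebesgue_rV R d).
Implicit Types (x y u : V) (r t p s c b : R).
Local Open Scope ereal_scope.

Lemma measurable_epowx t : measurable_fun setT (epow t : V -> R).
Proof. by apply: measurable_epow; exact: measurable_id. Qed.

Lemma int_ball_measure (mu : {measure set V -> \bar R}) (a : V) r :
  \int[mu]_x (((enorm (x - a) < r)%R)%:R : R)%:E = mu (eball a r).
Proof.
rewrite -(mul1e (mu _)) -(integral_cst mu (measurable_ball_set a r)).
by rewrite (@integral_ind _ _ _ mu (eball a r) (cst 1%R) (fun x => (enorm (x - a) < r)%R))//;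
  apply: eq_integral => x _; rewrite mul1r.
Qed.

Lemma int_ball_ind (a : V) r :
  \int[L]_x (((enorm (x - a) < r)%R)%:R : R)%:E = L (eball a r).
Proof. exact: int_ball_measure. Qed.

(** Self-similarity: if the set [D n.+1] is covered by a set [S] of finite
   measure and by the dilation of [D n] by [c], the integrals over the [D n] of
   a power satisfy [A n.+1 <= const + q * A n], with ratio [q < 1]. *)
Lemma int_epow_selfsimilar t c b (S : V -> bool) (D : nat -> V -> bool) (v : R) :
  (0 < c)%R -> measurable_fun setT S -> (forall n, measurable_fun setT (D n)) ->
  (0 <= b)%R -> (forall x, S x -> (epow t x <= b)%R) ->
  \int[L]_x ((S x)%:R : R)%:E <= v%:E -> (0 <= v)%R ->
  (forall x, D 0%N x = false) ->
  (forall n x, D n.+1 x -> S x || D n (c^-1 *: x)%R) ->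
  (c ^+ d * c `^ (- t) < 1)%R ->
  forall n, \int[L]_x (epow t x * (D n x)%:R)%:E <=
    (b * v / (1 - c ^+ d * c `^ (- t)))%:E.
Proof.
move=> c0 mS mD b0 Sb Sv v0 D0 DS q1; set q := (_ * _)%R in q1 *.
have q0 : (0 <= q)%R by rewrite mulr_ge0 ?powR_ge0// exprn_ge0// ltW.
have E0 := @epow_ge0 R d t.
have mE := measurable_epowx t.
elim=> [|n IH].
  rewrite integral0_eq ?lee_fin ?divr_ge0 ?mulr_ge0// ?subr_ge0 ?(ltW q1)//.
  by move=> x _; rewrite D0 mulr0.
apply: (@le_trans _ _ (\int[L]_x (b * (S x)%:R +
    epow t x * (D n (c^-1 *: x))%:R)%:E)).
  apply: le_intT.
  - by apply: measurable_funM => //; exact: measurable_bool.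
  - apply: measurable_funD; first by apply: measurable_funM => //; exact: measurable_bool.
    apply: measurable_funM => //; apply: measurable_bool.
    by apply: (measurableT_comp (mD n)); meas.
  - move=> x; rewrite mulr_ge0//=.
    case: (boolP (D n.+1 x)) => [/DS/orP[Sx|Dx]|_].
    + by rewrite Sx !mulr1 (le_trans (Sb _ Sx))// lerDl mulr_ge0.
    + by rewrite Dx !mulr1 lerDr mulr_ge0.
    + by rewrite mulr0 addr_ge0 ?mulr_ge0.
rewrite intTD//; first last.
- by move=> x; rewrite mulr_ge0.
- by move=> x; rewrite mulr_ge0.
- apply: measurable_funM => //; apply: measurable_bool.
  by apply: (measurableT_comp (mD n)); meas.
- by apply: measurable_funM => //; exact: measurable_bool.
rewrite intTZ//; last exact: measurable_bool.
rewrite [X in _ + X](@ge0_integral_affine _ _ c 0) ?gt_eqF//; last 2 first.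
- apply/measurable_EFinP; apply: measurable_funM => //; apply: measurable_bool.
  by apply: (measurableT_comp (mD n)); meas.
- by move=> x; rewrite lee_fin mulr_ge0.
have -> : \int[L]_x (epow t (c *: x + 0)%R *
    (D n (c^-1 *: (c *: x + 0))%R)%:R)%:E =
    (c `^ (- t))%:E * \int[L]_x (epow t x * (D n x)%:R)%:E.
  rewrite -intTZ ?powR_ge0//; last 2 first.
  - by apply: measurable_funM => //; exact: measurable_bool.
  - by move=> x; rewrite mulr_ge0.
  apply: eq_integral => x _; rewrite addr0 scalerA mulVf ?gt_eqF// scale1r.
  by rewrite epowZ// mulrA.
rewrite muleA -EFinM (gtr0_norm c0) -/q.
apply: (@le_trans _ _ (b%:E * v%:E + q%:E * (b * v / (1 - q))%:E)).
  by apply: leeD; apply: lee_wpmul2l; rewrite ?lee_fin.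
rewrite -!EFinM -EFinD lee_fin le_eqVlt; apply/orP; left; apply/eqP.
by field; rewrite subr_eq0 gt_eqF.
Qed.

Lemma int_ball_bool (a : V) r :
  measurable_fun setT (fun x : V => (enorm (x - a) < r)%R).
Proof. by apply: measurable_fun_ltr; meas. Qed.

Let exists_lt_expr2 r : exists N, (r < 2 ^+ N)%R.
Proof.
exists (Num.truncn r).+1; apply: lt_le_trans (truncnS_gt r) _.
by rewrite -natrX ler_nat ltnW// ltn_expl.
Qed.

(** Apply the self-similarity to the unit ball without its part in
   [enorm x < 2^-1 ^+ n], then let [n] grow. *)
Lemma int_epow_near t : (0 < t < d%:R)%R -> exists2 C, (0 <= C)%R &
  \int[L]_x (epow t x * (enorm x < 1)%R%:R)%:E <= C%:E.
Proof.
move=> /andP[t0 td].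
have h0 : (0 < 2^-1 :> R)%R by [].
pose q : R := (2^-1 ^+ d * 2^-1 `^ (- t))%R.
have q1 : (q < 1)%R.
  rewrite /q -powR_mulrn// -powRD; last by rewrite (gt_eqF h0) implybT.
  rewrite -(@powR_inv1 _ 2)// -powRrM mulN1r powRN invf_lt1 ?powR_gt0//.
  rewrite -[ltLHS](powRr0 (2 : R)) /powR; case: eqP => [|_]; first lra.
  by rewrite ltr_expR ltr_pM2r ?ln_gt0//; [rewrite subr_gt0|lra].
pose b : R := (2^-1 `^ (- t))%R.
exists (b * @vball R d / (1 - q))%R.
  by rewrite divr_ge0 ?mulr_ge0 ?powR_ge0 ?(ltW (@vball_gt0 R d))// subr_ge0 ltW.
pose D n (x : V) := (enorm x < 1)%R && (2^-1 ^+ n <= enorm x)%R.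
pose S (x : V) := (enorm x < 1)%R && (2^-1 <= enorm x)%R.
have mD c : measurable_fun setT
    (fun x : V => (enorm x < 1)%R && (c <= enorm x)%R).
  have m1 : measurable_fun setT (fun x : V => (enorm x < 1)%R) by meas.
  have m2 : measurable_fun setT (fun x : V => (c <= enorm x)%R) by meas.
  exact: measurable_and m1 m2.
apply: (@intT_le_sup _ _ _ _ (fun n x => epow t x * (D n x)%:R)%R).
- by move=> n; apply: measurable_funM; [meas|exact: (measurable_bool (mD _))].
- by move=> n x; rewrite mulr_ge0 ?epow_ge0.
- move=> x m n mn; rewrite ler_wpM2l ?epow_ge0// ler_nat /D.
  case: (enorm x < 1)%R => //=; case: (boolP (2^-1 ^+ m <= enorm x)%R) => // h.
  rewrite (_ : (2^-1 ^+ n <= enorm x)%R = true)//.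
  by apply: le_trans h; apply: ler_wiXn2l => //; lra.
- move=> x; have [->|x0] := eqVneq x 0%R.
    by exists 0%N => n _; rewrite epow0 ?mul0r// gt_eqF.
  have xg := enorm_gt0 x0.
  have [N NP] := exists_lt_expr2 (enorm x)^-1.
  have {}NP : (2^-1 ^+ N <= enorm x)%R.
    by rewrite exprVn -(invrK (enorm x)) lef_pV2 ?posrE ?exprn_gt0 ?invr_gt0// ltW.
  exists N => n Nn; rewrite /D (_ : (_ <= enorm x)%R) ?andbT//.
  by apply: le_trans NP; apply: ler_wiXn2l => //; lra.
- apply: (@int_epow_selfsimilar t 2^-1%R b S D).
  + by [].
  + exact: mD.
  + by move=> n; exact: mD.
  + exact: powR_ge0.
  + by move=> x /andP[_]; exact: epow_le.
  + rewrite -lebesgue_ball1 -int_ball_ind; apply: le_intT.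
    * by apply: measurable_bool; exact: mD.
    * by apply: measurable_bool; exact: int_ball_bool.
    * by move=> x; rewrite subr0; apply: ind_le => /andP[].
  + exact/ltW/vball_gt0.
  + by move=> x; rewrite /D expr0 leNgt; case: ltP.
  + move=> n x /andP[x1]; rewrite /S /D x1/= enormZ invrK ger0_norm// exprS => h.
    by case: (leP 2^-1%R) => //= xh; apply/andP; split; lra.
  + exact: q1.
Qed.

(** Apply the self-similarity to [1 <= enorm x < 2 ^+ n], then let [n] grow. *)
Lemma int_epow_far t : (d%:R < t)%R -> exists2 C, (0 <= C)%R &
  \int[L]_x (epow t x * (1 <= enorm x)%R%:R)%:E <= C%:E.
Proof.
move=> td; have t0 : (0 < t)%R by rewrite (le_lt_trans _ td).
pose q : R := (2 ^+ d * 2 `^ (- t))%R.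
have q1 : (q < 1)%R.
  rewrite /q -powR_mulrn// -powRD; last by rewrite pnatr_eq0 implybT.
  rewrite -[ltRHS](powRr0 (2 : R)) /powR; case: eqP => [|_]; first lra.
  by rewrite ltr_expR ltr_pM2r ?ln_gt0//; [rewrite subr_lt0|lra].
exists (1 * (2 ^+ d * @vball R d) / (1 - q))%R.
  by rewrite divr_ge0 ?mulr_ge0 ?exprn_ge0 ?(ltW (@vball_gt0 R d))// subr_ge0 ltW.
pose D n (x : V) := (enorm x < 2 ^+ n)%R && (1 <= enorm x)%R.
have mD (c : R) : measurable_fun setT
    (fun x : V => (enorm x < c)%R && (1 <= enorm x)%R).
  have m1 : measurable_fun setT (fun x : V => (enorm x < c)%R) by meas.
  have m2 : measurable_fun setT (fun x : V => (1 <= enorm x)%R) by meas.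
  exact: measurable_and m1 m2.
apply: (@intT_le_sup _ _ _ _ (fun n x => epow t x * (D n x)%:R)%R).
- by move=> n; apply: measurable_funM; [meas|exact: (measurable_bool (mD _))].
- by move=> n x; rewrite mulr_ge0 ?epow_ge0.
- move=> x m n mn; rewrite ler_wpM2l ?epow_ge0// ler_nat /D.
  case: (1 <= enorm x)%R; rewrite ?andbF ?andbT//.
  case: (boolP (enorm x < 2 ^+ m)%R) => // h.
  rewrite (lt_le_trans h)//; apply: ler_weXn2l => //; lra.
- move=> x.
  have [N NP] := exists_lt_expr2 (enorm x).
  exists N => n Nn; rewrite /D (_ : (enorm x < _)%R)//.
  by apply: lt_le_trans NP _; apply: ler_weXn2l => //; lra.
- apply: (@int_epow_selfsimilar t 2%R 1%R (D 1%N) D).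
  + by [].
  + exact: mD.
  + by move=> n; exact: mD.
  + by [].
  + move=> x /andP[_ x1]; have := @epow_le _ _ t x 1%R t0 ltr01 x1.
    by rewrite powR1.
  + rewrite -(@lebesgue_ball R d 0%R 2)// -int_ball_ind; apply: le_intT.
    * by apply: measurable_bool; exact: mD.
    * by apply: measurable_bool; exact: int_ball_bool.
    * by move=> x; rewrite subr0; apply: ind_le => /andP[]; rewrite expr1.
  + by rewrite mulr_ge0 ?exprn_ge0// ltW// vball_gt0.
  + by move=> x; rewrite /D expr0 leNgt; case: ltP.
  + move=> n x /andP[x1 x2]; rewrite /D x2 andbT expr1 enormZ ger0_norm//.
    by rewrite exprS in x1; case: ltP => //= xh; apply/andP; split; lra.
  + exact: q1.
Qed.

(** Rescale by [r] around [y]: where the rescaled variable has norm at least [1],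
   the power is at most [1] and the volume of the ball bounds the integral. *)
Lemma int_epow_ball s : (0 < s < d%:R)%R -> exists2 C, (0 <= C)%R &
  forall (b y : V) r, (0 < r)%R ->
  \int[L]_x (epow s (x - y) * (enorm (x - b) < r)%R%:R)%:E <=
  (C * (r ^+ d * r `^ (- s)))%:E.
Proof.
move=> sd; have [C C0 CP] := int_epow_near sd.
have s0 : (0 < s)%R by case/andP: sd.
exists (C + @vball R d)%R => [|b y r r0].
  by rewrite addr_ge0// ltW// vball_gt0.
rewrite (@ge0_integral_affine _ _ r y) ?gt_eqF//; last 2 first.
- by meas.
- by move=> x; rewrite lee_fin mulr_ge0 ?epow_ge0.
rewrite (gtr0_norm r0).
pose b' := (r^-1 *: (b - y))%R.
apply: (@le_trans _ _ ((r ^+ d)%:E * \int[L]_x (r `^ (- s) *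
   (epow s x * (enorm x < 1)%R%:R + (enorm (x - b') < 1)%R%:R))%:E)).
  apply: lee_wpmul2l; first by rewrite lee_fin exprn_ge0// ltW.
  apply: le_intT; [by meas|by meas|move=> x].
  rewrite mulr_ge0 ?epow_ge0//= addrK epowZ// -mulrA ler_wpM2l ?powR_ge0//.
  have -> : (r *: x + y - b = r *: (x - b'))%R.
    by rewrite scalerBr scalerA divff ?gt_eqF// scale1r opprB addrA.
  rewrite enormZ (gtr0_norm r0) -ltr_pdivlMl// mulVf ?gt_eqF//.
  have E0 := epow_ge0 s x.
  case: ltP => xb; case: ltP => x1; rewrite ?mulr1 ?mulr0 ?addr0 ?add0r//.
    by rewrite lerDl.
  by have := epow_le s0 ltr01 x1; rewrite powR1.
rewrite intTZ ?powR_ge0//; last 2 first.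
- by meas.
- by move=> x; rewrite addr_ge0 ?mulr_ge0 ?epow_ge0.
rewrite intTD//; last 3 first.
- by meas.
- by meas.
- by move=> x; rewrite mulr_ge0 ?epow_ge0.
rewrite int_ball_ind lebesgue_ball// expr1n mul1r.
rewrite mulrC -mulrA EFinM.
apply: lee_wpmul2l; first by rewrite lee_fin exprn_ge0// ltW.
rewrite EFinM; apply: lee_wpmul2l; first by rewrite lee_fin powR_ge0.
by rewrite EFinD leeD2r.
Qed.

Lemma int_wt p : (d%:R < p)%R -> exists2 C, (0 <= C)%R &
  \int[L]_x (wt p x)%:E <= C%:E.
Proof.
move=> dp; have [C C0 CP] := int_epow_far dp.
exists (@vball R d + C)%R; first by rewrite addr_ge0// ltW// vball_gt0.
under eq_integral do rewrite wtE.
rewrite intTD//; last 3 first.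
- by meas.
- by meas.
- by move=> x; rewrite mulr_ge0 ?epow_ge0.
rewrite EFinD leeD// -lebesgue_ball1 -int_ball_ind.
by under [leRHS]eq_integral do rewrite subr0.
Qed.

(** Within distance [1] of [y] the weight is at most [1], elsewhere the power is. *)
Lemma int_epow_wt s p : (0 < s < d%:R)%R -> (d%:R < p)%R ->
  exists2 C, (0 <= C)%R & forall y,
  \int[L]_u (epow s (u - y) * wt p u)%:E <= C%:E.
Proof.
move=> sd dp; have [C C0 CP] := int_epow_ball sd.
have [D D0 DP] := int_wt dp.
have s0 : (0 < s)%R by case/andP: sd.
have p0 : (0 < p)%R by rewrite (le_lt_trans _ dp).
exists (C + D)%R => [|y]; first exact: addr_ge0.
apply: (@le_trans _ _ (\int[L]_u
  (epow s (u - y) * (enorm (u - y) < 1)%R%:R + wt p u)%:E)).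
  apply: le_intT; [by meas|by meas|move=> u].
  have E0 := epow_ge0 s (u - y)%R; have w0 := ltW (wt_gt0 p u).
  rewrite mulr_ge0//=; case: ltP => uy; rewrite ?mulr1 ?mulr0 ?add0r.
    by rewrite (le_trans (ler_wpM2l E0 (wt_le1 u p0)))// mulr1 lerDl.
  rewrite -[leRHS]mul1r ler_wpM2r//.
  by have := epow_le s0 ltr01 uy; rewrite powR1.
rewrite intTD//; last 4 first.
- by meas.
- by meas.
- by move=> x; rewrite mulr_ge0 ?epow_ge0.
- by move=> x; exact/ltW/wt_gt0.
rewrite EFinD leeD//; have := CP y y _ ltr01.
by rewrite expr1n powR1 !mulr1.
Qed.

End powers.

(** * Fubini for real-valued integrands *)

Section fubini_real.
Context {R : realType} {d1 d2 : measure_display}.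
Context {T1 : measurableType d1} {T2 : measurableType d2}.
Variables (m1 : {sigma_finite_measure set T1 -> \bar R}).
Variables (m2 : {sigma_finite_measure set T2 -> \bar R}).
Implicit Types f : T1 * T2 -> R.
Local Open Scope ereal_scope.

Lemma measurable_int_param f : measurable_fun setT f ->
  measurable_fun setT (fun x => \int[m2]_y (f (x, y))%:E).
Proof.
move=> mf; have mf' : measurable_fun setT (EFin \o f) by exact/measurable_EFinP.
rewrite (_ : (fun _ => _) = (fun x => \int[m2]_y (EFin \o f)^\+ (x, y)) \-
                            (fun x => \int[m2]_y (EFin \o f)^\- (x, y))).
  apply: emeasurable_funB.
    apply: (measurable_fun_fubini_tonelli_F (EFin \o f)^\+) => //.
    exact: measurable_funepos.
  apply: (measurable_fun_fubini_tonelli_F (EFin \o f)^\-) => //.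
  exact: measurable_funeneg.
apply/funext => x; rewrite integralE.
by congr (_ - _); apply: eq_integral => y _; rewrite ?funeposE ?funenegE.
Qed.

Lemma measurable_Rint_param f : measurable_fun setT f ->
  measurable_fun setT (fun x => (\int[m2]_y f (x, y))%R).
Proof.
move=> mf; apply: (measurableT_comp (fine_measurable measurableT)).
exact: measurable_int_param.
Qed.

Lemma fubini_real f : measurable_fun setT f ->
  \int[m1]_x \int[m2]_y `|f (x, y)|%:E < +oo ->
  \int[m1]_x \int[m2]_y (f (x, y))%:E = \int[m2]_y \int[m1]_x (f (x, y))%:E.
Proof.
move=> mf foo; apply: (@Fubini _ _ _ _ _ m1 m2 (EFin \o f)).
by apply/integrable12ltyP; first exact/measurable_EFinP.
Qed.

Lemma fubini_real' f : measurable_fun setT f ->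
  \int[m2]_y \int[m1]_x `|f (x, y)|%:E < +oo ->
  \int[m1]_x \int[m2]_y (f (x, y))%:E = \int[m2]_y \int[m1]_x (f (x, y))%:E.
Proof.
move=> mf foo; apply: (@Fubini _ _ _ _ _ m1 m2 (EFin \o f)).
by apply/integrable21ltyP; first exact/measurable_EFinP.
Qed.

Lemma tonelli_real f : measurable_fun setT f -> (forall p, (0 <= f p)%R) ->
  \int[m1]_x \int[m2]_y (f (x, y))%:E = \int[m2]_y \int[m1]_x (f (x, y))%:E.
Proof.
move=> mf f0; apply: (@fubini_tonelli _ _ _ _ _ m1 m2 (EFin \o f)).
  exact/measurable_EFinP.
by move=> p; rewrite lee_fin.
Qed.

End fubini_real.

Section integrable_real.
Context {R : realType} {d0 : measure_display} {T : measurableType d0}.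
Variable mu : {measure set T -> \bar R}.
Implicit Types f g : T -> R.
Local Open Scope ereal_scope.

Lemma integrable_le f g (C : R) : measurable_fun setT f ->
  measurable_fun setT g -> (forall x, (`|f x| <= g x)%R) ->
  \int[mu]_x (g x)%:E <= C%:E -> mu.-integrable setT (EFin \o f).
Proof.
move=> mf mg fg gC; apply/integrableP; split; first exact/measurable_EFinP.
apply: (@le_lt_trans _ _ C%:E); last exact: ltry.
apply: le_trans gC.
apply: (@le_intT _ _ _ mu (fun x => `|f x|)%R g) => //.
  exact: measurableT_comp.
by move=> x; rewrite normr_ge0 fg.
Qed.

Lemma RintE f : mu.-integrable setT (EFin \o f) ->
  ((\int[mu]_x f x)%R)%:E = \int[mu]_x (f x)%:E.
Proof. by move=> fi; rewrite fineK//; exact: integrable_fin_num. Qed.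

End integrable_real.

Section vector_integrals.
Context {R : realType} {n : nat} {d0 : measure_display} {T : measurableType d0}.
Variable mu : {measure set T -> \bar R}.
Implicit Types F : T -> 'rV[R]_n.

Definition vint F : 'rV[R]_n := \row_i (\int[mu]_t F t ord0 i).

Lemma integrable_coord F i : measurable_fun setT F ->
  mu.-integrable setT (fun t => (enorm (F t))%:E) ->
  mu.-integrable setT (fun t => (F t ord0 i)%:E).
Proof.
move=> mF; apply: le_integrable => //.
  by apply/measurable_EFinP; exact: measurable_coord_fun.
move=> t _; rewrite lee_fin (ger0_norm (enorm_ge0 _)).
exact: coord_le_enorm.
Qed.

Lemma dot_vint F w : measurable_fun setT F ->
  mu.-integrable setT (fun t => (enorm (F t))%:E) ->
  mu.-integrable setT (fun t => (dot (F t) w)%:E) /\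
  ((dot (vint F) w)%:E = \int[mu]_t (dot (F t) w)%:E)%E.
Proof.
move=> mF iF.
have iFi i : mu.-integrable setT (fun t => (F t ord0 i)%:E).
  exact: integrable_coord.
split.
  under eq_fun do rewrite /dot -sumEFin.
  apply: integrable_sum => // i _; under eq_fun do rewrite EFinM muleC.
  exact: integrableZl.
rewrite /dot -sumEFin; under [RHS]eq_integral do rewrite -sumEFin.
rewrite integral_sum//; last first.
  move=> i; under eq_fun do rewrite EFinM muleC.
  exact: integrableZl.
apply: eq_bigr => i _; rewrite mxE EFinM -/(_ \o _).
under [RHS]eq_integral do rewrite EFinM.
by rewrite integralZr// -RintE//; exact: iFi.
Qed.

(** Pair the integral with itself, and divide by its norm. *)
Lemma enorm_vint F : measurable_fun setT F ->
  ((enorm (vint F))%:E <= \int[mu]_t (enorm (F t))%:E)%E.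
Proof.
move=> mF; have mnF := measurable_enorm mF.
have F0 t : 0 <= enorm (F t) by exact: enorm_ge0.
have [iF|/negP niF] := pselect (mu.-integrable setT (fun t => (enorm (F t))%:E)); last first.
  rewrite (_ : (\int[mu]_t _ = +oo)%E) ?leey//.
  apply/eqP; apply: contraT => noo; exfalso; apply: (negP niF).
  apply/integrableP; split; first exact/measurable_EFinP.
  under eq_integral do rewrite gee0_abs ?lee_fin//.
  by rewrite ltey.
set v := vint F; have [->|v0] := eqVneq v 0.
  by rewrite enorm0; exact: intT_ge0.
have vg := enorm_gt0 v0.
have [iv ve] := dot_vint v mF iF.
suff : ((enorm v)%:E * (enorm v)%:E <= (enorm v)%:E * \int[mu]_t (enorm (F t))%:E)%E.
  by rewrite lee_pmul2l// lte_fin.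
rewrite -EFinM -expr2 enorm_sqr ve -intTZ ?(ltW vg)//.
apply: le_integral => //.
  under eq_fun do rewrite EFinM; exact: integrableZl.
by move=> t _; rewrite lee_fin mulrC; exact: dot_le.
Qed.

End vector_integrals.

Section null_origin.
Context {R : realType} {d : nat} (d0 : (0 < d)%N).
Local Notation V := 'rV[R]_d.
Local Notation L := (@lebesgue_rV R d).
Implicit Types (f g : V -> R).
Local Open Scope ereal_scope.

Lemma measurable_point (a : V) : measurable [set a].
Proof.
rewrite (_ : [set a] = [set x | (enorm (x - a) <= 0)%R]).
  have : measurable_fun setT (fun x : V => (enorm (x - a) <= 0)%R) by meas.
  by move=> /(_ measurableT [set true] I); rewrite setTI.
apply/seteqP; split => x /=; first by move=> ->; rewrite subrr enorm0.
move=> h; apply/eqP; rewrite -subr_eq0; apply/eqP/enorm_eq0/eqP.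
by rewrite eq_le h enorm_ge0.
Qed.

Lemma lebesgue_point0 (a : V) : L [set a] = 0.
Proof.
apply/eqP; rewrite eq_le measure_ge0 andbT; apply/lee_addgt0Pr => r r0.
rewrite add0e; pose t : R := (Num.min 1 (r / @vball R d))%R.
have v0 := @vball_gt0 R d.
have t0 : (0 < t)%R by rewrite lt_min ltr01 divr_gt0.
apply: (@le_trans _ _ (L (eball a t))).
  apply: le_measure; rewrite ?inE; [exact: measurable_point|exact: measurable_ball_set|].
  by move=> x ->; rewrite /eball /= subrr enorm0.
rewrite lebesgue_ball// lee_fin -ler_pdivlMr//.
apply: (@le_trans _ _ t); last by rewrite ge_min lexx orbT.
rewrite -[leRHS]expr1; apply: ler_wiXn2l => //; first exact: ltW.
by rewrite ge_min lexx.
Qed.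

(** [epow] vanishes at the origin, so lower bounds by powers fail there. *)
Lemma le_intT_ne0 (f g : V -> \bar R) : measurable_fun setT f ->
  measurable_fun setT g ->
  (forall x, 0 <= f x) -> (forall x, 0 <= g x) ->
  (forall x, x != 0%R -> f x <= g x) ->
  \int[L]_x f x <= \int[L]_x g x.
Proof.
move=> mf mg f0 g0 fg.
rewrite (ge0_negligible_integral (measurable_point 0%R) measurableT mf)//; last first.
  exact: lebesgue_point0.
rewrite [leRHS](ge0_negligible_integral (measurable_point 0%R) measurableT mg)//; last first.
  exact: lebesgue_point0.
apply: ge0_le_integral => //.
- by apply: measurableD => //; exact: measurable_point.
- exact: measurable_funTS.
- exact: measurable_funTS.
- by move=> x [_ /= /eqP x0]; exact: fg.
Qed.

Lemma eq_intT_ne (a : V) (f g : V -> \bar R) : measurable_fun setT f ->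
  measurable_fun setT g -> (forall x, x != a -> f x = g x) ->
  \int[L]_x f x = \int[L]_x g x.
Proof.
move=> mf mg fg; apply: ae_eq_integral => //.
exists [set a]; split; [exact: measurable_point|exact: lebesgue_point0|].
move=> x /= h; apply/eqP/negP => x0; apply: h => _; apply: fg; exact/negP.
Qed.

Lemma integral_gt0 (f : V -> \bar R) (b : V) (r : R) : measurable_fun setT f ->
  (forall x, 0 <= f x) -> (0 < r)%R ->
  (forall x, (enorm (x - b) < r)%R -> 0 < f x) -> 0 < \int[L]_x f x.
Proof.
move=> mf f0 r0 fp; rewrite lt_neqAle integral_ge0// andbT.
apply/eqP => /esym i0.
have : ae_eq L setT f (cst 0).
  apply/(ae_eq_integral_abs L measurableT mf).
  by rewrite -i0; apply: eq_integral => x _; rewrite gee0_abs.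
case=> N [mN N0 fN].
have : L (eball b r) <= L N.
  apply: le_measure; rewrite ?inE//; first exact: measurable_ball_set.
  move=> x xb; apply: fN => /= /(_ I) fx0.
  by have := fp x xb; rewrite fx0 ltxx.
rewrite N0 lebesgue_ball// lee_fin leNgt mulr_gt0 ?exprn_gt0//.
exact: vball_gt0.
Qed.

Lemma integral_shift (b : V) (f : V -> \bar R) : measurable_fun setT f ->
  \int[L]_x f (x + b)%R = \int[L]_x f x.
Proof.
move=> mf; rewrite [RHS](@integral_affine _ _ 1 b)//.
by rewrite normr1 expr1n mul1e; apply: eq_integral => x _; rewrite scale1r.
Qed.

Lemma integral_flip (b : V) (f : V -> \bar R) : measurable_fun setT f ->
  \int[L]_x f (b - x)%R = \int[L]_x f x.
Proof.
move=> mf; rewrite [RHS](@integral_affine _ _ (-1) b)//.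
rewrite normrN1 expr1n mul1e.
by apply: eq_integral => x _; rewrite scaleN1r addrC.
Qed.

End null_origin.

(** * The Riesz potential of a homogeneous singular vector field *)

Lemma half_gt0 {R : realType} : 0 < 2^-1 :> R.
Proof. by rewrite invr_gt0. Qed.

Lemma lt1_of_half {R : realType} (t : R) : 0 <= t -> 2 * t <= 1 -> t < 1.
Proof. lra. Qed.

Section singular_test.
Context {R : realType} {d : nat} (d0 : (0 < d)%N).
Variables (s p : R).
Hypotheses (s0 : 0 < s) (dp : d%:R < p) (pd : p < d%:R + 1)
  (spd : s + p < d%:R + d%:R).
Local Notation V := 'rV[R]_d.
Local Notation L := (@lebesgue_rV R d).
Local Notation q := (s + p - d%:R).
Implicit Types (x y u w z v : V).

Let d1 : 1 <= d%:R :> R. Proof. by rewrite ler1n. Qed.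
Let sd : 0 < s < d%:R. Proof. by move: s0 spd dp => *; apply/andP; split; lra. Qed.
Let p0 : 0 < p. Proof. by move: d1 dp => *; lra. Qed.
Let sn0 : s != 0. Proof. by rewrite gt_eqF. Qed.
Let pn0 : p != 0. Proof. by rewrite gt_eqF. Qed.
Let p10 : 0 < p - 1 < d%:R.
Proof. by move: d1 dp pd => *; apply/andP; split; lra. Qed.
Let q0 : 0 < q < d%:R. Proof. by move: s0 spd dp => *; apply/andP; split; lra. Qed.

(** The kernel at [x] symmetrised in [x], against the singular vector field
   [kern p x = x / enorm x `^ (p + 1)]: the symmetrisation gains the factor
   [enorm x] that makes the product integrable at the origin. *)
Definition sprod x w : R := dot (kern p x) (kern s (x - w) + kern s (x + w)).

Lemma measurable_sprod d' (T : measurableType d') (f g : T -> V) :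
  measurable_fun setT f -> measurable_fun setT g ->
  measurable_fun setT (fun t => sprod (f t) (g t)).
Proof. by move=> mf mg; rewrite /sprod; meas. Qed.

Lemma sprodZ (c : R) x w : 0 < c ->
  sprod (c *: x) (c *: w) = c `^ (- p) * c `^ (- s) * sprod x w.
Proof.
move=> c0; rewrite /sprod -(scalerBr c x w) -(scalerDr c x w).
rewrite (kernZ p x c0) (kernZ s (x - w) c0) (kernZ s (x + w) c0).
by rewrite -(scalerDr _ (kern s (x - w))) dotZl dotZr mulrA.
Qed.

Lemma sprod_householder v x w :
  sprod (householder v x) (householder v w) = sprod x w.
Proof.
rewrite /sprod -householderB -householderD !kern_householder.
by rewrite -householderD householder_dot.
Qed.

Lemma sprod_le x w : `|sprod x w| <=
  epow p x * (epow s (x - w) + epow s (x + w)).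
Proof.
apply: le_trans (cauchy_schwarz _ _) _.
rewrite enorm_kern// ler_wpM2l ?epow_ge0//.
by apply: le_trans (enormD _ _) _; rewrite !enorm_kern.
Qed.

Local Open Scope ereal_scope.

(** Near the origin the terms [kern s (- w)] and [kern s w] cancel, and
   [kern_lipschitz] leaves the integrable power [epow (p - 1)]. Elsewhere
   [kern p] is dominated by an integrable weight. *)
Lemma int_sprod_unit : exists2 C, (0 <= C)%R & forall w, enorm w = 1%R ->
  \int[L]_x `|sprod x w|%:E <= C%:E.
Proof.
have [C C0 CP] := @kern_lipschitz R d s s0.
have [A A0 AP] := int_epow_near p10.
have [B B0 BP] := int_epow_wt sd dp.
(* [K] compares [epow p] with the weight outside the ball of radius [2^-1]. *)
have [K [K0 K1 KE]] : exists K : R, [/\ 0 < K, 1 <= K & K = 2 `^ p]%R.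
  exists (2 `^ p)%R; split=> //.
  by rewrite -[leLHS](powRr0 (2 : R)); apply: ler_powR; [lra|exact: ltW].
exists (2 * C * A + K * (B + B))%R => [|w w1].
  by rewrite addr_ge0 ?mulr_ge0 ?addr_ge0 ?(ltW K0).
apply: (@le_trans _ _ (\int[L]_x
  (2 * C * (epow (p - 1) x * (enorm x < 1)%R%:R) +
   K * (epow s (x - w) * wt p x + epow s (x - - w) * wt p x))%:E)).
  apply: le_intT.
  - apply: measurableT_comp => //.
    by apply: measurable_sprod; [exact: measurable_id|exact: measurable_cst].
  - by meas.
  move=> x; rewrite normr_ge0/= opprK.
  have E1 := epow_ge0 s (x - w)%R; have E2 := epow_ge0 s (x + w)%R.
  have W0 := ltW (wt_gt0 p x); have Ep := epow_ge0 p x.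
  have Ep1 := epow_ge0 (p - 1)%R x.
  have T1 : (0 <= 2 * C * (epow (p - 1) x * (enorm x < 1)%R%:R))%R.
    by rewrite mulr_ge0 ?mulr_ge0.
  have T2 : (0 <= K * (epow s (x - w) * wt p x + epow s (x + w) * wt p x))%R.
    exact: mulr_ge0 (ltW K0) (addr_ge0 (mulr_ge0 E1 W0) (mulr_ge0 E2 W0)).
  have [xs|xb] := leP (2 * enorm x)%R 1%R.
    apply: ler_wpDr; first exact: T2.
    rewrite (lt1_of_half (enorm_ge0 x) xs).
    rewrite mulr1; apply: le_trans (cauchy_schwarz _ _) _.
    rewrite enorm_kern//.
    have -> : (kern s (x - w) + kern s (x + w) =
      (kern s (- w + x) - kern s (- w)) + (kern s (w + x) - kern s w))%R.
      by rewrite kernN opprK addrACA subrr addr0 (addrC (- w)%R) (addrC w).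
    have wE : epow (s + 1) w = 1%R by rewrite /epow w1 powR1.
    apply: (@le_trans _ _ (epow p x * (C * (enorm x * 1) + C * (enorm x * 1)))%R).
      rewrite ler_wpM2l//; apply: le_trans (enormD _ _) _; apply: lerD.
        by rewrite -wE -(epowN _ w); apply: CP; rewrite enormN w1.
      by rewrite -wE; apply: CP; rewrite w1.
    rewrite mulr1 -(@epow_mul1 _ _ (p - 1)%R x) ?subrK; last first.
      by rewrite gt_eqF//; case/andP: p10.
    by rewrite le_eqVlt; apply/orP; left; apply/eqP; ring.
  apply: ler_wpDl; first exact: T1.
  apply: le_trans (sprod_le _ _) _.
  rewrite -mulrDl (mulrC _ (wt _ _)) mulrA.
  apply: ler_wpM2r; first exact: (addr_ge0 E1 E2).
  rewrite wtE; case: (ltP (enorm x) 1%R) => x1; last first.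
    by rewrite mulr1 add0r ler_peMl.
  rewrite mulr0 addr0 mulr1.
  have := @epow_le _ _ p x 2^-1%R p0; rewrite -(@powR_inv1 _ 2)//.
  rewrite -powRrM mulN1r opprK -KE powR_inv1; last exact: ltW.
  by apply; [exact: half_gt0|rewrite -[leLHS]mulr1 ler_pdivrMl// ltW].
rewrite intTD//; last 4 first.
- by meas.
- by meas.
- by move=> x; rewrite !mulr_ge0 ?epow_ge0.
- by move=> x; rewrite mulr_ge0 ?(ltW K0)// addr_ge0// mulr_ge0 ?epow_ge0 ?(ltW (wt_gt0 _ _)).
rewrite intTZ ?mulr_ge0//; last 2 first.
- by meas.
- by move=> x; rewrite mulr_ge0 ?epow_ge0.
rewrite intTZ ?(ltW K0)//; last 2 first.
- by meas.
- by move=> x; rewrite addr_ge0// mulr_ge0 ?epow_ge0 ?(ltW (wt_gt0 _ _)).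
rewrite intTD//; last 4 first.
- by meas.
- by meas.
- by move=> x; rewrite mulr_ge0 ?epow_ge0 ?(ltW (wt_gt0 _ _)).
- by move=> x; rewrite mulr_ge0 ?epow_ge0 ?(ltW (wt_gt0 _ _)).
rewrite EFinD; apply: leeD; rewrite [leRHS]EFinM.
  by apply: lee_wpmul2l; [rewrite lee_fin mulr_ge0|exact: AP].
apply: lee_wpmul2l; first by rewrite lee_fin ltW.
by rewrite EFinD; apply: leeD; exact: BP.
Qed.

Lemma powR_split (c : R) : (0 < c)%R ->
  (c ^+ d * (c `^ (- p) * c `^ (- s)) = c `^ (- q))%R.
Proof.
move=> c0; rewrite -powR_mulrn ?(ltW c0)// -!powRD ?(gt_eqF c0) ?implybT//.
by congr (_ `^ _)%R; ring.
Qed.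

(** Householder reflections act transitively on the sphere, so that the
   direction of [w] does not matter. *)
Lemma int_sprod_polar (f : R -> R) : measurable_fun setT f ->
  forall w0 w, enorm w0 = 1%R -> w != 0%R ->
  \int[L]_x (f (sprod x w))%:E =
  (enorm w ^+ d)%:E *
  \int[L]_x (f (enorm w `^ (- p) * enorm w `^ (- s) * sprod x w0)%R)%:E.
Proof.
move=> mf w0 w w01 wn0; have wg := enorm_gt0 wn0.
have cw : enorm w = enorm (enorm w *: w0) by rewrite enormZ w01 mulr1 gtr0_norm.
move: cw wg; set c := (X in _ = enorm (X *: _)) => cw wg.
have mfs v : measurable_fun setT (fun x => (f (sprod x v))%:E).
  apply/measurable_EFinP; apply: (measurableT_comp mf).
  by apply: measurable_sprod; [exact: measurable_id|exact: measurable_cst].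
transitivity (\int[L]_x (f (sprod x (c *: w0)%R))%:E).
  rewrite -(integral_householder (w - c *: w0)%R (mfs (c *: w0)%R)).
  by apply: eq_integral => x _; rewrite -{2}(householder_swap cw) sprod_householder.
have c0 : c != 0%R by rewrite gt_eqF.
rewrite (integral_affine 0%R c0 (mfs _)) (gtr0_norm wg); congr (_ * _).
by apply: eq_integral => x _; rewrite addr0 sprodZ.
Qed.

Lemma int_abs_sprod w0 w : enorm w0 = 1%R -> w != 0%R ->
  \int[L]_x `|sprod x w|%:E = (epow q w)%:E * \int[L]_x `|sprod x w0|%:E.
Proof.
move=> w01 wn0; have wg := enorm_gt0 wn0.
have k0 : (0 < enorm w `^ (- p) * enorm w `^ (- s))%R by rewrite mulr_gt0 ?powR_gt0.
rewrite (int_sprod_polar (@normr_measurable R setT) w01 wn0).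
under eq_integral do rewrite normrM (gtr0_norm k0).
rewrite intTZ ?(ltW k0)//; last first.
  apply: measurableT_comp => //.
  by apply: measurable_sprod; [exact: measurable_id|exact: measurable_cst].
by rewrite muleA -EFinM powR_split.
Qed.

Lemma int_abs_sprod_le : exists2 C, (0 <= C)%R & forall w, w != 0%R ->
  \int[L]_x `|sprod x w|%:E <= (C * epow q w)%:E.
Proof.
have [w0 w01] := @exists_enorm1 R d d0.
have [C C0 CP] := int_sprod_unit; exists C => // w wn0.
rewrite (int_abs_sprod w01 wn0) mulrC EFinM; apply: lee_wpmul2l; last exact: CP.
by rewrite lee_fin epow_ge0.
Qed.

Lemma integrable_sprod w : w != 0%R ->
  L.-integrable setT (EFin \o (fun x => sprod x w)).
Proof.
move=> wn0; have [C C0 CP] := int_abs_sprod_le.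
have ms : measurable_fun setT (fun x => sprod x w).
  by apply: measurable_sprod; [exact: measurable_id|exact: measurable_cst].
apply: (@integrable_le _ _ _ _ _ (fun x => `|sprod x w|)%R) (CP _ wn0) => //.
exact: measurableT_comp.
Qed.

(** Scaling and invariance under reflections leave one unknown, the value [k] of
   the integral on the unit sphere; [sprod_const_gt0] gives its sign. *)
Lemma int_sprod : exists k : R, forall w, w != 0%R ->
  \int[L]_x (sprod x w)%:E = (k * epow q w)%:E.
Proof.
have [w0 w01] := @exists_enorm1 R d d0.
have w00 : w0 != 0%R.
  by apply: contra_eq_neq w01 => ->; rewrite enorm0 eq_sym oner_neq0.
exists (\int[L]_x sprod x w0)%R => w wn0; have wg := enorm_gt0 wn0.
rewrite (int_sprod_polar (@measurable_id _ _ setT) w01 wn0).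
under eq_integral do rewrite EFinM.
rewrite integralZl//; last exact: integrable_sprod.
rewrite muleA -EFinM powR_split// EFinM muleC RintE//.
exact: integrable_sprod.
Qed.

Lemma int_sprod_swap (k : R) (h : V -> R) (b : V) (r : R) : (0 < r)%R ->
  (forall w, w != 0%R -> \int[L]_x (sprod x w)%:E = (k * epow q w)%:E) ->
  measurable_fun setT h ->
  (forall w, 0 <= h w <= (enorm (w - b) < r)%R%:R)%R ->
  \int[L]_x \int[L]_w (sprod x w * h w)%:E =
  k%:E * \int[L]_w (epow q w * h w)%:E.
Proof.
move=> r0 kP mh hb.
have h0 w : (0 <= h w)%R by case/andP: (hb w).
have [C C0 CP] := int_abs_sprod_le; have [D D0 DP] := int_epow_ball q0.
have ms : measurable_fun setT (fun z : V * V => sprod z.1 z.2 * h z.2)%R.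
  apply: measurable_funM; first exact: measurable_sprod.
  exact: measurableT_comp mh measurable_snd.
have ms' : measurable_fun setT (fun z : V * V => sprod z.2 z.1 * h z.1)%R.
  apply: measurable_funM; first exact: measurable_sprod.
  exact: measurableT_comp mh measurable_fst.
have meh : measurable_fun setT (fun w => epow q w * h w)%R by meas.
have eh0 w : (0 <= epow q w * h w)%R by rewrite mulr_ge0 ?epow_ge0.
pose M : R := (D * (r ^+ d * r `^ (- q)))%R.
have ehM : \int[L]_w (epow q w * h w)%:E <= M%:E.
  apply: le_trans (DP b 0%R r r0); apply: le_intT => //; first by meas.
  by move=> w; rewrite eh0 subr0/= ler_wpM2l ?epow_ge0//; case/andP: (hb w).
rewrite (@fubini_real' _ _ _ _ _ L L _ ms)/=; last first.
  apply: (@le_lt_trans _ _ (\int[L]_w (C * (epow q w * h w))%:E)).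
    apply: le_intT_ne0 => //.
    - apply: (@measurable_int_param _ _ _ _ _ L
        (fun z : V * V => `|sprod z.2 z.1 * h z.1|)%R).
      exact: measurableT_comp ms'.
    - by meas.
    - by move=> w; exact: intT_ge0.
    - by move=> w; rewrite lee_fin mulr_ge0.
    move=> w wn0; under eq_integral do rewrite normrM (ger0_norm (h0 w)) mulrC.
    rewrite intTZ//; last first.
      apply: measurableT_comp => //.
      by apply: measurable_sprod; [exact: measurable_id|exact: measurable_cst].
    rewrite mulrA mulrC EFinM; apply: lee_wpmul2l; last exact: CP.
    by rewrite lee_fin.
  rewrite intTZ//; apply: (@le_lt_trans _ _ (C%:E * M%:E)); last exact: ltry.
  by apply: lee_wpmul2l.
rewrite -integralZl//; last first.
  by apply: (integrable_le meh meh _ ehM) => w; rewrite ger0_norm.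
apply: (eq_intT_ne d0 (a := 0%R)) => //.
- apply: (@measurable_int_param _ _ _ _ _ L
    (fun z : V * V => sprod z.2 z.1 * h z.1)%R).
  exact: ms'.
- by apply: measurable_funeM; exact/measurable_EFinP.
move=> w wn0; under eq_integral do rewrite EFinM.
by rewrite integralZr ?kP// -?EFinM ?mulrA//; exact: integrable_sprod.
Qed.

Let rad x w : R := dot (kern p x) (kern s (x - w)).

Let radE x w : rad x w = (epow (p + 1) x * epow (s + 1) (x - w) * dot x (x - w))%R.
Proof. by rewrite /rad !kernE dotZl dotZr mulrA. Qed.

Let mrad x (r : R) : measurable_fun setT (fun w => rad x w * (enorm w < r)%R%:R)%R.
Proof. by rewrite /rad; meas. Qed.

Let irad x (r : R) : (0 < r)%R ->
  L.-integrable setT (EFin \o (fun w => rad x w * (enorm w < r)%R%:R)%R).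
Proof.
move=> r0; have [D D0 DP] := int_epow_ball sd.
apply: (@integrable_le _ _ _ _ _
  (fun w => epow p x * (epow s (w - x) * (enorm (w - 0) < r)%R%:R))%R
  (epow p x * (D * (r ^+ d * r `^ (- s))))%R) => //.
- by meas.
- move=> w; rewrite subr0 normrM mulrA normr_nat ler_wpM2r//.
  apply: le_trans (cauchy_schwarz _ _) _.
  by rewrite (enorm_kern _ sn0) (enorm_kern _ pn0) -(epowN _ (w - x)%R) opprB.
- rewrite intTZ ?epow_ge0//; last 2 first.
  + by meas.
  + by move=> w; rewrite mulr_ge0 ?epow_ge0.
  by rewrite EFinM; apply: lee_wpmul2l; [rewrite lee_fin epow_ge0|exact: DP].
Qed.

(** The field of the uniform measure on a centred ball never points inwards: the
   affine reflection in the hyperplane through [x] orthogonal to [x] sends the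
   part of the ball beyond that hyperplane into the ball, and reverses the
   component of the kernel along [x]. *)
Lemma ball_field_outward x (r : R) : (0 < r)%R ->
  0 <= \int[L]_w (rad x w * (enorm w < r)%R%:R)%:E.
Proof.
move=> r0; pose F w := (rad x w * (enorm w < r)%R%:R)%R.
have mF := mrad x r; have iF := irad x r0; rewrite -/F in mF iF *.
pose Fp w := Num.max (F w) 0%R; pose Fm w := Num.max (- F w)%R 0%R.
have mFp : measurable_fun setT Fp by exact: measurable_maxr.
have mFm : measurable_fun setT Fm.
  by apply: measurable_maxr => //; exact: measurable_funN.
have FE w : F w = (Fp w - Fm w)%R.
  rewrite /Fp /Fm; have [Fw|/ltW Fw] := leP 0%R (F w).
    by rewrite max_r ?subr0// oppr_le0.
  by rewrite max_l ?oppr_ge0// sub0r opprK.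
have iFp : L.-integrable setT (EFin \o Fp).
  apply: le_integrable iF => //; first exact/measurable_EFinP.
  move=> w _; rewrite lee_fin /Fp; case: (ltP (F w) 0%R) => Fw.
    by rewrite normr0.
  by [].
have iFm : L.-integrable setT (EFin \o Fm).
  apply: le_integrable iF => //; first exact/measurable_EFinP.
  move=> w _; rewrite lee_fin /Fm; case: (ltP (- F w)%R 0%R) => Fw.
    by rewrite normr0.
  by rewrite normrN.
have -> : \int[L]_w (rad x w * (enorm w < r)%R%:R)%:E =
    \int[L]_w ((Fp w)%:E - (Fm w)%:E).
  by apply: eq_integral => w _; rewrite -EFinB -FE.
rewrite integralB_EFin// sube_ge0; last first.
  by apply/orP; left; exact: integrable_fin_num.
pose H := householder x.
have Hx v : dot x (H v) = (- dot x v)%R.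
  have Hxx : H x = (- x)%R.
    rewrite /H /householder; have [->|xn0] := eqVneq x 0%R.
      by rewrite scaler0 subr0 oppr0.
    have xx : dot x x != 0%R by rewrite -enorm_sqr sqrf_eq0 gt_eqF// enorm_gt0.
    by rewrite mulfK// scaler_nat mulr2n opprD addrA subrr sub0r.
  by rewrite -(householder_dot x) -/H Hxx /H householderK dotNl.
have mH : measurable_fun setT (fun w => H w) by rewrite /H /householder; meas.
have mFmE : measurable_fun setT (EFin \o Fm) by exact/measurable_EFinP.
rewrite -(integral_shift x mFmE).
rewrite -(integral_householder x) -/H; last first.
  by apply: (measurableT_comp mFmE); meas.
rewrite -(integral_shift (- x)%R); last first.
  by apply: (measurableT_comp mFmE); meas.
apply: le_intT => //.
  by apply: (measurableT_comp mFm); apply: measurable_addv => //;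
     apply: (measurableT_comp mH); meas.
move=> w; rewrite /Fm le_max lexx orbT/=.
set v := (H (w - x) + x)%R; rewrite ge_max [X in _ && X]le_max lexx orbT andbT.
have xv : (x - v = H (x - w))%R.
  by rewrite /v opprD addrCA subrr addr0 /H -householderN opprB.
have rv : rad x v = (- rad x w)%R.
  have eH : epow (s + 1) (H (x - w)%R) = epow (s + 1) (x - w)%R.
    by rewrite /epow /H householder_enorm.
  by rewrite radE radE xv Hx eH mulrN.
rewrite /Fp le_max /F rv mulNr opprK.
case: (ltP (enorm v) r) => vr; last by rewrite mulr0 lexx orbT.
case: (lerP (rad x w) 0%R) => rw; first by rewrite mulr1 rw orbT.
suff -> : (enorm w < r)%R by rewrite lexx.
apply: le_lt_trans vr; rewrite -ler_sqr ?nnegrE ?enorm_ge0// !enorm_sqr.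
have xw : (0 <= dot x (x - w))%R.
  rewrite leNgt; apply/negP => xw; move: rw.
  by rewrite radE ltNge nmulr_lle0 ?mulr_ge0 ?epow_ge0.
have -> : dot w w = (dot (x - w) (x - w) - 2 * dot x (x - w) + dot x x)%R.
  by rewrite !dotE (dotC w x); ring.
have -> : dot v v = (dot (x - w) (x - w) + 2 * dot x (x - w) + dot x x)%R.
  have HH : dot (H (w - x)%R) (H (w - x)%R) = dot (w - x)%R (w - x)%R.
    exact: householder_dot.
  rewrite /v dotDl dotDr dotDr HH (dotC (H (w - x)%R) x) Hx.
  by rewrite !dotE (dotC w x); ring.
by rewrite !lerD2r; lra.
Qed.

Lemma int_sprod_ball x : 
  \int[L]_w (sprod x w * (enorm w < 1)%R%:R)%:E =
  2%:E * \int[L]_w (rad x w * (enorm w < 1)%R%:R)%:E.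
Proof.
pose F w := (rad x w * (enorm w < 1)%R%:R)%R.
have mF : measurable_fun setT F := mrad x 1%R.
have mFE : measurable_fun setT (EFin \o F) by exact/measurable_EFinP.
have iF : L.-integrable setT (EFin \o F) := irad x ltr01.
have mFN : measurable_fun setT (fun w => F (- w)%R) by rewrite /F /rad; meas.
have iFN : L.-integrable setT (EFin \o (fun w => F (- w)%R)).
  case/integrableP: iF => _ iF; apply/integrableP; split; first exact/measurable_EFinP.
  rewrite -(integral_flip 0%R) in iF; last exact: measurableT_comp.
  by move: iF; under eq_integral do rewrite sub0r.
transitivity (\int[L]_w ((F w)%:E + (F (- w)%R)%:E)).
  apply: eq_integral => w _; rewrite -EFinD /F enormN -mulrDl /rad opprK.
  by rewrite /sprod dotDr.
rewrite integralD_EFin//.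
have -> : \int[L]_w (F (- w)%R)%:E = \int[L]_w (F w)%:E.
  by rewrite -[RHS](integral_flip 0%R mFE); apply: eq_integral => w _; rewrite sub0r.
rewrite -(RintE iF) -EFinD -EFinM; congr EFin; ring.
Qed.

(** Integrate over the unit ball of [w]. By [int_sprod_swap] this multiplies [k]
   by a nonnegative number, and by [int_sprod_ball] it leaves twice the
   outward component of the field of the ball, which is never negative, and
   is positive at all points outside the ball. *)
Lemma sprod_const_gt0 (k : R) :
  (forall w, w != 0%R -> \int[L]_x (sprod x w)%:E = (k * epow q w)%:E) ->
  (0 < k)%R.
Proof.
move=> kP.
pose h w : R := (enorm w < 1)%R%:R.
have mh : measurable_fun setT h by rewrite /h; meas.
have := @int_sprod_swap k h 0%R 1%R ltr01 kP mh.
have hb w : (0 <= h w <= (enorm (w - 0) < 1)%R%:R)%R by rewrite subr0 /h ler0n lexx.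
move=> /(_ hb) E.
have J0 x : 0 <= \int[L]_w (sprod x w * h w)%:E.
  rewrite int_sprod_ball; apply: mule_ge0 => //; exact: ball_field_outward.
have [w0 w01] := @exists_enorm1 R d d0.
have : 0 < \int[L]_x \int[L]_w (sprod x w * h w)%:E.
  apply: (@integral_gt0 _ _ _ (2 *: w0)%R 1%R) => //.
    apply: (@measurable_int_param _ _ _ _ _ L (fun z : V * V => sprod z.1 z.2 * h z.2)%R).
    apply: measurable_funM; first exact: measurable_sprod.
    exact: measurableT_comp mh measurable_snd.
  move=> x xb.
  have x1 : (1 < enorm x)%R.
    have := enorm_subl (2 *: w0)%R x; rewrite enormB enormZ w01 mulr1 ger0_norm// in xb *.
    by move: xb; lra.
  rewrite int_sprod_ball mule_gt0//.
  have rad0 w : (enorm w < 1)%R -> (0 < rad x w)%R.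
    move=> w1; have xw : (0 < dot x (x - w))%R.
      rewrite dotBr -enorm_sqr subr_gt0; apply: le_lt_trans (dot_le _ _) _.
      by rewrite expr2 ltr_pM2l ?(lt_trans ltr01)// (lt_trans w1).
    rewrite radE !mulr_gt0 ?epow_gt0//.
      by apply: contraTneq x1 => ->; rewrite enorm0 ltr10.
    rewrite subr_eq0; apply: contraTneq x1 => ->; by rewrite -leNgt ltW.
  apply: (@integral_gt0 _ _ _ 0%R 1%R) => //.
  - by apply/measurable_EFinP; exact: mrad.
  - move=> w; rewrite lee_fin; case: (ltP (enorm w) 1%R) => w1; last by rewrite mulr0.
    by rewrite mulr1 ltW// rad0.
  - by move=> w; rewrite subr0 => w1; rewrite w1 mulr1 lte_fin rad0.
rewrite E => kpos; rewrite ltNge; apply/negP => k0.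
move: kpos; rewrite ltNge => /negP; apply.
have := k0; rewrite -lee_fin => k0'.
apply: mule_le0_ge0 => //.
by apply: intT_ge0 => w; rewrite mulr_ge0 ?epow_ge0// /h ler0n.
Qed.

End singular_test.

(** * A test field that detects concentration of mass *)

Section test_field.
Context {R : realType} {d : nat} (d0 : (0 < d)%N).
Variables (s p : R).
Hypotheses (s0 : 0 < s) (dp : d%:R < p) (pd : p < d%:R + 1)
  (spd : s + p < d%:R + d%:R).
Local Notation V := 'rV[R]_d.
Local Notation L := (@lebesgue_rV R d).
Local Notation q := (s + p - d%:R).
Implicit Types (x y u w z v : V).

Let d1 : 1 <= d%:R :> R. Proof. by rewrite ler1n. Qed.
Let sd : 0 < s < d%:R. Proof. by move: s0 spd dp => *; apply/andP; split; lra. Qed.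
Let p0 : 0 < p. Proof. by move: d1 dp => *; lra. Qed.
Let sn0 : s != 0. Proof. by rewrite gt_eqF. Qed.
Let pn0 : p != 0. Proof. by rewrite gt_eqF. Qed.
Let p10 : 0 < p - 1 < d%:R.
Proof. by move: d1 dp pd => *; apply/andP; split; lra. Qed.
Let q0 : 0 < q < d%:R. Proof. by move: s0 spd dp => *; apply/andP; split; lra. Qed.

Definition tent z : R := Num.max 0 (1 - enorm z).

Lemma tent_ge0 z : 0 <= tent z. Proof. by rewrite /tent le_max lexx. Qed.

Lemma tent_le z : tent z <= (enorm z < 1)%R%:R.
Proof.
rewrite /tent; case: (ltP (enorm z) 1) => z1; rewrite ge_max ?ler01/=.
  by rewrite gerBl enorm_ge0.
by rewrite lexx subr_le0.
Qed.

Lemma tentN z : tent (- z) = tent z.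
Proof. by rewrite /tent enormN. Qed.

Lemma tent_lipschitz y z : `|tent y - tent z| <= enorm (y - z).
Proof.
suff H a b : tent a - tent b <= enorm (a - b).
  by rewrite ler_norml H andbT lerNl opprB enormB H.
rewrite lerBlDr /tent ge_max addr_ge0 ?enorm_ge0 ?le_max ?lexx//=.
have := enorm_subl b a; rewrite enormB => ba.
apply: (@le_trans _ _ (enorm (a - b) + (1 - enorm b))); first lra.
by rewrite lerD2l le_max lexx orbT.
Qed.

Lemma measurable_tent d' (T : measurableType d') (f : T -> V) :
  measurable_fun setT f -> measurable_fun setT (fun t => tent (f t)).
Proof. by move=> mf; rewrite /tent; meas. Qed.

Definition dtent u x : R := tent (u - x) - tent (u + x).

Lemma measurable_dtent d' (T : measurableType d') (f g : T -> V) :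
  measurable_fun setT f -> measurable_fun setT g ->
  measurable_fun setT (fun t => dtent (f t) (g t)).
Proof.
move=> mf mg; apply: measurable_funB; apply: measurable_tent.
  exact: measurable_subv.
exact: measurable_addv.
Qed.

Lemma dtent_lipschitz u x : `|dtent u x| <= 2 * enorm x.
Proof.
apply: le_trans (tent_lipschitz _ _) _.
have -> : u - x - (u + x) = (-2) *: x.
  by rewrite opprD addrACA subrr add0r scaleNr scaler_nat mulr2n opprD.
by rewrite enormZ normrN ger0_norm.
Qed.

Lemma dtent_le_ind u x :
  `|dtent u x| <= (enorm (u - x) < 1)%R%:R + (enorm (u + x) < 1)%R%:R.
Proof.
apply: le_trans (ler_normB _ _) _.
by rewrite !ger0_norm ?tent_ge0// lerD// tent_le.
Qed.

Lemma dtentN u x : dtent (- u) x = - dtent u x.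
Proof.
by rewrite /dtent -opprD tentN -(tentN (- u + x)) opprD opprK opprB.
Qed.

(** Twice the convolution of the tent function with the field [kern p], which is
   not integrable at the origin: pairing [x] with [- x] makes the integral
   converge. *)
Definition test u : V := vint L (fun x => dtent u x *: kern p x).

Let mtest u : measurable_fun setT (fun x => dtent u x *: kern p x).
Proof.
apply: measurable_scalev; last by meas.
by apply: measurable_dtent; [exact: measurable_cst|exact: measurable_id].
Qed.

Let mdt u : measurable_fun setT (fun x => epow p x * `|dtent u x|).
Proof.
apply: measurable_funM; first by meas.
apply: measurableT_comp => //.
by apply: measurable_dtent; [exact: measurable_cst|exact: measurable_id].
Qed.

Let ntest u x : enorm (dtent u x *: kern p x) = epow p x * `|dtent u x|.
Proof. by rewrite enormZ (enorm_kern _ pn0) mulrC. Qed.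

Local Open Scope ereal_scope.

(** For bounded [u], the difference of tents is Lipschitz in [x] and bounded. For
   large [u], it vanishes unless [x] is close to [u] or to [- u]. *)
Lemma int_dtent : exists2 C, (0 <= C)%R & forall u,
  \int[L]_x (epow p x * `|dtent u x|)%:E <= (C * wt p u)%:E.
Proof.
have [A A0 AP] := int_epow_near p10; have [B B0 BP] := int_epow_far dp.
have [K [K0 KE]] : exists K : R, (0 <= K)%R /\ K = (2 `^ p)%R.
  by exists (2 `^ p)%R; split => //; exact: powR_ge0.
have b0 : (0 <= @vball R d)%R by exact/ltW/vball_gt0.
exists (K * (2 * A + 2 * B) + K * (@vball R d + @vball R d))%R => [|u].
  by rewrite addr_ge0 ?mulr_ge0 ?addr_ge0 ?mulr_ge0.
have W0 := wt_gt0 p u; have W0' := ltW W0.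
have [u2|u2] := ltP (enorm u) 2%R.
  apply: (@le_trans _ _ (\int[L]_x (2 * (epow (p - 1) x * (enorm x < 1)%R%:R) +
     2 * (epow p x * (1 <= enorm x)%R%:R))%:E)).
    apply: le_intT => //; first by meas.
    move=> x; have E0 := epow_ge0 p x.
    rewrite (mulr_ge0 E0 (normr_ge0 _))/=.
    case: ltP => x1; rewrite ?mulr1 ?mulr0 ?addr0 ?add0r.
      apply: le_trans (ler_wpM2l E0 (dtent_lipschitz u x)) _.
      rewrite -(@epow_mul1 _ _ (p - 1)%R x) ?subrK; last first.
        by rewrite gt_eqF//; case/andP: p10.
      by rewrite mulrC mulrA.
    rewrite mulrC; apply: ler_wpM2r => //.
    apply: le_trans (dtent_le_ind u x) _.
    by case: (_ < _)%R; case: (_ < _)%R; rewrite ?addr0 ?add0r//= ler1n.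
  rewrite intTD//; last 4 first.
  - by meas.
  - by meas.
  - by move=> x; rewrite !mulr_ge0 ?epow_ge0.
  - by move=> x; rewrite !mulr_ge0 ?epow_ge0.
  rewrite intTZ//; last 2 first.
  - by meas.
  - by move=> x; rewrite !mulr_ge0 ?epow_ge0.
  rewrite intTZ//; last 2 first.
  - by meas.
  - by move=> x; rewrite !mulr_ge0 ?epow_ge0.
  apply: (@le_trans _ _ ((2 * A + 2 * B)%:E)).
    have -> : (2 * A + 2 * B)%:E = 2%:E * A%:E + 2%:E * B%:E by [].
    by apply: leeD; apply: lee_wpmul2l.
  have KW : (1 <= K * wt p u)%R.
    rewrite KE /wt powRN ler_pdivlMr ?powR_gt0 ?lt_max ?ltr01// mul1r.
    apply: ge0_ler_powR; rewrite ?nnegrE ?(ltW p0) ?le_max ?ler01//.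
    by rewrite ge_max (ltW u2) ler1n.
  rewrite lee_fin [leRHS]mulrDl; apply: ler_wpDr.
    exact: (mulr_ge0 (mulr_ge0 K0 (addr_ge0 b0 b0)) W0').
  by rewrite mulrAC; apply: ler_peMl => //; rewrite addr_ge0 ?mulr_ge0.
apply: (@le_trans _ _ (\int[L]_x (K * wt p u *
   ((enorm (x - u) < 1)%R%:R + (enorm (x - - u) < 1)%R%:R))%:E)).
  apply: le_intT => //; first by meas.
  move=> x; have E0 := epow_ge0 p x.
  rewrite (mulr_ge0 E0 (normr_ge0 _))/=.
  have KW0 : (0 <= K * wt p u)%R by exact: mulr_ge0.
  have D : (`|dtent u x| <= (enorm (x - u) < 1)%R%:R + (enorm (x - - u) < 1)%R%:R)%R.
    by rewrite enormB opprK (addrC x); exact: dtent_le_ind.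
  have [xu|xu] := leP (enorm u) (2 * enorm x)%R.
    apply: le_trans (ler_wpM2l E0 D) _; apply: ler_wpM2r; first exact: addr_ge0.
    have ug : (0 < enorm u)%R by apply: lt_le_trans u2.
    have u12 : (0 < 2^-1 * enorm u)%R by rewrite mulr_gt0// half_gt0.
    have xu' : (2^-1 * enorm u <= enorm x)%R by rewrite ler_pdivrMl.
    apply: le_trans (epow_le p0 u12 xu') _.
    rewrite powRM ?(ltW half_gt0) ?(ltW ug)// -(@powR_inv1 _ 2)//.
    rewrite -powRrM mulN1r opprK -KE ler_wpM2l// wtE.
    have u1 : (1 <= enorm u)%R by apply: le_trans u2; rewrite ler1n.
    by rewrite u1 mulr1 lerDr.
  have -> : dtent u x = 0%R.
    apply/eqP; rewrite -normr_le0; apply: le_trans D _.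
    have h1 : (enorm (x - u) < 1)%R = false.
      apply/negbTE; rewrite -leNgt enormB.
      by have := enorm_subl u x; move: xu u2; lra.
    have h2 : (enorm (x - - u) < 1)%R = false.
      apply/negbTE; rewrite -leNgt opprK addrC.
      by have := enorm_subl u (- x)%R; rewrite opprK enormN; move: xu u2; lra.
    by rewrite h1 h2 addr0.
  by rewrite normr0 mulr0; apply: mulr_ge0 => //; exact: addr_ge0.
rewrite intTZ//; last 2 first.
- by meas.
- exact: mulr_ge0.
rewrite intTD//; last 2 first.
- by meas.
- by meas.
rewrite !int_ball_ind !lebesgue_ball// expr1n mul1r -EFinD -EFinM lee_fin.
rewrite mulrDl mulrAC ler_wpDl// !mulr_ge0 ?addr_ge0 ?mulr_ge0//.
Qed.

Lemma integrable_test u :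
  L.-integrable setT (fun x => (enorm (dtent u x *: kern p x))%:E).
Proof.
have [C C0 CP] := int_dtent.
under eq_fun do rewrite ntest.
apply: (integrable_le (mdt u) (mdt u) _ (CP u)) => x.
by rewrite ger0_norm// mulr_ge0 ?epow_ge0.
Qed.

Lemma measurable_test : measurable_fun setT test.
Proof.
apply: measurable_fun_rV => i; under eq_fun do rewrite mxE.
apply: (@measurable_Rint_param _ _ _ _ _ L
  (fun z : V * V => (dtent z.1 z.2 *: kern p z.2) ord0 i)).
apply: measurable_coord_fun; apply: measurable_scalev; last by meas.
exact: measurable_dtent.
Qed.

Lemma testN u : test (- u)%R = (- test u)%R.
Proof.
apply/rowP => i; rewrite !mxE -mulN1r -RintegralZl//; last first.
  exact: (integrable_coord i (mtest u) (integrable_test u)).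
by apply: eq_Rintegral => x _; rewrite dtentN scaleNr mxE mulN1r.
Qed.

Lemma test_le : exists2 C, (0 <= C)%R & forall u, (enorm (test u) <= C * wt p u)%R.
Proof.
have [C C0 CP] := int_dtent; exists C => // u; rewrite -lee_fin.
apply: le_trans (enorm_vint _ (mtest u)) _.
by under eq_integral do rewrite ntest; exact: CP.
Qed.

Let itent y b v :
  L.-integrable setT (EFin \o (fun u => dot (kern s (u - y)) v * tent (u - b))%R).
Proof.
have [D D0 DP] := int_epow_ball sd.
apply: (@integrable_le _ _ _ _ _
  (fun u => enorm v * (epow s (u - y) * (enorm (u - b) < 1)%R%:R))%R
  (enorm v * (D * (1 ^+ d * 1 `^ (- s))))%R) => [| |u|].
- by apply: measurable_funM; [meas|apply: measurable_tent; meas].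
- by meas.
- rewrite normrM (ger0_norm (tent_ge0 _)) mulrA.
  apply: ler_pM => //; [exact: tent_ge0| |exact: tent_le].
  apply: le_trans (cauchy_schwarz _ _) _.
  by rewrite (enorm_kern _ sn0) mulrC.
- rewrite intTZ ?enorm_ge0//; last 2 first.
  + by meas.
  + by move=> u; rewrite mulr_ge0 ?epow_ge0.
  by rewrite EFinM; apply: lee_wpmul2l; [rewrite lee_fin enorm_ge0|exact: DP].
Qed.

Let mitent y b v :
  measurable_fun setT (fun u => (dot (kern s (u - y)) v * tent (u - b))%:E).
Proof.
apply/measurable_EFinP.
by apply: measurable_funM; [meas|apply: measurable_tent; meas].
Qed.

(** The substitutions [u = x + y - w] in the first tent and [u = y - x - w] in the
   second one move the symmetrisation in [x] from the tent to the kernel. *)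
Let int_dtent_sprod y x :
  \int[L]_u (dot (kern s (u - y)) (kern p x) * dtent u x)%:E =
  \int[L]_w (sprod s p x w * tent (y - w))%:E.
Proof.
set v := kern p x.
have i1 := itent y x v; have i2 := itent y (- x)%R v.
have j1 := itent x y (- v)%R; have j2 := itent (- x)%R y (- v)%R.
transitivity (\int[L]_u ((dot (kern s (u - y)) v * tent (u - x))%:E -
    (dot (kern s (u - y)) v * tent (u - - x))%:E)).
  by apply: eq_integral => u _; rewrite -EFinB -mulrBr opprK.
rewrite integralB_EFin//.
rewrite -(integral_flip (x + y)%R (mitent y x v)).
rewrite -(integral_flip (y - x)%R (mitent y (- x)%R v)).
transitivity (\int[L]_w (dot (kern s (w - x)) (- v)%R * tent (w - y))%:E -
    \int[L]_w (dot (kern s (w - - x)) v * - tent (w - y))%:E).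
  apply: f_equal2; [|apply: (f_equal oppe)]; apply: eq_integral => w _.
    have -> : (x + y - w - y = - (w - x))%R by rewrite addrAC addrK opprB.
    have -> : (x + y - w - x = - (w - y))%R.
      by rewrite [(x + y)%R]addrC addrAC addrK opprB.
    by rewrite kernN tentN dotNl dotNr.
  have -> : (y - x - w - y = - (w - - x))%R.
    by rewrite opprK addrAC [(y - x)%R]addrC addrK opprD addrC.
  have -> : (y - x - w - - x = - (w - y))%R.
    by rewrite opprK addrAC subrK opprB.
  by rewrite kernN tentN dotNl mulNr mulrN.
have j2' : \int[L]_w (dot (kern s (w - - x)) v * - tent (w - y))%:E =
    \int[L]_w (dot (kern s (w - - x)) (- v)%R * tent (w - y))%:E.
  by apply: eq_integral => w _; rewrite dotNr mulrN mulNr.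
rewrite j2' -(integralB_EFin measurableT j1 j2); apply: eq_integral => w _.
have E1 : kern s (w - x) = (- kern s (x - w))%R by rewrite -(opprB x w) kernN.
rewrite /sprod -/v dotDr E1 opprK (addrC w x) dotNl !dotNr opprK.
rewrite (dotC v) (dotC v) -(tentN (y - w)) opprB -EFinB.
by congr EFin; ring.
Qed.

(** Exchanging the integrals turns the pairing of the kernel with the test field
   into the convolution of the tent with the potential of [int_sprod]. *)
Lemma int_kern_test : exists2 k : R, (0 < k)%R & forall y,
  \int[L]_u (dot (kern s (u - y)) (test u))%:E =
  k%:E * \int[L]_w (epow q w * tent (w - y))%:E.
Proof.
have [k kP] := int_sprod d0 s0 dp pd spd.
exists k => [|y]; first exact: (sprod_const_gt0 d0 s0 dp pd spd kP).
have [C C0 CP] := int_dtent; have [B B0 BP] := int_epow_wt sd dp.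
pose F (z : V * V) : R := (dot (kern s (z.1 - y)) (kern p z.2) * dtent z.1 z.2)%R.
have mF : measurable_fun setT F.
  by apply: measurable_funM; [meas|exact: measurable_dtent].
transitivity (\int[L]_u \int[L]_x (F (u, x))%:E).
  apply: eq_integral => u _; rewrite dotC.
  have [_ ->] := dot_vint (kern s (u - y)) (mtest u) (integrable_test u).
  by apply: eq_integral => x _; rewrite /F/= dotZl mulrC dotC.
rewrite (@fubini_real _ _ _ _ _ L L _ mF); last first.
  apply: (@le_lt_trans _ _ (C * B)%:E); last exact: ltry.
  apply: (@le_trans _ _ (\int[L]_u (C * (epow s (u - y) * wt p u))%:E)).
    apply: ge0_le_integral => //.
    - by move=> u _; apply: intT_ge0 => x.
    - apply: (@measurable_int_param _ _ _ _ _ L (fun z : V * V => `|F z|)%R).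
      exact: measurableT_comp.
    - by apply/measurable_EFinP; meas.
    move=> u _; apply: (@le_trans _ _ (\int[L]_x
        (epow s (u - y) * (epow p x * `|dtent u x|))%:E)).
      apply: le_intT.
      - apply: measurableT_comp => //; rewrite /F/=.
        apply: measurable_funM; first by meas.
        by apply: measurable_dtent; [exact: measurable_cst|exact: measurable_id].
      - by apply: measurable_funM => //; exact: mdt.
      move=> x; rewrite normr_ge0/= /F normrM mulrA; apply: ler_wpM2r => //=.
      apply: le_trans (cauchy_schwarz _ _) _.
      by rewrite (enorm_kern _ sn0) (enorm_kern _ pn0).
    rewrite intTZ ?epow_ge0//; last first.
      by move=> x; rewrite mulr_ge0 ?epow_ge0.
    rewrite mulrCA EFinM; apply: lee_wpmul2l; last exact: CP.
    by rewrite lee_fin epow_ge0.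
  rewrite intTZ//; last 2 first.
  - by meas.
  - by move=> u; rewrite mulr_ge0 ?epow_ge0 ?(ltW (wt_gt0 _ _)).
  by rewrite EFinM; apply: lee_wpmul2l => //; exact: BP.
under eq_integral do rewrite /F/= int_dtent_sprod.
have mh : measurable_fun setT (fun w => tent (y - w)).
  by apply: measurable_tent; meas.
rewrite (int_sprod_swap d0 s0 dp pd spd ltr01 kP mh (b := y)) => [|w].
  congr (_ * _); apply: eq_integral => w _.
  by rewrite -[tent (w - y)%R]tentN opprB.
by rewrite tent_ge0 enormB tent_le.
Qed.

(** For [enorm y < 1], restrict the integral of [int_kern_test] to the ball of
   radius [2^-1] around [y], where the tent is at least [2^-1] and the norm of [w]
   at most [2]. *)
Lemma test_detects : exists2 c : R, (0 < c)%R & forall y,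
  (c * (enorm y < 1)%R%:R)%:E <= \int[L]_u (dot (kern s (u - y)) (test u))%:E.
Proof.
have [k k0 kP] := int_kern_test.
have b0 := @vball_gt0 R d.
pose m : R := (2 `^ (- q) * 2^-1)%R.
have m0 : (0 < m)%R by rewrite mulr_gt0 ?powR_gt0// half_gt0.
exists (k * (m * (2^-1 ^+ d * @vball R d)))%R => [|y].
  by rewrite !mulr_gt0 ?exprn_gt0// half_gt0.
rewrite kP; case: ltP => y1; last first.
  rewrite mulr0; apply: mule_ge0; first by rewrite lee_fin ltW.
  by apply: intT_ge0 => w; rewrite mulr_ge0 ?epow_ge0 ?tent_ge0.
rewrite mulr1 EFinM; apply: lee_wpmul2l; first by rewrite lee_fin ltW.
apply: (@le_trans _ _ (\int[L]_w (m * (enorm (w - y) < 2^-1)%R%:R)%:E)).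
  rewrite intTZ ?(ltW m0)//; last by meas.
  by rewrite int_ball_ind lebesgue_ball ?half_gt0// EFinM.
apply: le_intT_ne0 => //.
- by meas.
- apply/measurable_EFinP; apply: measurable_funM; first by meas.
  by apply: measurable_tent; meas.
- by move=> w; rewrite lee_fin mulr_ge0 ?(ltW m0).
- by move=> w; rewrite lee_fin mulr_ge0 ?epow_ge0 ?tent_ge0.
move=> w w0; rewrite lee_fin; case: (ltP (enorm (w - y)) 2^-1%R) => wy; last first.
  by rewrite mulr0; apply: mulr_ge0; [exact: epow_ge0|exact: tent_ge0].
rewrite mulr1 /m; apply: ler_pM; rewrite ?powR_ge0 ?(ltW half_gt0)//.
  apply: epow_ge => //; first by case/andP: q0.
  have := enorm_subl w y; move: wy y1 (@half_gt0 R); lra.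
by rewrite /tent le_max; apply/orP; right; move: wy; lra.
Qed.

End test_field.

(** * Limits at the right of zero *)

Section small_limits.
Context {R : realType}.

(** [F r = o(r `^ p)] as [r] decreases to [0], for nonnegative [F]. *)
Definition littleo_pow (F : R -> \bar R) (p : R) :=
  forall eta : R, 0 < eta -> exists2 delta : R, 0 < delta &
    forall r : R, 0 < r < delta -> (F r <= (eta * r `^ p)%:E)%E.

Lemma near_right0P (P : R -> Prop) : (\forall r \near (0 : R)^'+, P r) <->
  exists2 delta : R, 0 < delta & forall r, 0 < r < delta -> P r.
Proof.
split=> [[e /= e0 eP]|[e e0 eP]].
  exists e => // r /andP[r0 re]; apply: eP => //=.
  by rewrite sub0r normrN gtr0_norm.
exists e => //= r; rewrite /ball /= sub0r normrN => re r0; apply: eP.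
by rewrite r0/=; rewrite gtr0_norm in re.
Qed.

Lemma cvg_right0P (F : R -> \bar R) :
  (forall r, 0 < r -> (0 <= F r)%E) ->
  (F r @[r --> (0 : R)^'+] --> 0%E) <->
  forall eta : R, 0 < eta -> exists2 delta : R, 0 < delta &
    forall r : R, 0 < r < delta -> (F r <= eta%:E)%E.
Proof.
move=> F0; split=> [/fine_cvgP[Ffin Fcvg] eta eta0|H].
  apply/near_right0P; near=> r.
  have r0 : 0 < r by near: r; exact: nbhs_right_gt.
  rewrite -[leLHS]fineK; last by near: r.
  rewrite lee_fin -[leLHS]ger0_norm ?fine_ge0 ?F0// -[fine _]subr0 distrC.
  by near: r; move/cvgrPdist_le : Fcvg => /(_ _ eta0).
have Ffin : \forall r \near (0 : R)^'+, F r \is a fin_num.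
  have [delta d0 dP] := H 1 ltr01; apply/near_right0P; exists delta => // r rd.
  rewrite ge0_fin_numE; first by apply: le_lt_trans (dP _ rd) _; exact: ltry.
  by apply: F0; case/andP: rd.
apply/fine_cvgP; split => //; apply/cvgrPdist_le => eta eta0.
have [delta d0 dP] := H eta eta0; near=> r.
have rd : 0 < r < delta.
  by apply/andP; split; near: r; [exact: nbhs_right_gt|exact: nbhs_right_lt].
have Fr0 : (0 <= F r)%E by apply: F0; case/andP: rd.
rewrite sub0r normrN ger0_norm/= ?fine_ge0// -lee_fin fineK; first exact: dP.
by near: r.
Unshelve. all: by end_near. Qed.

Lemma littleo_powP (F : R -> \bar R) (p c : R) : 0 < c ->
  (forall r, 0 < r -> (0 <= F r)%E) ->
  ((c * r `^ (- p))%:E * F r @[r --> (0 : R)^'+] --> 0%E)%E <-> littleo_pow F p.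
Proof.
move=> c0 F0.
have k0 r : 0 < r -> 0 < c * r `^ (- p) by move=> r0; rewrite mulr_gt0// powR_gt0.
have E eta r : 0 < r ->
    ((c * r `^ (- p))%:E * F r <= eta%:E)%E = (F r <= (eta / c * r `^ p)%:E)%E.
  move=> r0; rewrite muleC -lee_pdivlMr ?k0// -EFinM -mulrA powRN.
  by rewrite invfM invrK.
rewrite cvg_right0P => [|r r0]; last first.
  by apply: mule_ge0; [rewrite lee_fin ltW ?k0|exact: F0].
split=> H eta eta0.
  have [delta d0 dP] := H (eta * c) (mulr_gt0 eta0 c0); exists delta => // r rd.
  have r0 : 0 < r by case/andP: rd.
  by have := dP r rd; rewrite E// mulfK// gt_eqF.
have [delta d0 dP] := H (eta / c) (divr_gt0 eta0 c0); exists delta => // r rd.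
have r0 : 0 < r by case/andP: rd.
by rewrite E// dP.
Qed.

Lemma norm_le_enorm n (x : 'rV[R]_n) : `|x| <= enorm x.
Proof.
rewrite -[`|x|]/(mx_norm x).
have [->|/mx_norm_neq0[[i j] ->]] := eqVneq (mx_norm x) 0; first exact: enorm_ge0.
by rewrite (ord1 i); exact: coord_le_enorm.
Qed.

Lemma enorm_le_norm n (x : 'rV[R]_n) : enorm x <= n%:R * `|x|.
Proof.
apply: le_trans (enorm_le_sum x) _.
apply: (@le_trans _ _ (\sum_(i < n) `|x|)).
  apply: ler_sum => i _; rewrite -[`|x|]/(mx_norm x) mx_normrE.
  by apply: (le_trans _ (le_bigmax _ _ (ord0, i))).
by rewrite sumr_const card_ord mulr_natl.
Qed.

Lemma cvg_right0_enormP n (f : R -> 'rV[R]_n) (v : 'rV[R]_n) :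
  (f r @[r --> (0 : R)^'+] --> v) <->
  forall eta : R, 0 < eta -> exists2 delta : R, 0 < delta &
    forall r : R, 0 < r < delta -> enorm (f r - v) <= eta.
Proof.
split=> [/cvgrPdist_le H eta eta0|H].
  apply/near_right0P.
  have n0 : 0 < eta / n.+1%:R by rewrite divr_gt0.
  have := H _ n0; apply: filterS => r h; rewrite enormB.
  apply: le_trans (enorm_le_norm _) _.
  apply: (@le_trans _ _ (n.+1%:R * (eta / n.+1%:R))); last first.
    by rewrite mulrC divfK.
  by apply: ler_pM => //; rewrite ler_nat.
apply/cvgrPdist_le => eta eta0; apply/near_right0P.
have [delta d0 dP] := H eta eta0; exists delta => // r rd.
by rewrite distrC; apply: le_trans (norm_le_enorm _) (dP r rd).
Qed.

End small_limits.

(** * Tails of measures with small density *)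

Section tails.
Context {R : realType} {d : nat}.
Local Notation V := 'rV[R]_d.
Variables (mu : {measure set V -> \bar R}) (a : V) (g : V -> R).
Hypotheses (mg : measurable_fun setT g) (g0 : forall x, 0 <= g x).
Variables (p e : R).
Hypotheses (p0 : 0 < p) (e0 : 0 < e).
Local Open Scope ereal_scope.

Let I r := \int[mu]_x (g x * (enorm (x - a) < r)%R%:R)%:E.
Let N r := \int[mu]_x (epow (p + e) (x - a) * (r <= enorm (x - a))%R%:R * g x)%:E.
Let S b r := \int[mu]_x (epow (p + e) (x - a) *
  ((r <= enorm (x - a))%R%:R * (enorm (x - a) < b)%R%:R) * g x)%:E.

(** Dyadic summation, as an induction on the number of halvings that take [b]
   below [r]: the shell between [r] and [2 * r] costs at most
   [r `^ - (p + e) * I (2 * r)], which is [o(r `^ - e)]. *)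
Let shells (b eta : R) : (0 < b)%R -> (0 <= eta)%R ->
  (forall r, (0 < r < b)%R -> I (2 * r)%R <= (eta * r `^ p)%:E) ->
  forall n r, (0 < r)%R -> (b <= 2 ^+ n * r)%R ->
  S b r <= (eta / (1 - 2 `^ (- e)) * r `^ (- e))%:E.
Proof.
move=> b0 eta0 Ib; set q := (2 `^ (- e))%R.
have q1 : (q < 1)%R.
  rewrite /q powRN invf_lt1 ?powR_gt0//.
  have := @gt0_ltr_powR R e e0 1%R 2%R; rewrite powR1; apply; rewrite ?nnegrE//; lra.
have q1' : (0 < 1 - q)%R by rewrite subr_gt0.
have B0 r : (0 <= eta / (1 - q) * r `^ (- e))%R.
  by rewrite mulr_ge0 ?powR_ge0// divr_ge0// ltW.
have far r : (b <= r)%R -> S b r <= (eta / (1 - q) * r `^ (- e))%:E.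
  move=> br; rewrite /S integral0_eq ?lee_fin// => x _.
  case: (ltP (enorm (x - a)) b) => xb; last by rewrite !mulr0 mul0r.
  by rewrite (leNgt r) (lt_le_trans xb br) mul0r mulr0 mul0r.
elim=> [|n IH] r r0 br; first by apply: far; rewrite expr0 mul1r in br.
have [rb|rb] := leP b r; first exact: far.
have r20 : (0 < 2 * r)%R by rewrite mulr_gt0.
have {}IH : S b (2 * r)%R <= (eta / (1 - q) * (2 * r) `^ (- e))%:E.
  by apply: IH => //; rewrite mulrA -exprSr.
apply: (@le_trans _ _ (\int[mu]_x
   (r `^ (- (p + e)) * (g x * (enorm (x - a) < 2 * r)%R%:R) +
    epow (p + e) (x - a) *
    ((2 * r <= enorm (x - a))%R%:R * (enorm (x - a) < b)%R%:R) * g x)%:E)).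
  apply: le_intT; [by meas|by meas|move=> x].
  have E0 := epow_ge0 (p + e)%R (x - a)%R; have gx := g0 x.
  apply/andP; split; first by rewrite !mulr_ge0.
  case: (leP r (enorm (x - a))) => rx; last first.
    rewrite mul0r mulr0 mul0r addr_ge0//; last by rewrite !mulr_ge0.
    by rewrite mulr_ge0 ?powR_ge0// mulr_ge0.
  rewrite mul1r; case: (ltP (enorm (x - a)) (2 * r)%R) => rx2.
    rewrite mulr1 mul0r mulr0 mul0r addr0.
    apply: ler_wpM2r => //; rewrite -[leRHS]mulr1.
    apply: ler_pM => //; first exact: epow_le (addr_gt0 p0 e0) r0 rx.
    by rewrite lern1; case: (_ < _)%R.
  by rewrite mulr0 mulr0 add0r mul1r lexx.
rewrite intTD//; last 4 first.
- by meas.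
- by meas.
- by move=> x; rewrite !mulr_ge0 ?powR_ge0.
- by move=> x; rewrite !mulr_ge0 ?epow_ge0.
rewrite intTZ ?powR_ge0//; last 2 first.
- by meas.
- by move=> x; rewrite mulr_ge0.
apply: (@le_trans _ _ ((r `^ (- (p + e)))%:E * (eta * r `^ p)%:E +
   (eta / (1 - q) * (2 * r) `^ (- e))%:E)).
  apply: leeD; last exact: IH.
  by apply: lee_wpmul2l; [rewrite lee_fin powR_ge0|apply: Ib; rewrite r0].
rewrite -EFinM -EFinD lee_fin powRM ?(ltW r0)// -/q.
have -> : (r `^ (- (p + e)) * (eta * r `^ p) = eta * r `^ (- e))%R.
  rewrite mulrCA -powRD ?(gt_eqF r0) ?implybT//.
  by congr (_ * _ `^ _)%R; ring.
rewrite le_eqVlt; apply/orP; left; apply/eqP.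
by field; rewrite gt_eqF.
Qed.

(** The tail splits at a small radius [b]: the shells up to [b] are summed, and
   the rest is a constant, negligible against [r `^ (- e)]. *)
Lemma tail_littleo : littleo_pow I p ->
  (forall b, (0 < b)%R -> exists M : R, N b <= M%:E) -> littleo_pow N (- e).
Proof.
move=> Io Nfin eta eta0.
set q := (2 `^ (- e))%R.
have q1 : (q < 1)%R.
  rewrite /q powRN invf_lt1 ?powR_gt0//.
  have := @gt0_ltr_powR R e e0 1%R 2%R; rewrite powR1; apply; rewrite ?nnegrE//; lra.
have q1' : (0 < 1 - q)%R by rewrite subr_gt0.
pose eta1 : R := (eta / 2 * (1 - q))%R.
have eta10 : (0 < eta1)%R by rewrite mulr_gt0// divr_gt0.
have k0 : (0 < 2 `^ p :> R)%R by rewrite powR_gt0.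
have [b0 b00 b0P] := Io (eta1 / 2 `^ p)%R (divr_gt0 eta10 k0).
pose b : R := (b0 / 2)%R.
have bg : (0 < b)%R by rewrite divr_gt0.
have [M MP] := Nfin b bg.
pose M1 : R := (`|M| + 1)%R.
have M10 : (0 < M1)%R by rewrite ltr_wpDl.
pose c : R := (eta / 2 / M1)%R.
have c0 : (0 < c)%R by rewrite !divr_gt0.
exists (Num.min b (c `^ e^-1))%R => [|r /andP[r0]].
  by rewrite lt_min bg powR_gt0.
rewrite lt_min => /andP[rb rc].
have Sr : S b r <= (eta / 2 * r `^ (- e))%:E.
  have [n nP] : exists n, (b / r < 2 ^+ n)%R.
    exists (Num.truncn (b / r)).+1; apply: lt_le_trans (truncnS_gt _) _.
    by rewrite -natrX ler_nat ltnW// ltn_expl.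
  have := @shells b eta1 bg (ltW eta10) _ n r r0 _; rewrite -/q /eta1 mulfK; last first.
    by rewrite gt_eqF.
  apply.
    move=> t /andP[t0 tb]; apply: le_trans (b0P _ _) _.
      by rewrite mulr_gt0//= mulrC -ltr_pdivlMr.
    rewrite powRM ?(ltW t0)// mulrA divfK ?gt_eqF//.
  by move: nP; rewrite ltr_pdivrMr// => /ltW.
apply: (@le_trans _ _ (S b r + N b)).
  rewrite /S /N -intTD//; last 4 first.
  - by meas.
  - by meas.
  - by move=> x; rewrite !mulr_ge0 ?epow_ge0.
  - by move=> x; rewrite !mulr_ge0 ?epow_ge0.
  apply: le_intT; [by meas|by meas|move=> x].
  have E0 := epow_ge0 (p + e)%R (x - a)%R; have gx := g0 x.
  rewrite !mulr_ge0//= -mulrDl; apply: ler_wpM2r => //.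
  rewrite -mulrDr; apply: ler_wpM2l => //.
  case: (leP r (enorm (x - a))) => rx; last by rewrite addr_ge0// mulr_ge0.
  by case: (ltP (enorm (x - a)) b) => bx; rewrite ?mulr1 ?mulr0 ?addr0 ?add0r.
apply: (@le_trans _ _ ((eta / 2 * r `^ (- e))%:E + M%:E)); first exact: leeD.
rewrite -EFinD lee_fin [leRHS](_ : _ =
  eta / 2 * r `^ (- e) + eta / 2 * r `^ (- e))%R; last by field.
rewrite lerD2l; apply: le_trans (ler_norm M) _.
apply: (@le_trans _ _ M1); first by rewrite lerDl.
(* [r < c `^ e^-1] makes the constant [M1] at most [eta / 2 * r `^ (- e)] *)
have re : (r `^ e <= c)%R.
  have -> : c = ((c `^ e^-1) `^ e)%R.
    by rewrite -powRrM mulVf ?gt_eqF// powRr1// ltW.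
  by apply: ge0_ler_powR; rewrite ?nnegrE ?powR_ge0 ?(ltW e0) ?(ltW r0) ?(ltW rc).
rewrite powRN ler_pdivlMr ?powR_gt0// mulrC -ler_pdivlMr//.
Qed.

End tails.

(** * The Riesz field *)

Section riesz.
Context {R : realType} {d : nat}.
Variables (s : R) (m : {finite_measure set 'rV[R]_d -> \bar R}).
Hypothesis sd : 0 < s < d%:R.
Local Notation V := 'rV[R]_d.
Local Notation L := (@lebesgue_rV R d).
Implicit Types (x y u a v : V).
Local Open Scope ereal_scope.

Let s0 : (0 < s)%R. Proof. by case/andP: sd. Qed.
Let sn0 : (s != 0)%R. Proof. exact: lt0r_neq0. Qed.
Let d0 : (0 < d)%N.
Proof. by rewrite -(@ltr_nat R); case/andP: sd; exact: lt_trans. Qed.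

Definition mass : R := fine (m setT).

Lemma massE : m setT = mass%:E.
Proof. by rewrite fineK// fin_num_measure. Qed.

Lemma mass_ge0 : (0 <= mass)%R.
Proof. by rewrite -lee_fin -massE. Qed.

Lemma int_cst_mass (C : R) : \int[m]_y C%:E = (C * mass)%:E.
Proof. by rewrite integral_cst// EFinM; congr (_ * _); exact: massE. Qed.

Lemma le_int_mass (f : V -> \bar R) (C : R) : measurable_fun setT f ->
  (forall y, 0 <= f y <= C%:E) -> \int[m]_y f y <= (C * mass)%:E.
Proof.
move=> mf fC; rewrite -int_cst_mass; apply: ge0_le_integral => //.
- by move=> y _; case/andP: (fC y).
- by move=> y _; case/andP: (fC y).
Qed.

Lemma int_eball a (r : R) :
  \int[m]_y (((enorm (y - a) < r)%R)%:R : R)%:E = m (eball a r).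
Proof. exact: int_ball_measure. Qed.

(** The integrand of [riesz_dom], infinite on the diagonal, where [epow] is [0]. *)
Let k (z : V * V) : \bar R := ((enorm (z.1 - z.2) `^ s)%:E)^-1.

Let mk : measurable_fun setT k.
Proof.
have mt : measurable_fun setT (fun z : V * V => enorm (z.1 - z.2) `^ s)%R.
  rewrite (_ : (fun _ => _) = fun z : V * V => epow (- s) (z.1 - z.2)%R); first by meas.
  by apply/funext => z; rewrite /epow opprK.
rewrite (_ : k = fun z : V * V => if (enorm (z.1 - z.2) `^ s == 0)%R then +oo
    else (epow s (z.1 - z.2)%R)%:E).
  apply: measurable_fun_ifT => //=.
    by apply: measurable_fun_eqr => //; exact: measurable_cst.
  by meas.
by apply/funext => z; rewrite /k inver; case: ifP => // _; rewrite /epow powRN.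
Qed.

Let k0 z : 0 <= k z.
Proof. by rewrite /k inver; case: ifP => // _; rewrite lee_fin invr_ge0 powR_ge0. Qed.

Let le_epow_k z : (epow s (z.1 - z.2)%R)%:E <= k z.
Proof. by rewrite /k inver; case: ifP => _; rewrite ?leey// /epow powRN. Qed.

Let k_epow x y : x != y -> k (x, y) = (epow s (x - y)%R)%:E.
Proof.
move=> xy; have ng : (0 < enorm (x - y)%R)%R by rewrite enorm_gt0// subr_eq0.
by rewrite /k inver/= gt_eqF ?powR_gt0// /epow powRN.
Qed.

Let mkx x : measurable_fun setT (fun y => k (x, y)).
Proof. exact: (measurableT_comp mk (pair1_measurable x)). Qed.

Let mky y : measurable_fun setT (fun x => k (x, y)).
Proof. exact: (measurableT_comp mk (pair2_measurable y)). Qed.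

Let J x : \bar R := \int[m]_y k (x, y).

Let mJ : measurable_fun setT J.
Proof. exact: (measurable_fun_fubini_tonelli_F k mk k0). Qed.

Let J0 x : 0 <= J x. Proof. exact: integral_ge0. Qed.

Let domE x : (x \in riesz_dom s m) = (J x < +oo).
Proof. by apply/idP/idP; rewrite inE. Qed.

Definition riesz_pot x : \bar R := \int[m]_y (epow s (x - y))%:E.

Lemma riesz_pot_ge0 x : 0 <= riesz_pot x.
Proof. by apply: intT_ge0 => y; exact: epow_ge0. Qed.

Lemma riesz_pot_dom x : x \in riesz_dom s m -> riesz_pot x < +oo.
Proof.
rewrite domE; apply: le_lt_trans; apply: (ge0_le_integral m measurableT).
- by move=> y _; rewrite lee_fin; exact: epow_ge0.
- by meas.
- exact: mkx.
- by move=> y _; exact: (le_epow_k (x, y)).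
Qed.

(** Integrating the potential against an integrable weight and exchanging the
   integrals shows that it is almost everywhere finite. *)
Lemma riesz_dom_ae : {ae L, forall x, x \in riesz_dom s m}.
Proof.
have dp : (d%:R < d%:R + 1 :> R)%R by rewrite ltrDl.
pose p : R := (d%:R + 1)%R.
have [C C0 CP] := @int_epow_wt R d s p sd dp.
have mw : measurable_fun setT (fun x : V => (wt p x)%:E) by meas.
have mw1 : measurable_fun setT (fun z : V * V => (wt p z.1)%:E) by meas.
have w0 x : 0 <= (wt p x)%:E by rewrite lee_fin; exact/ltW/wt_gt0.
have iJ : \int[L]_x (J x * (wt p x)%:E) < +oo.
  have -> : \int[L]_x (J x * (wt p x)%:E) = \int[L]_x \int[m]_y (k (x, y) * (wt p x)%:E).
    apply: eq_integral => x _; rewrite (ge0_integralZr m measurableT (mkx x))//.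
  rewrite (@fubini_tonelli _ _ _ _ _ L m (fun z => k z * (wt p z.1)%:E)); last 2 first.
  - by apply: emeasurable_funM.
  - by move=> z; exact: mule_ge0.
  apply: (@le_lt_trans _ _ (C * mass)%:E); last exact: ltry.
  apply: le_int_mass.
    apply: (@measurable_fun_fubini_tonelli_G _ _ _ _ _ L (fun z => k z * (wt p z.1)%:E)).
      by apply: emeasurable_funM.
    by move=> z; exact: mule_ge0.
  move=> y; rewrite integral_ge0/=; last by move=> x _; exact: mule_ge0.
  apply: le_trans (CP y).
  rewrite le_eqVlt; apply/orP; left; apply/eqP.
  apply: (@eq_intT_ne _ _ d0 y).
  - exact: (emeasurable_funM (mky y) mw).
  - by meas.
  - by move=> x xy; rewrite k_epow// EFinM.
have : L.-integrable setT (fun x => J x * (wt p x)%:E).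
  apply/integrableP; split; first exact: emeasurable_funM.
  by under eq_integral do rewrite gee0_abs ?mule_ge0//.
move=> /(integrable_ae measurableT); apply: filterS => x /(_ I).
rewrite domE; move: (J0 x); case: (J x) => [t|_|//]; first by rewrite ltry.
by rewrite gt0_mulye// lte_fin; exact: wt_gt0.
Qed.

Lemma riesz_field_dom x : x \in riesz_dom s m ->
  riesz_field s m x = vint m (fun y => kern s (x - y)).
Proof. by rewrite /riesz_field => ->. Qed.

Lemma measurable_riesz_field : measurable_fun setT (riesz_field s m).
Proof.
apply: measurable_fun_rV => i.
rewrite (_ : (fun _ => _) = fun x => if J x < +oo then
   (\int[m]_y (kern s (x - y) ord0 i))%R else 0%R).
  apply: measurable_fun_ifT => //=.
    by apply: measurable_fun_lte.
  apply: (@measurable_Rint_param _ _ _ _ _ m (fun z : V * V => kern s (z.1 - z.2) ord0 i)).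
  by apply: measurable_coord_fun; meas.
apply/funext => x; rewrite /riesz_field domE; case: ifP => _; last by rewrite mxE.
by rewrite mxE.
Qed.

Lemma enorm_kernB x y : enorm (kern s (x - y)) = epow s (x - y).
Proof. exact: enorm_kern. Qed.

Lemma riesz_field_le x : (enorm (riesz_field s m x))%:E <= riesz_pot x.
Proof.
have [xd|xd] := boolP (x \in riesz_dom s m); last first.
  by rewrite /riesz_field (negbTE xd) enorm0 riesz_pot_ge0.
rewrite riesz_field_dom//; apply: le_trans (enorm_vint _ _) _; first by meas.
by under eq_integral do rewrite enorm_kernB.
Qed.

Lemma integrable_kern x : x \in riesz_dom s m ->
  m.-integrable setT (fun y => (enorm (kern s (x - y)))%:E).
Proof.
move=> xd; under eq_fun do rewrite enorm_kernB.
apply/integrableP; split; first by meas.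
under eq_integral do rewrite gee0_abs ?lee_fin ?epow_ge0//.
exact: riesz_pot_dom.
Qed.

Lemma dot_riesz_field x w : x \in riesz_dom s m ->
  (dot (riesz_field s m x) w)%:E = \int[m]_y (dot (kern s (x - y)) w)%:E.
Proof.
move=> xd; rewrite riesz_field_dom//; have [|_ ->//] := dot_vint w _ (integrable_kern xd).
by meas.
Qed.

Lemma truncated_fieldE a (r : R) : truncated_field s m a r =
  vint m (fun y => (r <= enorm (y - a))%R%:R *: kern s (a - y)).
Proof.
apply/rowP => i; rewrite !mxE Rintegral_mkcond; congr fine.
apply: eq_integral => y _; rewrite patchE; congr EFin; rewrite [RHS]mxE.
case: (boolP (y \in ~` eball a r)) => [/set_mem /= /negP|/negP yr].
  by rewrite -leNgt => ->; rewrite mul1r.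
suff -> : (r <= enorm (y - a))%R = false by rewrite mul0r.
apply/negbTE; rewrite -ltNge; apply: contrapT => h; apply: yr.
by apply/mem_set => /= h'; exact: h.
Qed.

End riesz.

(** * Comparison with truncations *)

Section truncations.
Context {R : realType} {d : nat}.
Variables (s : R) (m : {finite_measure set 'rV[R]_d -> \bar R}).
Hypothesis sd : 0 < s < d%:R.
Local Notation V := 'rV[R]_d.
Local Notation L := (@lebesgue_rV R d).
Implicit Types (x y u a v : V).
Local Open Scope ereal_scope.

Let s0 : (0 < s)%R. Proof. by case/andP: sd. Qed.
Let sn0 : (s != 0)%R. Proof. exact: lt0r_neq0. Qed.

Lemma vintB (F G : V -> V) : measurable_fun setT F -> measurable_fun setT G ->
  m.-integrable setT (fun t => (enorm (F t))%:E) ->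
  m.-integrable setT (fun t => (enorm (G t))%:E) ->
  vint m (fun t => F t - G t)%R = (vint m F - vint m G)%R.
Proof.
move=> mF mG iF iG; apply/rowP => i; rewrite !mxE.
transitivity (\int[m]_t (F t ord0 i - G t ord0 i))%R.
  by congr fine; apply: eq_integral => t _; rewrite !mxE.
by rewrite RintegralB//; exact: integrable_coord.
Qed.

(** Split the measure at radius [2 * r]: the inner part is bounded by its
   potential, and on the outer part the kernel is Lipschitz. *)
Lemma riesz_field_truncation : exists2 C : R, (0 <= C)%R & forall a r x,
  (0 < r)%R -> x \in riesz_dom s m -> (enorm (x - a) < r)%R ->
  (enorm (riesz_field s m x - truncated_field s m a (2 * r)))%:E <=
  \int[m]_y ((enorm (y - a) < 2 * r)%R%:R * epow s (x - y) +
    C * r * (epow (s + 1) (y - a) * (2 * r <= enorm (y - a))%R%:R))%:E.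
Proof.
have [C C0 CP] := @kern_lipschitz R d s s0.
exists C => // a r x r0 xd xa.
rewrite (riesz_field_dom xd) truncated_fieldE -vintB; first last.
- have r20 : (0 < 2 * r)%R by rewrite mulr_gt0.
  apply: (@integrable_le _ _ _ m _ (fun=> (2 * r) `^ (- s))%R ((2 * r) `^ (- s) * mass m)%R).
  + by meas.
  + by meas.
  + move=> y; rewrite (ger0_norm (enorm_ge0 _)) enormZ (enorm_kern _ sn0) (ger0_norm (ler0n _ _)).
    case: (leP (2 * r)%R (enorm (y - a))) => ya; last by rewrite mul0r powR_ge0.
    by rewrite mul1r -epowN opprB; exact: epow_le.
  + by rewrite int_cst_mass.
- exact: integrable_kern.
- by meas.
- by meas.
apply: le_trans (enorm_vint _ _) _; first by meas.
apply: le_intT; [by meas|by meas|move=> y].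
rewrite enorm_ge0/=.
have e1 := epow_ge0 s (x - y)%R.
case: (leP (2 * r)%R (enorm (y - a))) => ya.
  rewrite scale1r mul0r add0r mulr1.
  have -> : (x - y = (a - y) + (x - a))%R by rewrite [RHS]addrC addrA subrK.
  apply: le_trans (CP _ _ _) _.
    rewrite enormB [leRHS]enormB enormB; apply: le_trans ya.
    by rewrite ler_pM2l// ltW.
  rewrite -mulrA; apply: (ler_wpM2l C0).
  rewrite -(epowN _ (y - a)%R) opprB; apply: ler_wpM2r; first exact: epow_ge0.
  exact: ltW.
rewrite scale0r subr0 mul1r mulr0 mulr0 addr0.
by rewrite (enorm_kern _ sn0) lexx.
Qed.

(** By Tonelli the inner part of [riesz_field_truncation] is integrable over the
   ball, with [r ^+ d * r `^ (- s)] times the mass of a ball as bound; the outer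
   part is a tail integral of [m]. *)
Lemma truncation_littleo a : littleo_pow (fun r => m (eball a r)) s ->
  littleo_pow (fun r => \int[L]_x
    (enorm (riesz_field s m x - truncated_field s m a (2 * r)) *
     (enorm (x - a) < r)%R%:R)%:E) d%:R.
Proof.
move=> mo; have [C C0 CP] := riesz_field_truncation.
have [B B0 BP] := int_epow_ball sd.
have v0 := @vball_gt0 R d.
pose N r := \int[m]_y (epow (s + 1) (y - a) * (r <= enorm (y - a))%R%:R * 1)%:E.
have No : littleo_pow N (- 1).
  apply: (@tail_littleo R d m a (fun=> 1%R) _ _ s 1%R s0 ltr01).
  - by meas.
  - by [].
  - move=> eta eta0; have [delta d0 dP] := mo eta eta0; exists delta => // r rd.
    under eq_integral do rewrite mul1r.
    by rewrite int_eball; exact: dP.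
  - move=> b b0; exists (b `^ (- (s + 1)) * mass m)%R; apply: le_int_mass.
      by meas.
    move=> y; rewrite !lee_fin mulr1 mulr_ge0 ?epow_ge0//=.
    case: (leP b (enorm (y - a))) => yb; last by rewrite mulr0 powR_ge0.
    by rewrite mulr1; apply: epow_le => //; exact: addr_gt0.
have est r : (0 < r)%R -> \int[L]_x
    (enorm (riesz_field s m x - truncated_field s m a (2 * r)) *
     (enorm (x - a) < r)%R%:R)%:E <=
    (B * (r ^+ d * r `^ (- s)))%:E * m (eball a (2 * r)%R) +
    (C * r * (r ^+ d * @vball R d))%:E * N (2 * r)%R.
  move=> r0; have Cr0 := mulr_ge0 C0 (ltW r0).
  have rd0 : (0 <= r ^+ d)%R by rewrite exprn_ge0// ltW.
  pose T y : R := (epow (s + 1) (y - a) * (2 * r <= enorm (y - a))%R%:R)%R.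
  have T0 y : (0 <= T y)%R by rewrite mulr_ge0 ?epow_ge0.
  have CT0 y : (0 <= C * r * T y)%R by exact: mulr_ge0.
  pose P z : R := (epow s (z.1 - z.2) * (enorm (z.1 - a) < r)%R%:R)%R.
  have P0 z : (0 <= P z)%R by rewrite mulr_ge0 ?epow_ge0.
  pose G (z : V * V) : R := ((enorm (z.2 - a) < 2 * r)%R%:R * P z +
     (C * r * T z.2) * (enorm (z.1 - a) < r)%R%:R)%R.
  have G0 z : (0 <= G z)%R by apply: addr_ge0; apply: mulr_ge0.
  have mG : measurable_fun setT G by rewrite /G /P /T; meas.
  have mV := @measurable_riesz_field R d s m.
  apply: (@le_trans _ _ (\int[L]_x \int[m]_y (G (x, y))%:E)).
    apply: ae_ge0_le_integral => //.
    - by move=> x _; rewrite lee_fin mulr_ge0 ?enorm_ge0.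
    - by meas.
    - by move=> x _; apply: intT_ge0.
    - exact: (@measurable_int_param _ _ _ _ _ m G).
    pose Gx x (b : bool) y : R := ((enorm (y - a) < 2 * r)%R%:R *
      (epow s (x - y) * b%:R) + (C * r * T y) * b%:R)%R.
    have := @riesz_dom_ae R d s m sd; apply: filterS => x xd _.
    case: (ltP (enorm (x - a)) r) => xr; last by rewrite mulr0; apply: intT_ge0.
    rewrite mulr1; apply: le_trans (CP a r x r0 xd xr) _.
    rewrite le_eqVlt; apply/orP; left; apply/eqP; apply: eq_integral => y _.
    have <- : Gx x true y = G (x, y) by exact: (congr1 (fun b => Gx x b y) (esym xr)).
    by congr (_ * _ + _)%:E; apply/esym; exact: mulr1.
  rewrite (@tonelli_real _ _ _ _ _ L m _ mG G0).
  apply: (@le_trans _ _ (\int[m]_y (B * (r ^+ d * r `^ (- s)) *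
      (enorm (y - a) < 2 * r)%R%:R + C * r * (r ^+ d * @vball R d) * T y)%:E)).
    apply: (ge0_le_integral m measurableT).
    - by move=> y _; apply: intT_ge0.
    - apply: (@measurable_int_param _ _ _ _ _ L (fun z : V * V => G (z.2, z.1))).
      by rewrite /G /P /T /=; meas.
    - by rewrite /T; meas.
    move=> y _; rewrite /G/= intTD//; last 4 first.
    - by rewrite /P /=; meas.
    - by meas.
    - by move=> x; apply: mulr_ge0.
    - by move=> x; apply: mulr_ge0.
    rewrite intTZ//; last by rewrite /P /=; meas.
    rewrite intTZ//; last by meas.
    rewrite int_ball_ind lebesgue_ball// EFinD; apply: leeD.
      rewrite [in leRHS]mulrC [leRHS]EFinM; apply: lee_wpmul2l; first by rewrite lee_fin.
      exact: BP.
    by rewrite -EFinM lee_fin mulrAC.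
  rewrite intTD//; last 4 first.
  - by meas.
  - by rewrite /T; meas.
  - by move=> y; rewrite !mulr_ge0 ?powR_ge0.
  - by move=> y; rewrite mulr_ge0// mulr_ge0// mulr_ge0// ltW.
  rewrite intTZ//; last 2 first.
  - by meas.
  - by rewrite mulr_ge0// mulr_ge0// powR_ge0.
  rewrite intTZ//; last 2 first.
  - by rewrite /T; meas.
  - by rewrite mulr_ge0// mulr_ge0// ltW.
  rewrite int_eball /N; under [X in _ <= _ + _ * X]eq_integral do rewrite mulr1.
  exact: lexx.
move=> eta eta0.
pose K1 : R := (B * 2 `^ s)%R; pose K2 : R := (C * @vball R d / 2)%R.
have K10 : (0 <= K1)%R by rewrite mulr_ge0 ?powR_ge0.
have K20 : (0 <= K2)%R by rewrite divr_ge0// mulr_ge0// ltW.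
have K0 : (0 < K1 + K2 + 1)%R by rewrite ltr_wpDl// addr_ge0.
pose eta1 : R := (eta / (K1 + K2 + 1))%R.
have eta10 : (0 < eta1)%R by rewrite divr_gt0.
have [d1 d10 d1P] := mo eta1 eta10; have [d2 d20 d2P] := No eta1 eta10.
exists (Num.min d1 d2 / 2)%R => [|r /andP[r0]].
  by rewrite divr_gt0// lt_min d10.
rewrite ltr_pdivlMr// mulrC lt_min => /andP[rd1 rd2].
have r20 : (0 < 2 * r)%R by rewrite mulr_gt0.
have rd0 : (0 <= r ^+ d)%R by rewrite exprn_ge0// ltW.
apply: le_trans (est r r0) _.
apply: (@le_trans _ _ ((B * (r ^+ d * r `^ (- s)))%:E * (eta1 * (2 * r) `^ s)%:E +
   (C * r * (r ^+ d * @vball R d))%:E * (eta1 * (2 * r) `^ (- 1))%:E)).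
  apply: leeD; apply: lee_wpmul2l.
  - by rewrite lee_fin mulr_ge0// mulr_ge0// powR_ge0.
  - by apply: d1P; rewrite r20.
  - by rewrite lee_fin !mulr_ge0// ltW.
  - by apply: d2P; rewrite r20.
rewrite -!EFinM -EFinD lee_fin.
rewrite powRM ?(ltW r0)// [X in (X <= _)%R](_ : _ = (K1 + K2) * eta1 * r ^+ d)%R; last first.
  rewrite powRN powR_inv1 ?(ltW r20)// /K1 /K2; field.
  by rewrite (gt_eqF r0) (gt_eqF (powR_gt0 s r0)).
rewrite powR_mulrn ?(ltW r0)//; apply: ler_wpM2r => //.
rewrite /eta1 mulrCA ler_piMr ?(ltW eta0)// ler_pdivrMr// mul1r.
by rewrite lerDl.
Qed.

End truncations.

(** * Detecting mass with a test field *)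

Section detection.
Context {R : realType} {d : nat}.
Variables (s : R) (m : {finite_measure set 'rV[R]_d -> \bar R}).
Hypothesis sd : 0 < s < d%:R.
Variable p : R.
Hypotheses (dp : d%:R < p) (pd : p < d%:R + 1) (spd : s + p < d%:R + d%:R).
Local Notation V := 'rV[R]_d.
Local Notation L := (@lebesgue_rV R d).
Implicit Types (x y u a v : V).
Local Open Scope ereal_scope.

Let s0 : (0 < s)%R. Proof. by case/andP: sd. Qed.
Let sn0 : (s != 0)%R. Proof. exact: lt0r_neq0. Qed.
Let d0 : (0 < d)%N.
Proof. by rewrite -(@ltr_nat R); case/andP: sd; exact: lt_trans. Qed.
Let p0 : (0 < p)%R. Proof. by rewrite (le_lt_trans _ dp). Qed.

(** The dilation that takes the ball of radius [r] around [a] to the unit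
   ball. *)
Local Notation resc a r u := (r^-1 *: (u - a))%R.

Let resc_affine a (r : R) u : (0 < r)%R -> resc a r (r *: u + a) = u.
Proof. by move=> r0; rewrite addrK scalerA mulVf ?gt_eqF// scale1r. Qed.

Let resc_sub a (r : R) u y : (0 < r)%R ->
  (r *: u + a - y = r *: (u - resc a r y))%R.
Proof.
move=> r0; rewrite scalerBr scalerA divff ?gt_eqF// scale1r.
by rewrite opprB addrA.
Qed.

Lemma wt_ge0 u : (0 <= wt p u)%R. Proof. exact/ltW/wt_gt0. Qed.

Lemma wt_resc a (r : R) u : (0 < r)%R -> wt p (resc a r u) =
  ((enorm (u - a) < r)%R%:R + r `^ p * (epow p (u - a) * (r <= enorm (u - a))%R%:R))%R.
Proof.
move=> r0; rewrite wtE epowZ ?invr_gt0// enormZ gtr0_norm ?invr_gt0//.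
rewrite -ltr_pdivlMl ?invr_gt0// -ler_pdivrMl ?invr_gt0// invrK !mulr1.
rewrite mulrA; congr (_ + _ * _ * _)%R.
by rewrite -(powR_inv1 (ltW r0)) -powRrM mulN1r opprK.
Qed.

Let wtpos a (r : R) u : (0 <= wt p (resc a r u))%R. Proof. exact: wt_ge0. Qed.

Lemma int_epow_resc a (r : R) : (0 < r)%R -> exists2 M : R, (0 <= M)%R & forall y,
  \int[L]_u (wt p (resc a r u) * epow s (u - y))%:E <= M%:E.
Proof.
move=> r0; have [C C0 CP] := int_epow_wt sd dp.
have rd0 : (0 <= r ^+ d)%R by rewrite exprn_ge0// ltW.
exists (r ^+ d * (r `^ (- s) * C))%R => [|y].
  by rewrite mulr_ge0// mulr_ge0// powR_ge0.
rewrite (@ge0_integral_affine _ _ r a) ?gt_eqF//; last 2 first.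
- by meas.
- by move=> u; rewrite lee_fin mulr_ge0 ?epow_ge0.
rewrite (gtr0_norm r0) [leRHS]EFinM; apply: lee_wpmul2l; first by rewrite lee_fin.
under eq_integral do
  rewrite (resc_affine _ _ r0) (resc_sub _ _ _ r0) (epowZ _ _ r0) mulrCA [X in (_ * X)%R]mulrC.
rewrite intTZ ?powR_ge0//; last 2 first.
- by meas.
- by move=> u; rewrite mulr_ge0 ?epow_ge0 ?wt_ge0.
rewrite [leRHS]EFinM; apply: lee_wpmul2l; last exact: CP.
by rewrite lee_fin powR_ge0.
Qed.

Lemma int_wt_resc a (r : R) : (0 < r)%R -> exists2 M : R, (0 <= M)%R &
  \int[L]_u (wt p (resc a r u))%:E <= M%:E.
Proof.
move=> r0; have [C C0 CP] := @int_wt R d p dp.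
have rd0 : (0 <= r ^+ d)%R by rewrite exprn_ge0// ltW.
exists (r ^+ d * C)%R; first exact: mulr_ge0.
rewrite (@ge0_integral_affine _ _ r a) ?gt_eqF//; last 2 first.
- by meas.
- by move=> u; rewrite lee_fin.
rewrite (gtr0_norm r0) [leRHS]EFinM; apply: lee_wpmul2l; first by rewrite lee_fin.
by under eq_integral do rewrite (resc_affine _ _ r0).
Qed.

Let mwe a (r : R) : measurable_fun setT
  (fun z : V * V => wt p (resc a r z.1) * epow s (z.1 - z.2))%R.
Proof. by meas. Qed.

Let we0 a (r : R) (z : V * V) : (0 <= wt p (resc a r z.1) * epow s (z.1 - z.2))%R.
Proof. by rewrite mulr_ge0 ?epow_ge0. Qed.

Lemma int_int_epow_resc a (r : R) : (0 < r)%R -> exists2 M : R, (0 <= M)%R &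
  \int[L]_u \int[m]_y (wt p (resc a r u) * epow s (u - y))%:E <= M%:E.
Proof.
move=> r0; have [C C0 CP] := int_epow_resc a r0.
exists (C * mass m)%R; first by rewrite mulr_ge0 ?mass_ge0.
rewrite (@tonelli_real _ _ _ _ _ L m _ (mwe a r) (we0 a r)).
apply: le_int_mass.
  apply: (@measurable_int_param _ _ _ _ _ L
    (fun z : V * V => wt p (resc a r z.2) * epow s (z.2 - z.1))%R).
  by meas.
by move=> y; rewrite CP andbT; apply: intT_ge0 => u; exact: (we0 a r (u, y)).
Qed.

Let mV : measurable_fun setT (riesz_field s m).
Proof. exact: measurable_riesz_field. Qed.

Lemma int_field_resc a (r : R) v : (0 < r)%R -> exists2 M : R, (0 <= M)%R &
  \int[L]_u (wt p (resc a r u) * enorm (riesz_field s m u - v))%:E <= M%:E.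
Proof.
move=> r0; have [C C0 CP] := int_int_epow_resc a r0.
have [D D0 DP] := int_wt_resc a r0.
have v0 := enorm_ge0 v.
exists (C + enorm v * D)%R; first by rewrite addr_ge0// mulr_ge0.
pose F u := \int[m]_y (wt p (resc a r u) * epow s (u - y))%:E.
have F0 u : 0 <= F u by apply: intT_ge0 => y; exact: (we0 a r (u, y)).
have mF : measurable_fun setT F by exact: (@measurable_int_param _ _ _ _ _ m _ (mwe a r)).
have mG : measurable_fun setT (fun u => (enorm v * wt p (resc a r u))%:E) by meas.
have G0 u : 0 <= (enorm v * wt p (resc a r u))%:E by rewrite lee_fin mulr_ge0.
apply: (@le_trans _ _ (\int[L]_u (F u + (enorm v * wt p (resc a r u))%:E))).
  apply: (ge0_le_integral L measurableT).
  - by move=> u _; rewrite lee_fin mulr_ge0 ?enorm_ge0.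
  - by meas.
  - exact: emeasurable_funD.
  move=> u _.
  apply: (@le_trans _ _ (wt p (resc a r u) * enorm (riesz_field s m u) +
      enorm v * wt p (resc a r u))%:E).
    rewrite lee_fin [X in (_ <= _ + X)%R]mulrC -mulrDr; apply: ler_wpM2l => //.
    by apply: le_trans (enormD _ _) _; rewrite enormN.
  rewrite EFinD leeD2r// /F intTZ//; last 2 first.
  - by meas.
  - by move=> y; exact: epow_ge0.
  rewrite EFinM; apply: lee_wpmul2l; first by rewrite lee_fin.
  exact: riesz_field_le.
rewrite (ge0_integralD L measurableT (fun u _ => F0 u) mF (fun u _ => G0 u) mG).
rewrite EFinD; apply: leeD => //.
rewrite intTZ//; last by meas.
by rewrite [leRHS]EFinM; apply: lee_wpmul2l; rewrite ?lee_fin.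
Qed.

Let mtest a (r : R) : measurable_fun setT (fun u => test p (resc a r u)).
Proof. by apply: (measurableT_comp (measurable_test p)); meas. Qed.

(** Fubini and the scaling of the kernel reduce the pairing of the field with
   the rescaled test field to the pairing of one kernel with the test field. *)
Lemma mass_le_test : exists2 c : R, (0 < c)%R & forall a (r : R), (0 < r)%R ->
  (c * (r ^+ d * r `^ (- s)))%:E * m (eball a r) <=
  \int[L]_u (dot (riesz_field s m u) (test p (resc a r u)))%:E.
Proof.
have [c c0 cP] := test_detects d0 s0 dp pd spd.
have [Ct Ct0 CtP] := test_le d0 dp pd.
exists c => // a r r0.
have rr0 : (0 <= r ^+ d * r `^ (- s))%R.
  by rewrite mulr_ge0 ?powR_ge0// exprn_ge0// ltW.
have [M M0 MP] := int_int_epow_resc a r0.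
pose F (z : V * V) : R := dot (kern s (z.1 - z.2)) (test p (resc a r z.1)).
have mF : measurable_fun setT F.
  apply: measurable_dot; first by meas.
  by apply: (measurableT_comp (mtest a r)); meas.
have F_le z : (`|F z| <= Ct * (wt p (resc a r z.1) * epow s (z.1 - z.2)))%R.
  apply: le_trans (cauchy_schwarz _ _) _; rewrite (enorm_kern _ sn0).
  by rewrite mulrA [leRHS]mulrC; apply: ler_wpM2l; [exact: epow_ge0|exact: CtP].
have -> : \int[L]_u (dot (riesz_field s m u) (test p (resc a r u)))%:E =
    \int[L]_u \int[m]_y (F (u, y))%:E.
  apply: ae_eq_integral => //.
  - by apply/measurable_EFinP; exact: measurable_dot.
  - exact: (@measurable_int_param _ _ _ _ _ m _ mF).
  have := @riesz_dom_ae R d s m sd; apply: filterS => u ud _.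
  exact: dot_riesz_field.
rewrite (@fubini_real _ _ _ _ _ L m F mF); last first.
  apply: (@le_lt_trans _ _ (Ct * M)%:E); last exact: ltry.
  apply: (@le_trans _ _ (\int[L]_u \int[m]_y
      (Ct * (wt p (resc a r u) * epow s (u - y)))%:E)).
    apply: (ge0_le_integral L measurableT).
    - by move=> u _; apply: intT_ge0 => y.
    - apply: (@measurable_int_param _ _ _ _ _ m (fun z : V * V => `|F z|)%R).
      exact: measurableT_comp.
    - apply: (@measurable_int_param _ _ _ _ _ m (fun z : V * V =>
        Ct * (wt p (resc a r z.1) * epow s (z.1 - z.2)))%R).
      by meas.
    move=> u _; apply: (@le_intT _ _ _ m (fun y => `|F (u, y)|)%R).
    - by rewrite /F /=; meas.
    - by meas.
    - by move=> y; rewrite normr_ge0; exact: (F_le (u, y)).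
  under eq_integral => u _.
    rewrite intTZ//; last 2 first.
    - by meas.
    - by move=> y; exact: (we0 a r (u, y)).
    over.
  rewrite ge0_integralZl_EFin//; last 2 first.
  - by move=> u _; apply: intT_ge0 => y; exact: (we0 a r (u, y)).
  - exact: (@measurable_int_param _ _ _ _ _ m _ (mwe a r)).
  by rewrite [leRHS]EFinM; apply: lee_wpmul2l; rewrite ?lee_fin.
rewrite -int_eball -intTZ//; last 2 first.
- by meas.
- by apply: mulr_ge0 => //; exact: ltW.
apply: (ge0_le_integral m measurableT).
- by move=> y _; rewrite lee_fin mulr_ge0// mulr_ge0// ltW.
- by meas.
- apply: (@measurable_int_param _ _ _ _ _ L (fun z : V * V => F (z.2, z.1))).
  apply: (measurableT_comp mF); exact: measurable_swap.
move=> y _.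
have mFy : measurable_fun setT (fun u => (F (u, y))%:E).
  by apply/measurable_EFinP; exact: (measurableT_comp mF (pair2_measurable y)).
rewrite (integral_affine a (lt0r_neq0 r0) mFy) (gtr0_norm r0).
under [X in _ <= _ * X]eq_integral do
  rewrite /F/= (resc_affine _ _ r0) (resc_sub _ _ _ r0) (kernZ _ _ r0) dotZl EFinM.
set z := resc a r y.
have mk : measurable_fun setT (fun u => dot (kern s (u - z)) (test p u)).
  by apply: measurable_dot; [meas|exact: measurable_test].
have [B B0 BP] := int_epow_wt sd dp.
rewrite integralZl//; last first.
  apply: (@integrable_le _ _ _ L _ (fun u => Ct * (epow s (u - z) * wt p u))%R (Ct * B)%R).
  - exact: mk.
  - by meas.
  - move=> u; apply: le_trans (cauchy_schwarz _ _) _; rewrite (enorm_kern _ sn0) mulrCA.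
    by apply: ler_wpM2l; [exact: epow_ge0|exact: CtP].
  - rewrite intTZ//; last 2 first.
    + by meas.
    + by move=> u; rewrite mulr_ge0 ?epow_ge0 ?wt_ge0.
    by rewrite [leRHS]EFinM; apply: lee_wpmul2l; rewrite ?lee_fin.
have -> : ((enorm (y - a) < r)%R = (enorm z < 1)%R).
  by rewrite /z enormZ gtr0_norm ?invr_gt0// ltr_pdivrMl// mulr1.
rewrite muleA -EFinM mulrAC mulrC [leLHS]EFinM; apply: lee_wpmul2l; first by rewrite lee_fin.
exact: cP.
Qed.

(** The test field is odd, so a constant may be subtracted from the field. *)
Lemma int_field_test : exists2 C : R, (0 <= C)%R & forall a (r : R) v, (0 < r)%R ->
  \int[L]_u (dot (riesz_field s m u) (test p (resc a r u)))%:E <=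
  C%:E * \int[L]_u (wt p (resc a r u) * enorm (riesz_field s m u - v))%:E.
Proof.
have [Ct Ct0 CtP] := test_le d0 dp pd.
exists Ct => // a r v r0.
have mwV w : measurable_fun setT (fun u =>
   wt p (resc a r u) * enorm (riesz_field s m u - w))%R by meas.
have wV0 w u : (0 <= wt p (resc a r u) * enorm (riesz_field s m u - w))%R.
  by rewrite mulr_ge0 ?enorm_ge0.
have i1 : L.-integrable setT (EFin \o
    (fun u => dot (riesz_field s m u) (test p (resc a r u)))).
  have [M M0 MP] := int_field_resc a 0%R r0.
  apply: (@integrable_le _ _ _ L _
    (fun u => Ct * (wt p (resc a r u) * enorm (riesz_field s m u - 0)))%R (Ct * M)%R).
  - exact: measurable_dot.
  - exact: (measurable_funM (measurable_cst Ct) (mwV 0%R)).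
  - move=> u; apply: le_trans (cauchy_schwarz _ _) _.
    rewrite subr0 mulrA [leRHS]mulrC; apply: ler_wpM2l; [exact: enorm_ge0|exact: CtP].
  - rewrite intTZ//.
    by rewrite [leRHS]EFinM; apply: lee_wpmul2l; rewrite ?lee_fin.
have i2 : L.-integrable setT (EFin \o (fun u => dot v (test p (resc a r u)))).
  have [M M0 MP] := int_wt_resc a r0.
  apply: (@integrable_le _ _ _ L _
    (fun u => Ct * enorm v * wt p (resc a r u))%R (Ct * enorm v * M)%R).
  - by apply: measurable_dot => //; exact: measurable_cst.
  - by meas.
  - move=> u; apply: le_trans (cauchy_schwarz _ _) _.
    rewrite mulrAC [leRHS]mulrC; apply: ler_wpM2l; [exact: enorm_ge0|exact: CtP].
  - have Cv0 : (0 <= Ct * enorm v)%R by rewrite mulr_ge0 ?enorm_ge0.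
    rewrite intTZ//; last by meas.
    by rewrite [leRHS]EFinM; apply: lee_wpmul2l; rewrite ?lee_fin.
have o2 : \int[L]_u (dot v (test p (resc a r u)))%:E = 0.
  pose f u : R := dot v (test p (resc a r u)).
  have mf : measurable_fun setT (fun u => (f u)%:E).
    by apply/measurable_EFinP; apply: measurable_dot => //; exact: measurable_cst.
  have fN u : f (a + a - u)%R = (- f u)%R.
    rewrite /f -dotNr -(testN d0 dp pd) -scalerN; congr (dot v (test p (_ *: _))).
    by rewrite opprB addrAC addrK.
  have : \int[L]_u (f u)%:E = (-1)%:E * \int[L]_u (f u)%:E.
    rewrite -[LHS](integral_flip (a + a) mf) -(integralZl measurableT i2).
    by apply: eq_integral => u _; rewrite fN -EFinM mulN1r.
  rewrite -(RintE i2) -EFinM => -[h]; congr EFin.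
  by move: h; set t := Rintegral _ _ _; lra.
rewrite -[leLHS]sube0 -o2 -integralB_EFin// -intTZ//.
apply: le_integral => //.
- exact: (integrableB measurableT i1 i2).
- have [M M0 MP] := int_field_resc a v r0.
  apply: (@integrable_le _ _ _ L _
    (fun u => Ct * (wt p (resc a r u) * enorm (riesz_field s m u - v)))%R (Ct * M)%R).
  + exact: (measurable_funM (measurable_cst Ct) (mwV v)).
  + exact: (measurable_funM (measurable_cst Ct) (mwV v)).
  + by move=> u; rewrite ger0_norm// mulr_ge0.
  + rewrite intTZ//.
    by rewrite [leRHS]EFinM; apply: lee_wpmul2l; rewrite ?lee_fin.
move=> u _; rewrite -EFinB lee_fin -dotBl.
apply: le_trans (dot_le _ _) _.
rewrite mulrA [leRHS]mulrC; apply: ler_wpM2l; [exact: enorm_ge0|exact: CtP].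
Qed.

(** After rescaling, the weight that dominates the test field is the indicator of
   the ball plus a tail, to which [tail_littleo] applies with Lebesgue measure
   and the density [enorm (riesz_field s m x - v)]. *)
Lemma density_littleo a v :
  littleo_pow (fun r => \int[L]_x
    (enorm (riesz_field s m x - v) * (enorm (x - a) < r)%R%:R)%:E) d%:R ->
  littleo_pow (fun r => m (eball a r)) s.
Proof.
move=> Io; have [c c0 cP] := mass_le_test; have [C C0 CP] := int_field_test.
pose e : R := (p - d%:R)%R.
have e0 : (0 < e)%R by rewrite subr_gt0.
have dR0 : (0 < d%:R :> R)%R by rewrite ltr0n.
have de : (d%:R + e = p)%R by rewrite /e addrC subrK.
pose g x : R := enorm (riesz_field s m x - v).
have mg : measurable_fun setT g by rewrite /g; meas.
have g0 x : (0 <= g x)%R by exact: enorm_ge0.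
pose N r := \int[L]_x (epow p (x - a) * (r <= enorm (x - a))%R%:R * g x)%:E.
have No : littleo_pow N (- e).
  have := @tail_littleo R d L a g mg g0 d%:R e dR0 e0; rewrite de; apply => //.
  move=> b b0; have [M M0 MP] := int_field_resc a v b0.
  exists (b `^ (- p) * M)%R.
  apply: (@le_trans _ _ (\int[L]_x (b `^ (- p) *
     (wt p (resc a b x) * g x))%:E)).
    apply: le_intT; [by meas|by meas|move=> x].
    apply/andP; split; first by rewrite !mulr_ge0 ?epow_ge0.
    rewrite mulrA; apply: ler_wpM2r => //; rewrite (wt_resc _ _ b0) mulrDr mulrA.
    rewrite -powRD ?(gt_eqF b0) ?implybT// addNr powRr0 mul1r lerDr.
    by rewrite mulr_ge0 ?powR_ge0.
  rewrite intTZ ?powR_ge0//; last 2 first.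
  - by meas.
  - by move=> x; exact: mulr_ge0.
  by rewrite [leRHS]EFinM; apply: lee_wpmul2l; rewrite ?lee_fin ?powR_ge0.
move=> eta eta0.
have K0 : (0 < 2 * C + 1)%R by rewrite ltr_wpDl// mulr_ge0.
pose eta1 : R := (eta * c / (2 * C + 1))%R.
have eta10 : (0 < eta1)%R by rewrite divr_gt0// mulr_gt0.
have [d1 d10 d1P] := Io eta1 eta10; have [d2 d20 d2P] := No eta1 eta10.
exists (Num.min d1 d2)%R => [|r /andP[r0]]; first by rewrite lt_min d10.
rewrite lt_min => /andP[rd1 rd2].
have rd0 : (0 < r ^+ d)%R by rewrite exprn_gt0.
have rs0 : (0 < r `^ s)%R by rewrite powR_gt0.
have k0 : (0 < c * (r ^+ d * r `^ (- s)))%R by rewrite !mulr_gt0// powR_gt0.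
suff : (c * (r ^+ d * r `^ (- s)))%:E * m (eball a r) <=
    (c * (r ^+ d * r `^ (- s)))%:E * (eta * r `^ s)%:E.
  by rewrite lee_pmul2l// lte_fin.
apply: le_trans (cP a r r0) _; apply: le_trans (CP a r v r0) _.
apply: (@le_trans _ _ (C%:E * (eta1 * r ^+ d + r `^ p * (eta1 * r `^ (- e)))%:E)).
  apply: lee_wpmul2l; first by rewrite lee_fin.
  under eq_integral do rewrite (wt_resc _ _ r0) mulrDl -/(g _) [X in (X + _)%R]mulrC
    -[X in (_ + X)%R]mulrA.
  rewrite intTD//; last 4 first.
  - by meas.
  - by meas.
  - by move=> x; rewrite mulr_ge0.
  - by move=> x; rewrite !mulr_ge0 ?powR_ge0 ?epow_ge0.
  rewrite intTZ ?powR_ge0//; last 2 first.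
  - by meas.
  - by move=> x; rewrite !mulr_ge0 ?epow_ge0.
  rewrite EFinD [X in _ <= _ + X]EFinM; apply: leeD.
    by rewrite -powR_mulrn ?(ltW r0)//; apply: d1P; rewrite r0.
  apply: lee_wpmul2l; first by rewrite lee_fin powR_ge0.
  by apply: d2P; rewrite r0.
rewrite -!EFinM lee_fin.
have -> : (r `^ p * (eta1 * r `^ (- e)) = eta1 * r ^+ d)%R.
  rewrite mulrCA -powRD ?(gt_eqF r0) ?implybT// -powR_mulrn ?(ltW r0)//.
  by congr (_ * _ `^ _)%R; rewrite -de addrK.
rewrite [leRHS](_ : _ = eta * c * r ^+ d)%R; last first.
  by rewrite powRN; field; rewrite gt_eqF.
rewrite [leLHS](_ : _ = 2 * C * eta1 * r ^+ d)%R; last by ring.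
apply: ler_wpM2r; first exact: ltW.
rewrite /eta1 mulrCA ler_piMr ?(ltW (mulr_gt0 eta0 c0))// ler_pdivrMr// mul1r.
by rewrite lerDl.
Qed.

End detection.

(** * Lebesgue points *)

Section lebesgue_points.
Context {R : realType} {d : nat}.
Local Notation V := 'rV[R]_d.
Local Notation L := (@lebesgue_rV R d).
Implicit Types (a v : V) (f : V -> V).
Local Open Scope ereal_scope.

Lemma eq_cvg_right0 (F G : R -> \bar R) :
  (forall r, (0 < r)%R -> F r = G r) -> (forall r, (0 < r)%R -> 0 <= G r) ->
  (F r @[r --> (0%R : R)^'+] --> 0) <-> (G r @[r --> (0%R : R)^'+] --> 0).
Proof.
move=> FG G0; have F0 r : (0 < r)%R -> 0 <= F r by move=> r0; rewrite FG// G0.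
rewrite (cvg_right0P F0) (cvg_right0P G0).
by split=> H eta /H [delta d0 dP]; exists delta => // r rd;
  have := dP r rd; rewrite FG//; case/andP: rd.
Qed.

Lemma is_precise_valueP f a v : is_precise_value f a v <->
  littleo_pow (fun r => \int[L]_x (enorm (f x - v) * (enorm (x - a) < r)%R%:R)%:E) d%:R.
Proof.
have v0 := @vball_gt0 R d.
have I0 r : 0 <= \int[L]_x (enorm (f x - v) * (enorm (x - a) < r)%R%:R)%:E.
  by apply: intT_ge0 => x; rewrite mulr_ge0 ?enorm_ge0.
have vi0 : (0 < (@vball R d)^-1)%R by rewrite invr_gt0.
have pP := littleo_powP d%:R vi0 (fun r _ => I0 r).
apply: iff_trans pP; apply: eq_cvg_right0 => r r0; last first.
  by apply: mule_ge0 => //; rewrite lee_fin mulr_ge0 ?powR_ge0// ltW.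
rewrite /average_dev lebesgue_ball// inver.
have rd0 : (0 < r ^+ d * @vball R d)%R by rewrite mulr_gt0// exprn_gt0.
rewrite (gt_eqF rd0) invfM mulrC powRN powR_mulrn ?(ltW r0)//; congr (_ * _).
exact: (@integral_ind _ _ _ L (eball a r) _ (fun x => (enorm (x - a) < r)%R)).
Qed.

Lemma density0P (s : R) (m : {measure set V -> \bar R}) a :
  (m (eball a r) * (r `^ s)%:E^-1 @[r --> (0%R : R)^'+] --> 0) <->
  littleo_pow (fun r => m (eball a r)) s.
Proof.
have pP := @littleo_powP R (fun r => m (eball a r)) s 1%R ltr01
  (fun r _ => measure_ge0 m _).
apply: iff_trans pP; apply: eq_cvg_right0 => r r0; last first.
  by apply: mule_ge0 => //; rewrite lee_fin mul1r powR_ge0.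
by rewrite inver gt_eqF ?powR_gt0// muleC mul1r powRN.
Qed.

Variables (s : R) (m : {finite_measure set V -> \bar R}).
Hypothesis sd : (0 < s < d%:R)%R.

Let mV : measurable_fun setT (riesz_field s m).
Proof. exact: measurable_riesz_field. Qed.

(** The mean over the ball of the distance from the field to the truncation at
   radius [2 * r] is small, so the field is on average close to [v] exactly when
   the truncation is. *)
Lemma precise_value_truncation a v : littleo_pow (fun r => m (eball a r)) s ->
  is_precise_value (riesz_field s m) a v <->
  (truncated_field s m a e @[e --> (0%R : R)^'+] --> v).
Proof.
move=> /(truncation_littleo sd) To; rewrite is_precise_valueP cvg_right0_enormP.
pose W r x := enorm (riesz_field s m x - truncated_field s m a (2 * r)).
pose D r := enorm (truncated_field s m a (2 * r) - v).
pose ib r x : R := (enorm (x - a) < r)%R%:R.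
have v0 := @vball_gt0 R d.
have mW r : measurable_fun setT (fun x => W r x * ib r x)%R by rewrite /W /ib; meas.
have W0 r x : (0 <= W r x * ib r x)%R by rewrite mulr_ge0 ?enorm_ge0.
have mI r : measurable_fun setT
  (fun x => enorm (riesz_field s m x - v) * ib r x)%R by rewrite /ib; meas.
have I0 r x : (0 <= enorm (riesz_field s m x - v) * ib r x)%R.
  by rewrite mulr_ge0 ?enorm_ge0.
have D0 r : (0 <= D r)%R by exact: enorm_ge0.
have mD r : measurable_fun setT (fun x => D r * ib r x)%R by rewrite /ib; meas.
have iD0 r x : (0 <= D r * ib r x)%R by rewrite mulr_ge0.
have iD r : (0 < r)%R -> \int[L]_x (D r * ib r x)%:E = (D r * (r ^+ d * @vball R d))%:E.
  move=> r0; rewrite intTZ//; last by rewrite /ib; meas.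
  by rewrite int_ball_ind lebesgue_ball// EFinM.
split=> [Io eta eta0|H eta eta0].
- have eta10 : (0 < eta * @vball R d / 2)%R by rewrite divr_gt0// mulr_gt0.
  have [d1 d10 d1P] := To _ eta10; have [d2 d20 d2P] := Io _ eta10.
  exists (2 * Num.min d1 d2)%R => [|e /andP[e0 ed]].
    by rewrite mulr_gt0// lt_min d10.
  pose r : R := (e / 2)%R.
  have r0 : (0 < r)%R by rewrite divr_gt0.
  have er : (e = 2 * r)%R by rewrite /r mulrCA divff// mulr1.
  move: ed; rewrite er ltr_pM2l// lt_min => /andP[rd1 rd2].
  have rd0 : (0 < r ^+ d * @vball R d)%R by rewrite mulr_gt0// exprn_gt0.
  rewrite -/(D r) -(ler_pM2r rd0) -lee_fin -(iD _ r0).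
  apply: (@le_trans _ _ (\int[L]_x (W r x * ib r x +
      enorm (riesz_field s m x - v) * ib r x)%:E)).
    apply: le_intT => //; first exact: measurable_funD.
    move=> x; rewrite iD0/= -mulrDl; apply: ler_wpM2r => //.
    rewrite /D /W (enormB (riesz_field s m x) (truncated_field s m a _)).
    exact: enorm_triangle.
  rewrite intTD//.
  apply: (@le_trans _ _ ((eta * @vball R d / 2 * r `^ d%:R)%:E +
     (eta * @vball R d / 2 * r `^ d%:R)%:E)).
    by apply: leeD; [apply: d1P|apply: d2P]; rewrite r0.
  rewrite -EFinD lee_fin powR_mulrn ?(ltW r0)// le_eqVlt; apply/orP; left.
  by apply/eqP; field.
pose K : R := (@vball R d + 1)%R.
have K0 : (0 < K)%R by rewrite addr_gt0.
have eta10 : (0 < eta / K)%R by rewrite divr_gt0.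
have [d1 d10 d1P] := To _ eta10; have [d2 d20 d2P] := H _ eta10.
exists (Num.min d1 (d2 / 2))%R => [|r /andP[r0]].
  by rewrite lt_min d10 divr_gt0.
rewrite lt_min ltr_pdivlMr// mulrC => /andP[rd1 rd2].
apply: (@le_trans _ _ (\int[L]_x (W r x * ib r x + D r * ib r x)%:E)).
  apply: le_intT; [exact: mI|exact: measurable_funD|].
  move=> x; rewrite I0/= -mulrDl; apply: ler_wpM2r => //.
  exact: enorm_triangle.
rewrite intTD// (iD _ r0).
apply: (@le_trans _ _ ((eta / K * r `^ d%:R)%:E +
   (eta / K * (r ^+ d * @vball R d))%:E)).
  apply: leeD; first by apply: d1P; rewrite r0.
  rewrite lee_fin; apply: ler_wpM2r; last by apply: d2P; rewrite mulr_gt0.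
  by rewrite mulr_ge0 ?(ltW v0)// exprn_ge0// ltW.
rewrite -EFinD lee_fin powR_mulrn ?(ltW r0)// le_eqVlt; apply/orP; left.
by apply/eqP; rewrite /K; field; rewrite gt_eqF.
Qed.

(** The exponent of the test field must exceed [d] by less than both [1] and
   [d - s]. *)
Lemma precise_value_density a v : is_precise_value (riesz_field s m) a v ->
  littleo_pow (fun r => m (eball a r)) s.
Proof.
move=> /is_precise_valueP.
pose e : R := (Num.min 1 (d%:R - s) / 2)%R.
have [e0 e1 es] : [/\ (0 < e)%R, (e < 1)%R & (e < d%:R - s)%R].
  case/andP: sd => s0 sd'.
  rewrite /e; case: (lerP 1 (d%:R - s)%R) => h; split; lra.
apply: (@density_littleo _ _ s m sd (d%:R + e)%R).
- by rewrite ltrDl.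
- by rewrite ltrD2l.
- by rewrite addrCA ltrD2l; move: es; lra.
Qed.

Lemma pv_cvg a v : truncated_field s m a e @[e --> (0%R : R)^'+] --> v ->
  pv s m a = v.
Proof. by move=> h; apply: cvg_lim => //; exact: norm_hausdorff. Qed.

End lebesgue_points.

Theorem theorem1p1 (R : realType) (d : nat) (hd : (1 <= d)%N) (s : R)
    (hs : 0 < s < d%:R) (m : {finite_measure set 'rV[R]_d -> \bar R})
    (a : 'rV[R]_d) :
  (lebesgue_point (riesz_field s m) a <->
     has_pv s m a /\
     (m (eball a r) * (r `^ s)%:E^-1)%E @[r --> (0 : R)^'+] --> 0%E) /\
  (lebesgue_point (riesz_field s m) a ->
     precise_representative (riesz_field s m) a = pv s m a).
Proof.
split; first split.
- move=> [v vP]; have mo := precise_value_density hs vP.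
  split; last exact/density0P.
  by exists v; exact/(precise_value_truncation hs v mo).
- move=> [[v vP] /density0P mo].
  by exists v; exact/(precise_value_truncation hs v mo).
- move=> [v vP].
  have wP : is_precise_value (riesz_field s m) a
      (precise_representative (riesz_field s m) a) := getI vP.
  have mo := precise_value_density hs wP.
  by apply/esym/pv_cvg/(precise_value_truncation hs _ mo).
Qed.
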